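(* Let the tree data $T,k,b_j,\tilde p_j,\alpha_j$ and the spaces $W_{2,\alpha}^s$ be as defined in the context, and let $L_{2,\alpha}=W_{2,\alpha}^0$. Consider the operator $\mathcal{L}$ in $L_{2,\alpha}$ given by $\mathcal{L}y=[\mathcal{L}_jy]_{j\in\mathbb{N}}$, $$\mathcal{L}_jy(t)=-y_j''(t)-2i(\mathrm{Im}\,b_j)\,y_j'(t)+|b_j|^2y_j(t),\quad 0<t<1,\quad j\in\mathbb{N},$$ whose domain consists of all tuples $y=[y_j]\in W_{2,\alpha}^2$ satisfying $$y_1(0)=0;\qquad y_{k_j}(1)=y_j(0),\ j\ge2;\qquad y_j(1)=0,\ j\in\mathbb{N}_2;$$ $$y_j'(1)+\beta_jy_j(1)=\sum_{\nu\in V_j}\tilde p_\nu\, y_\nu'(0),\qquad \beta_j:=b_j-\sum_{\nu\in V_j}\tilde p_\nu b_\nu,\qquad j\in\mathbb{N}_1.$$ Then $\mathcal{L}$ is a self-adjoint positive definite operator in $L_{2,\alpha}$.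
   Context: Tree. $\mathbb{N}=\{1,2,\dots\}$. Fix an integer $T\ge2$. If $T\ge3$, let $\mathbb{N}_1$ be the set of odd positive integers and $\mathbb{N}_2=\mathbb{N}\setminus\mathbb{N}_1$; if $T=2$, let $\mathbb{N}_1=\{1\}$ and $\mathbb{N}_2=\mathbb{N}\setminus\{1\}$. The infinite rooted tree $\mathcal{T}$ has vertices $v_0,v_1,v_2,\dots$; $v_0$ is the root, the $v_j$ with $j\in\mathbb{N}_1$ are the internal vertices and the $v_j$ with $j\in\mathbb{N}_2\cup\{0\}$ are the boundary vertices. Its edges are $e_j=[v_{k_j},v_j]$, $j\in\mathbb{N}$, where $j\mapsto k_j$ is a map from $\mathbb{N}$ onto $\mathbb{N}_1\cup\{0\}$. Put $V_j=\{\nu\in\mathbb{N}:k_\nu=j\}$ for $j\in\mathbb{N}_1\cup\{0\}$ (indices of the edges leaving $v_j$). The map satisfies: $k_1=0$ and $V_0=\{1\}$; $V_j$ is countably infinite for every $j\in\mathbb{N}_1$; for each $j\in\mathbb{N}$, with $k_j^{\{0\}}=j$ and $k_j^{\{\nu+1\}}=k_{k_j^{\{\nu\}}}$, there is $\nu_j\ge0$ with $k_j^{\{\nu_j\}}=1$; and the tree has exactly $T$ tiers with all leaves other than the root at the last tier, i.e. $\nu_j+1\le T-1$ for $j\in\mathbb{N}_1$ and $\nu_j+1=T$ for $j\in\mathbb{N}_2$. Each edge $e_j$ is parametrized by $t\in[0,1]$, with $t=0$ at $v_{k_j}$ and $t=1$ at $v_j$. Coefficients and weights. Given are $b_1\in\mathbb{C}$,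 a sequence $(\theta_l)_{l\in\mathbb{N}}\subset\mathbb{C}$ with $\sup_l|\theta_l|<\infty$, and numbers $p_l>0$ with $\sum_{l=1}^\infty p_l=1$. For each $j\in\mathbb{N}_1$ enumerate $V_j=\{\nu_{j,l}\}_{l\in\mathbb{N}}$ (without repetition) and set $b_{\nu_{j,l}}=\theta_l$, $\tilde p_{\nu_{j,l}}=p_l$. This defines $b_j$ for all $j\in\mathbb{N}$ and $\tilde p_j$ for all $j\ge2$. Set $\alpha_1=1$ and $\alpha_j=\prod_{\nu=0}^{\nu_j-1}\tilde p_{k_j^{\{\nu\}}}$ for $j\ge2$; equivalently $\alpha_j=\tilde p_j\alpha_{k_j}$ for $j\ge2$. Spaces. For an integer $s\ge0$, $W_{2,\alpha}^s$ is the Hilbert space of tuples $y=[y_j]_{j\in\mathbb{N}}$ of complex-valued functions $y_j\in W_2^s[0,1]$ (Sobolev space; $W_2^0=L_2$) with $\|y\|_s^2=\langle y,y\rangle_s<\infty$, where $\langle y,z\rangle_s=\sum_{j=1}^\infty\alpha_j\langle y_j,z_j\rangle_{W_2^s[0,1]}$. Convention. A (possibly unbounded) operator $A$ in a Hilbert space is positive definite if there is $c>0$ with $\langle Ay,y\rangle\ge c\|y\|^2$ for all $y$ in its domain. *)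

(* Defs.v *)
From HB Require Import structures.
From mathcomp Require Import all_boot all_order all_algebra.
From mathcomp Require Import all_classical all_reals all_analysis.
From mathcomp Require Import complex.

Set Implicit Arguments.
Unset Strict Implicit.
Unset Printing Implicit Defensive.

Import Order.TTheory GRing.Theory Num.Theory numFieldNormedType.Exports.

Local Open Scope classical_set_scope.
Local Open Scope ring_scope.
Local Open Scope complex_scope.

(** * Unbounded operators

    [V] carries a semi-inner product [ip], linear in its first argument, which
    is used on the subspace [H].  The Hilbert space is the quotient of [H] by
    the vectors of norm zero: [null (x - y)] is equality in it.  An operator is
    given by its graph [G], where [G y f] means that [y] is in the domain and
    is mapped to [f]. *)
Section Operators.
Context {R : realType} {V : lmodType R[i]}.
Variables (H : set V) (ip : V -> V -> R[i]).
Implicit Type G : V -> V -> Prop.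

Definition null (x : V) : Prop := ip x x = 0.

Record linear_operator G : Prop := LinearOperator {
  lop_carrier : forall y f, G y f -> H y /\ H f;
  lop_zero    : G 0 0;
  lop_linear  : forall (a : R[i]) y f z g,
      G y f -> G z g -> G (a *: y + z) (a *: f + g);
  lop_compat  : forall y f y' f', G y f -> H y' -> H f' ->
      null (y - y') -> null (f - f') -> G y' f';
  lop_single  : forall y f y' f', G y f -> G y' f' ->
      null (y - y') -> null (f - f')
}.

Definition densely_defined G : Prop :=
  forall x, H x -> forall eps : R, 0 < eps ->
    exists y f, G y f /\ ip (x - y) (x - y) < eps%:C.

Definition adjoint G : V -> V -> Prop := fun z g =>
  [/\ H z, H g & forall y f, G y f -> ip f z = ip y g].

Definition self_adjoint G : Prop :=
  [/\ linear_operator G, densely_defined G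
    & forall z g, G z g <-> adjoint G z g].

(** In the order of [R[i]], [u <= v] says that [v - u] is real and
    nonnegative. *)
Definition positive_definite G : Prop :=
  exists c : R, 0 < c /\ forall y f, G y f -> c%:C * ip y y <= ip f y.

End Operators.

(** * The tree *)

Definition N1 (T j : nat) : bool := (if T == 2 then j == 1 else odd j)%N.
Definition N2 (T j : nat) : bool := (0 < j)%N && ~~ N1 T j.

Definition out_edges (k : nat -> nat) (j : nat) : set nat :=
  [set n | (0 < n)%N /\ k n = j].

(** The parent map [k] matters on positive indices only.  The value [k 0 = 0]
    is a normalization: with it [iter n k j = 1] for at most one [n], so that
    the depth [nu] is determined by [k]. *)
Record is_tree (T : nat) (k nu : nat -> nat) : Prop := IsTree {
  tree_k0       : k 0%N = 0%N;
  tree_k1       : k 1%N = 0%N;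
  tree_root     : out_edges k 0%N = [set 1%N];
  tree_onto     : k @` [set n | (0 < n)%N] = [set j | N1 T j \/ j = 0%N];
  tree_infinite : forall j, N1 T j -> infinite_set (out_edges k j);
  tree_depth    : forall j, (0 < j)%N -> iter (nu j) k j = 1%N;
  tree_internal : forall j, N1 T j -> (nu j + 1 <= T - 1)%N;
  tree_leaf     : forall j, N2 T j -> (nu j + 1)%N = T
}.

(** * Complex-valued integrals, series and Sobolev functions on [0, 1] *)

Section Analysis.
Context {R : realType}.
Local Notation C := R[i].
Local Notation mu := (@lebesgue_measure R).
Local Notation I01 := (`[(0 : R), 1]%classic : set R).
Implicit Types (f g : R -> C) (u : nat -> C).

Definition cintegral (A : set R) f : C :=
  (\int[mu]_(t in A) complex.Re (f t)) +i* (\int[mu]_(t in A) complex.Im (f t)).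

Definition csum u : C :=
  (limn (series (fun n => complex.Re (u n))))
    +i* (limn (series (fun n => complex.Im (u n)))).

Definition cmeasurable f : Prop :=
  measurable_fun I01 (fun t => complex.Re (f t)) /\
  measurable_fun I01 (fun t => complex.Im (f t)).

Definition sqnorm f : \bar R :=
  (\int[mu]_(t in I01) (Normc.normc (f t) ^+ 2)%:E)%E.

Definition L2 f : Prop := cmeasurable f /\ (sqnorm f < +oo)%E.

Definition ae_eq01 f g : Prop := {ae mu, forall t, I01 t -> f t = g t}.

(** [f] is absolutely continuous on [0, 1] with derivative [g]. *)
Definition is_primitive f g : Prop :=
  forall t, I01 t -> f t = f 0 + cintegral `[(0 : R), t] g.

(** The class of [f] belongs to W_2^s[0, 1] and [d m] is its [m]-th
    derivative, for [m <= s].  For [m < s], [d m] is the absolutely continuous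
    representative, whose values at the points of [0, 1], the endpoints
    included, are meaningful; [d s] is determined almost everywhere. *)
Record sobolev (s : nat) f (d : nat -> R -> C) : Prop := Sobolev {
  sob_repr  : cmeasurable f /\ ae_eq01 f (d 0%N);
  sob_L2    : forall m, (m <= s)%N -> L2 (d m);
  sob_deriv : forall m, (m < s)%N -> is_primitive (d m) (d m.+1)
}.

End Analysis.

(** * Spaces of tuples over the tree

    A tuple [y_j], [j >= 1], of functions on [0, 1] is represented by
    [y : nat -> R -> R[i]]; [y 0] and the values outside [0, 1] are ignored. *)
Section Tuples.
Context {R : realType}.
Local Notation C := R[i].
Local Notation tuples := (nat -> R -> C).

Definition alpha (k nu : nat -> nat) (pt : nat -> R) (j : nat) : R :=
  \prod_(n < nu j) pt (iter n k j).

Definition L2a (al : nat -> R) (y : tuples) : Prop :=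
  (forall j, (0 < j)%N -> L2 (y j)) /\
  (\sum_(1 <= j <oo) (al j)%:E * sqnorm (y j) < +oo)%E.

Definition ipa (al : nat -> R) (y z : tuples) : C :=
  csum (fun j => if j == 0%N then 0
                 else (al j)%:C * cintegral `[(0 : R), 1] (fun t => y j t * (z j t)^*)).

(** [d j m] is the [m]-th derivative of [y j]. *)
Definition W2a (al : nat -> R) (s : nat) (y : tuples)
    (d : nat -> nat -> R -> C) : Prop :=
  (forall j, (0 < j)%N -> sobolev s (y j) (d j)) /\
  (\sum_(1 <= j <oo)
     (al j)%:E * (\sum_(m < s.+1) sqnorm (d j m))%E < +oo)%E.

(** Sum over the edges leaving [v_j].  The series it is used for below
    converge absolutely. *)
Definition sum_out (k : nat -> nat) (j : nat) (u : nat -> C) : C :=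
  csum (fun n => if (0 < n)%N && (k n == j) then u n else 0).

Definition beta (k : nat -> nat) (pt : nat -> R) (b : nat -> C) (j : nat) : C :=
  b j - sum_out k j (fun n => (pt n)%:C * b n).

Record boundary_conditions (T : nat) (k : nat -> nat) (pt : nat -> R)
    (b : nat -> C) (d : nat -> nat -> R -> C) : Prop := BoundaryConditions {
  bc_root      : d 1%N 0%N 0 = 0;
  bc_cont      : forall j, (2 <= j)%N -> d (k j) 0%N 1 = d j 0%N 0;
  bc_leaf      : forall j, N2 T j -> d j 0%N 1 = 0;
  bc_kirchhoff : forall j, N1 T j ->
    d j 1%N 1 + beta k pt b j * d j 0%N 1 =
      sum_out k j (fun n => (pt n)%:C * d n 1%N 0)
}.

Definition Lexpr (b : nat -> C) (d : nat -> nat -> R -> C) : tuples :=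
  fun j t => - d j 2%N t - 2%:R * 'i * (complex.Im (b j))%:C * d j 1%N t
             + `|b j| ^+ 2 * d j 0%N t.

(** The graph of the operator: its domain consists of all [y] in W_{2,alpha}^2
    with [boundary_conditions]. *)
Definition Lop (T : nat) (k nu : nat -> nat) (pt : nat -> R) (b : nat -> C)
    (y f : tuples) : Prop :=
  exists d : nat -> nat -> R -> C,
    [/\ W2a (alpha k nu pt) 2 y d,
        boundary_conditions T k pt b d
      & forall j, (0 < j)%N ->
          cmeasurable (f j) /\ ae_eq01 (f j) (Lexpr b d j)].

End Tuples.

(* Main.v *)
(** On each edge the differential expression factors as
    [(- d/dt + conj b_j) (d/dt + b_j)].  With [u_j = y_j' + b_j y_j],
    Kirchhoff's condition becomes [u_j(1) = sum pt_n u_n(0)] over the edges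
    leaving [v_j], with no [beta_j] left, and since [alpha_n = pt_n alpha_j] on
    those edges all boundary terms in Green's formula cancel:
    [<L y, z> = <u, w>], where [w_j = z_j' + b_j z_j].  This is symmetry, and
    integrating [y_j' + b_j y_j = u_j] from the root gives
    [|y|^2 <= K |u|^2 = K <L y, y>].

    A densely defined symmetric operator that is onto is self-adjoint.
    Surjectivity is proved by solving [L y = f] explicitly: on an edge the
    solution is affine in [a_j = y_j(0)] and [c_j = u_j(0)].  From the leaves to
    the root one eliminates [c_j = D_j a_j + h_j], where [D_j] is real,
    nonpositive and bounded; then [a_j] is computed from the root to the leaves.
    The tree has finite depth and the [pt_n] over the edges leaving a vertex sum
    to 1, so both recursions keep the sequences square summable with the
    weights [alpha_j]. *)

Require Import Defs.
From HB Require Import structures.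
From mathcomp Require Import all_boot all_order all_algebra.
From mathcomp Require Import all_classical all_reals all_analysis.
From mathcomp Require Import measurable_realfun complex zify ring lra.

Set Implicit Arguments.
Unset Strict Implicit.
Unset Printing Implicit Defensive.

Import Order.TTheory GRing.Theory Num.Theory numFieldNormedType.Exports.

Local Open Scope classical_set_scope.
Local Open Scope ring_scope.
Local Open Scope complex_scope.

(** * Complex numbers and complex-valued integrals *)

Section Complex.
Context {R : realType}.
Implicit Types (x y z : R[i]) (a : R).
Local Notation Re := (@complex.Re R).
Local Notation Im := (@complex.Im R).
Local Notation nc := (@Normc.normc R).

(** The sign of D_j keeps the elimination from dividing by zero. Let r_j = e^(2 Re b_j), let E_j be
    the integral of e^(2 t Re b_j) over [0, 1], and let D be the p-weighted mean of the D_n over the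
    edges leaving v_j. Kirchhoff's condition solved for c_j reads c_j (r_j - D E_j) = D a_j + data.
    If D <= 0, the factor is at least r_j and D / (r_j - D E_j) lies between -1/E_j and 0, so the
    bound on D_j does not deteriorate from tier to tier. The boundary terms of Green's formula are
    infinite series. They may be regrouped by parent because they converge absolutely: end values on
    an edge are controlled by the W_2^1 norm there. The domain is dense because finitely many
    components may be replaced by W_2^2 functions that vanish with their derivatives at both ends,
    and the others by zero; all vertex conditions then hold trivially. The tree is known through its
    parent map only, so both recursions run on a number of tiers. *)

Lemma cRe_add x y : Re (x + y) = Re x + Re y. Proof. by case: x; case: y. Qed.
Lemma cIm_add x y : Im (x + y) = Im x + Im y. Proof. by case: x; case: y. Qed.
Lemma cRe_opp x : Re (- x) = - Re x. Proof. by case: x. Qed.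
Lemma cIm_opp x : Im (- x) = - Im x. Proof. by case: x. Qed.
Lemma cRe_mul x y : Re (x * y) = Re x * Re y - Im x * Im y.
Proof. by case: x; case: y. Qed.
Lemma cIm_mul x y : Im (x * y) = Re x * Im y + Im x * Re y.
Proof. by case: x => a b; case: y. Qed.
Lemma cRe_conj x : Re (x^*) = Re x. Proof. by case: x. Qed.
Lemma cIm_conj x : Im (x^*) = - Im x. Proof. by case: x. Qed.
Definition cE := (cRe_add, cIm_add, cRe_opp, cIm_opp, cRe_mul, cIm_mul,
  cRe_conj, cIm_conj).

Lemma eqc x y : Re x = Re y -> Im x = Im y -> x = y.
Proof. by case: x => a b; case: y => c d /= -> ->. Qed.

Lemma nc_sqr x : nc x ^+ 2 = Re x ^+ 2 + Im x ^+ 2.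
Proof. by case: x => a b /=; rewrite sqr_sqrtr// addr_ge0// sqr_ge0. Qed.

Lemma nc_ge0 x : 0 <= nc x. Proof. by case: x => a b; exact: sqrtr_ge0. Qed.

Lemma mulc_conj x : x * x^* = (nc x ^+ 2)%:C.
Proof. by rewrite nc_sqr; case: x => a b /=; apply: eqc => /=; ring. Qed.

Lemma sqrc_norm x : `|x| ^+ 2 = x * x^*.
Proof. exact: sqr_normc. Qed.

Lemma ncM x y : nc (x * y) = nc x * nc y. Proof. exact: Normc.normcM. Qed.

Lemma ncD x y : nc (x + y) <= nc x + nc y. Proof. exact: le_normcD. Qed.

Lemma ncN x : nc (- x) = nc x. Proof. exact: normcN. Qed.

Lemma nc_conj x : nc (x^*) = nc x.
Proof. by case: x => a b /=; rewrite sqrrN. Qed.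

Lemma nc_real a : nc (a%:C) = `|a|.
Proof. by rewrite /= expr0n addr0 sqrtr_sqr. Qed.

Lemma nc0 : nc 0 = 0. Proof. exact: Normc.normc0. Qed.

Lemma nc_eq0 x : nc x = 0 -> x = 0. Proof. exact: Normc.eq0_normc. Qed.

Lemma normr_nc x : `|x| = (nc x)%:C. Proof. by case: x. Qed.

Lemma Re_le_nc x : `|Re x| <= nc x.
Proof.
rewrite -[leRHS]ger0_norm ?nc_ge0// -ler_sqr ?nnegrE// real_normK ?num_real//.
by rewrite ger0_norm ?nc_ge0// nc_sqr lerDl sqr_ge0.
Qed.

Lemma Im_le_nc x : `|Im x| <= nc x.
Proof.
rewrite -[leRHS]ger0_norm ?nc_ge0// -ler_sqr ?nnegrE// real_normK ?num_real//.
by rewrite ger0_norm ?nc_ge0// nc_sqr lerDr sqr_ge0.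
Qed.

Lemma nc_le_ReIm x : nc x <= `|Re x| + `|Im x|.
Proof.
rewrite -ler_sqr ?nnegrE ?nc_ge0 ?addr_ge0// nc_sqr sqrrD.
by rewrite !real_normK ?num_real// addrAC lerDl mulrn_wge0// mulr_ge0.
Qed.

Lemma nc_sqrD x y : nc (x + y) ^+ 2 <= 2 * (nc x ^+ 2 + nc y ^+ 2).
Proof.
rewrite !nc_sqr !cE.
have := sqr_ge0 (Re x - Re y); have := sqr_ge0 (Im x - Im y); nra.
Qed.

Lemma nc_sqrM x y : nc (x * y) ^+ 2 = nc x ^+ 2 * nc y ^+ 2.
Proof. by rewrite ncM exprMn. Qed.

Lemma nc_mul_le x y : nc (x * y) <= nc x ^+ 2 + nc y ^+ 2.
Proof.
rewrite ncM; have := sqr_ge0 (nc x - nc y).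
have := sqr_ge0 (nc x); have := sqr_ge0 (nc y); nra.
Qed.

End Complex.

(** Makes filter reasoning ([filterS], [filterE]) available for statements that hold almost
    everywhere for Lebesgue measure on R. *)
Global Instance lebesgue_ae_filter (R : realType) :
  Filter (nbhs (almost_everywhere (@lebesgue_measure R))).
Proof. exact: ae_filter_ringOfSetsType. Qed.

Section Integral.
Context {R : realType}.
Local Notation C := R[i].
Local Notation Re := (@complex.Re R).
Local Notation Im := (@complex.Im R).
Local Notation nc := (@Normc.normc R).
Local Notation mu := (@lebesgue_measure R).
Local Notation I01 := (`[(0 : R), 1]%classic : set R).
Implicit Types (f g : R -> C) (A : set R).

Definition cintegrable A f : Prop :=
  mu.-integrable A (EFin \o (Re \o f)) /\ mu.-integrable A (EFin \o (Im \o f)).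

Lemma mu01 : mu I01 = 1%E.
Proof. by rewrite lebesgue_measure_itv/= lte_fin ltr01 -EFinB subr0. Qed.

Lemma mu01_lty : (mu I01 < +oo)%E. Proof. by rewrite mu01 ltry. Qed.

Lemma sub01 (t : R) : I01 t -> `[0, t] `<=` I01.
Proof.
rewrite /= in_itv/= => /andP[_ t1] x /=.
by rewrite !in_itv/= => /andP[-> /le_trans -> //].
Qed.

Lemma cintegrableS A B f : measurable A -> measurable B -> A `<=` B ->
  cintegrable B f -> cintegrable A f.
Proof. by move=> mA mB AB [r i]; split; [apply: integrableS r|apply: integrableS i]. Qed.

Lemma cintegrable_sub (t : R) f : I01 t -> cintegrable I01 f ->
  cintegrable `[0, t] f.
Proof. by move=> t01; apply: cintegrableS => //; exact: sub01. Qed.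

Lemma cmeasurableD f g : cmeasurable f -> cmeasurable g ->
  cmeasurable (fun t => f t + g t).
Proof.
move=> [fr fi] [gr gi]; split.
  by under [X in measurable_fun _ X]eq_fun do rewrite cE; exact: measurable_funD.
by under [X in measurable_fun _ X]eq_fun do rewrite cE; exact: measurable_funD.
Qed.

Lemma cmeasurableN f : cmeasurable f -> cmeasurable (fun t => - f t).
Proof.
move=> [fr fi]; split; under [X in measurable_fun _ X]eq_fun do rewrite cE; exact: measurableT_comp.
Qed.

Lemma cmeasurableM f g : cmeasurable f -> cmeasurable g ->
  cmeasurable (fun t => f t * g t).
Proof.
move=> [fr fi] [gr gi]; split.
  by under [X in measurable_fun _ X]eq_fun do rewrite cE; apply: measurable_funB; exact: measurable_funM.
by under [X in measurable_fun _ X]eq_fun do rewrite cE; apply: measurable_funD; exact: measurable_funM.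
Qed.

Lemma cmeasurable_conj f : cmeasurable f -> cmeasurable (fun t => (f t)^*).
Proof.
move=> [fr fi]; split; under [X in measurable_fun _ X]eq_fun do rewrite cE; first exact: fr.
exact: measurableT_comp.
Qed.

Lemma cmeasurable_cst (c : C) : cmeasurable (fun=> c).
Proof. by split; exact: measurable_cst. Qed.

Lemma cmeasurable_nc f : cmeasurable f ->
  measurable_fun I01 (fun t => nc (f t)).
Proof.
move=> [fr fi].
rewrite (_ : (fun _ => _) = fun t => Num.sqrt (Re (f t) ^+ 2 + Im (f t) ^+ 2)).
  apply: measurableT_comp; first by apply: continuous_measurable_fun; exact: sqrt_continuous.
  by apply: measurable_funD; exact: measurable_funX.
by apply/funext => t; rewrite -nc_sqr sqrtr_sqr ger0_norm// nc_ge0.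
Qed.

Lemma cintegrable_dom f (g : R -> R) : cmeasurable f ->
  (forall t, I01 t -> nc (f t) <= g t) -> mu.-integrable I01 (EFin \o g) ->
  cintegrable I01 f.
Proof.
move=> [fr fi] fg ig; split; (apply: (le_integrable _ _ _ ig) => //;
  first exact/measurable_EFinP) => t t01 /=; rewrite lee_fin.
- by rewrite (le_trans (Re_le_nc _))// (le_trans (fg _ t01))// ler_norm.
- by rewrite (le_trans (Im_le_nc _))// (le_trans (fg _ t01))// ler_norm.
Qed.

Lemma Rintegrable_eq A (F G : R -> R) : measurable A ->
  (forall t, A t -> F t = G t) ->
  mu.-integrable A (EFin \o F) -> mu.-integrable A (EFin \o G).
Proof.
move=> mA FG; apply: eq_integrable => // t /set_mem At /=.
by rewrite FG.
Qed.

Lemma RintegrableD A (F G : R -> R) : measurable A ->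
  mu.-integrable A (EFin \o F) -> mu.-integrable A (EFin \o G) ->
  mu.-integrable A (EFin \o (fun t => F t + G t)).
Proof. by move=> mA iF iG; have := integrableD _ iF iG; apply. Qed.

Lemma RintegrableB A (F G : R -> R) : measurable A ->
  mu.-integrable A (EFin \o F) -> mu.-integrable A (EFin \o G) ->
  mu.-integrable A (EFin \o (fun t => F t - G t)).
Proof. by move=> mA iF iG; have := integrableB _ iF iG; apply. Qed.

Lemma RintegrableZ A (r : R) (F : R -> R) : measurable A ->
  mu.-integrable A (EFin \o F) ->
  mu.-integrable A (EFin \o (fun t => r * F t)).
Proof. by move=> mA iF; have := integrableZl _ r iF; apply. Qed.

Lemma cintegrableZ A (c : C) f : measurable A -> cintegrable A f ->
  cintegrable A (fun t => c * f t).
Proof.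
move=> mA [fr fi]; split.
- apply: Rintegrable_eq (RintegrableB mA (RintegrableZ (Re c) mA fr)
    (RintegrableZ (Im c) mA fi)) => // t _ /=.
  by rewrite cE.
- apply: Rintegrable_eq (RintegrableD mA (RintegrableZ (Re c) mA fi)
    (RintegrableZ (Im c) mA fr)) => // t _ /=.
  by rewrite cE.
Qed.

Lemma cintegrableN A f : measurable A -> cintegrable A f ->
  cintegrable A (fun t => - f t).
Proof.
move=> mA; under [X in _ -> cintegrable _ X]eq_fun do rewrite -mulN1r.
exact: cintegrableZ.
Qed.

Lemma cintegralD A f g : measurable A -> cintegrable A f -> cintegrable A g ->
  cintegral A (fun t => f t + g t) = cintegral A f + cintegral A g.
Proof.
move=> mA [fr fi] [gr gi]; apply: eqc => /=.
  by under eq_Rintegral do rewrite cE; rewrite RintegralD.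
by under eq_Rintegral do rewrite cE; rewrite RintegralD.
Qed.

Lemma cintegralZ A (c : C) f : measurable A -> cintegrable A f ->
  cintegral A (fun t => c * f t) = c * cintegral A f.
Proof.
move=> mA [fr fi].
apply: eqc; rewrite !cE /=.
  under eq_Rintegral do rewrite cE.
  by rewrite RintegralB ?RintegralZl//; exact: RintegrableZ.
under eq_Rintegral do rewrite cE.
by rewrite RintegralD ?RintegralZl//; exact: RintegrableZ.
Qed.

Lemma cintegralN A f : measurable A -> cintegrable A f ->
  cintegral A (fun t => - f t) = - cintegral A f.
Proof.
move=> mA fi; under [X in cintegral _ X]eq_fun do rewrite -mulN1r.
by rewrite cintegralZ// mulN1r.
Qed.

Lemma cintegral_conj A f : measurable A -> cintegrable A f ->
  cintegral A (fun t => (f t)^*) = (cintegral A f)^*.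
Proof.
move=> mA [fr fi]; apply: eqc; rewrite cE /=.
  by under eq_Rintegral do rewrite cE.
under eq_Rintegral do rewrite cE -mulN1r.
by rewrite RintegralZl// mulN1r.
Qed.

Lemma eq_cintegral A f g : (forall t, A t -> f t = g t) ->
  cintegral A f = cintegral A g.
Proof.
by move=> fg; apply: eqc => /=; apply: eq_Rintegral => t /set_mem /fg ->.
Qed.

Lemma eq_cintegrable A f g : measurable A -> (forall t, A t -> f t = g t) ->
  cintegrable A f -> cintegrable A g.
Proof.
by move=> mA fg [r i]; split; [apply: eq_integrable r|apply: eq_integrable i];
  rewrite // => t /set_mem /fg /= ->.
Qed.

Lemma eq_cmeasurable f g : (forall t, I01 t -> f t = g t) ->
  cmeasurable f -> cmeasurable g.
Proof.
by move=> fg [r i]; split; [apply: eq_measurable_fun r|apply: eq_measurable_fun i];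
  rewrite // => t /set_mem /fg /= ->.
Qed.

Lemma ae_eq_cintegral f g : cmeasurable f -> cmeasurable g ->
  ae_eq01 f g -> cintegral I01 f = cintegral I01 g.
Proof.
move=> [fr fi] [gr gi] fg; apply: eqc => /=; congr fine;
  apply: ae_eq_integral => //; try exact/measurable_EFinP;
  by apply: filterS fg => t /= fg /fg ->.
Qed.

Lemma ae_eq01_sym f g : ae_eq01 f g -> ae_eq01 g f.
Proof. by apply: filterS => t /= fg /fg. Qed.

Lemma ae_eq01_trans f g h : ae_eq01 f g -> ae_eq01 g h -> ae_eq01 f h.
Proof. by apply: filterS2 => t /= fg gh t01; rewrite fg// gh. Qed.

Lemma ae_eq01_D f f' g g' : ae_eq01 f f' -> ae_eq01 g g' ->
  ae_eq01 (fun t => f t + g t) (fun t => f' t + g' t).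
Proof. by apply: filterS2 => t /= fg gh t01; rewrite fg// gh. Qed.

Lemma ae_eq01_M f f' g g' : ae_eq01 f f' -> ae_eq01 g g' ->
  ae_eq01 (fun t => f t * g t) (fun t => f' t * g' t).
Proof. by apply: filterS2 => t /= fg gh t01; rewrite fg// gh. Qed.

Lemma ae_eq01_conj f g : ae_eq01 f g ->
  ae_eq01 (fun t => (f t)^*) (fun t => (g t)^*).
Proof. by apply: filterS => t /= fg t01; rewrite fg. Qed.

Lemma eq_ae_eq01 f g : (forall t, I01 t -> f t = g t) -> ae_eq01 f g.
Proof. by move=> fg; apply: filterE. Qed.

(** The squared L2 norm as a real number. It is meaningful under [L2 f] only, since [fine] sends an
    infinite [sqnorm] to 0. *)
Definition n2 f : R := fine (sqnorm f).

Lemma sqnorm_ge0 f : (0 <= sqnorm f)%E.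
Proof. by apply: integral_ge0 => t _; rewrite lee_fin sqr_ge0. Qed.

Lemma n2_ge0 f : 0 <= n2 f. Proof. by rewrite fine_ge0// sqnorm_ge0. Qed.

Lemma n2E f : L2 f -> sqnorm f = (n2 f)%:E.
Proof. by move=> [_ f2]; rewrite fineK// ge0_fin_numE// sqnorm_ge0. Qed.

Lemma L2_sqr_integrable f : L2 f ->
  mu.-integrable I01 (EFin \o (fun t => nc (f t) ^+ 2)).
Proof.
move=> [mf f2]; apply/integrableP; split.
  by apply/measurable_EFinP; apply: measurable_funX; exact: cmeasurable_nc.
rewrite (_ : (\int[_]_(_ in _) _)%E = sqnorm f)//.
by apply: eq_integral => t _ /=; rewrite ger0_norm ?sqr_ge0.
Qed.

Lemma L2_intro f (g : R -> R) : cmeasurable f ->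
  mu.-integrable I01 (EFin \o g) ->
  (forall t, I01 t -> nc (f t) ^+ 2 <= g t) ->
  L2 f /\ n2 f <= \int[mu]_(t in I01) g t.
Proof.
move=> mf ig fg; have mn := cmeasurable_nc mf.
have L : L2 f.
  split=> //; move/integrableP: (ig) => [mg]; apply: le_lt_trans.
  apply: ge0_le_integral => //.
  - by move=> t _; rewrite lee_fin sqr_ge0.
  - exact/measurable_EFinP/measurable_funX.
  - exact: measurableT_comp.
  - by move=> t t01; rewrite lee_fin (le_trans (fg _ t01))// ler_norm.
by split=> //; apply: le_Rintegral => //; exact: L2_sqr_integrable.
Qed.

Lemma L2_meas f : L2 f -> cmeasurable f. Proof. by case. Qed.

Lemma cst_integrable (r : R) : mu.-integrable I01 (EFin \o (fun=> r)).
Proof.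
apply: measurable_bounded_integrable => //; first exact: mu01_lty.
by exists `|r|; split=> // x rx t _ /=; exact: ltW.
Qed.

Lemma le_n2 f g (K : R) : cmeasurable f -> L2 g ->
  (forall t, I01 t -> nc (f t) ^+ 2 <= K * nc (g t) ^+ 2) ->
  L2 f /\ n2 f <= K * n2 g.
Proof.
move=> mf Lg fg; have ig := L2_sqr_integrable Lg.
have [L le] := L2_intro mf (RintegrableZ K (measurable_itv _) ig) fg.
by split=> //; rewrite (le_trans le)// RintegralZl.
Qed.

Lemma L2D f g : L2 f -> L2 g ->
  L2 (fun t => f t + g t) /\ n2 (fun t => f t + g t) <= 2 * (n2 f + n2 g).
Proof.
move=> Lf Lg; have i1 := L2_sqr_integrable Lf; have i2 := L2_sqr_integrable Lg.
have m01 : measurable I01 by exact: measurable_itv.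
have := L2_intro (cmeasurableD (L2_meas Lf) (L2_meas Lg))
  (RintegrableZ 2 m01 (RintegrableD m01 i1 i2)) (fun t _ => nc_sqrD _ _).
by rewrite RintegralZl//; [rewrite RintegralD|exact: RintegrableD].
Qed.

Lemma L2_bdM (K : R) f g : cmeasurable f -> L2 g ->
  (forall t, I01 t -> nc (f t) <= K) ->
  L2 (fun t => f t * g t) /\ n2 (fun t => f t * g t) <= K ^+ 2 * n2 g.
Proof.
move=> mf Lg fK; apply: le_n2 => //; first exact: cmeasurableM (L2_meas Lg).
move=> t t01; have h := fK _ t01; have K0 : 0 <= K := le_trans (nc_ge0 _) h.
by rewrite nc_sqrM ler_wpM2r ?sqr_ge0// ler_pXn2r ?nnegrE ?nc_ge0.
Qed.

Lemma L2Z (c : C) f : L2 f ->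
  L2 (fun t => c * f t) /\ n2 (fun t => c * f t) <= nc c ^+ 2 * n2 f.
Proof. by move=> Lf; apply: L2_bdM => //; exact: cmeasurable_cst. Qed.

Lemma L2N f : L2 f -> L2 (fun t => - f t) /\ n2 (fun t => - f t) <= n2 f.
Proof.
move=> Lf; rewrite -[leRHS]mul1r; apply: le_n2 => //.
  exact: cmeasurableN (L2_meas Lf).
by move=> t _; rewrite ncN mul1r.
Qed.

Lemma L2_conj f : L2 f -> L2 (fun t => (f t)^*).
Proof.
move=> Lf; apply: (proj1 (@le_n2 _ f 1 _ Lf _)).
  exact: cmeasurable_conj (L2_meas Lf).
by move=> t _; rewrite nc_conj mul1r.
Qed.

Lemma L2_bd (K : R) f : cmeasurable f -> (forall t, I01 t -> nc (f t) ^+ 2 <= K) ->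
  L2 f /\ n2 f <= K.
Proof.
move=> mf fK; have [L le] := L2_intro mf (cst_integrable K) fK; split=> //.
by rewrite (le_trans le)// Rintegral_cst//= mu01 mulr1.
Qed.

Lemma L2_cst (c : C) : L2 (fun=> c).
Proof. by apply: (proj1 (@L2_bd (nc c ^+ 2) _ _ _)) => //; exact: cmeasurable_cst. Qed.

Lemma n2_const (K : R) : 0 <= K -> \int[mu]_(t in I01) K = K.
Proof. by move=> K0; rewrite Rintegral_cst//= mu01 mulr1. Qed.

Lemma eq_n2 f g : (forall t, I01 t -> f t = g t) -> n2 f = n2 g.
Proof.
by move=> fg; congr fine; apply: eq_integral => t /set_mem /fg ->.
Qed.

Lemma ae_eq_sqnorm f g : cmeasurable f -> cmeasurable g -> ae_eq01 f g ->
  sqnorm f = sqnorm g.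
Proof.
move=> mf mg fg; apply: ae_eq_integral => //; try
  by apply/measurable_EFinP; apply: measurable_funX; exact: cmeasurable_nc.
by apply: filterS fg => t /= fg /fg ->.
Qed.

Lemma ae_eq_L2 f g : cmeasurable g -> ae_eq01 f g -> L2 f -> L2 g.
Proof.
by move=> mg fg [mf f2]; split=> //; rewrite -(ae_eq_sqnorm mf mg fg).
Qed.

Lemma ae_eq_n2 f g : cmeasurable f -> cmeasurable g -> ae_eq01 f g ->
  n2 f = n2 g.
Proof. by move=> mf mg fg; congr fine; exact: ae_eq_sqnorm. Qed.

Lemma L2_mul_integrable f g : L2 f -> L2 g -> cintegrable I01 (fun t => f t * g t).
Proof.
move=> Lf Lg; apply: (cintegrable_dom _ (fun t _ => nc_mul_le _ _)).
  by apply: cmeasurableM; exact: L2_meas.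
by apply: RintegrableD; rewrite //; exact: L2_sqr_integrable.
Qed.

Lemma L2_integrable f : L2 f -> cintegrable I01 f.
Proof.
move=> Lf; apply: eq_cintegrable (L2_mul_integrable Lf (L2_cst 1)) => // t _.
by rewrite mulr1.
Qed.

Lemma n2_eq0 f : L2 f -> n2 f = 0 -> ae_eq01 f (fun=> 0).
Proof.
move=> Lf f0; have /measurable_int mf := L2_sqr_integrable Lf.
have m01 : measurable (I01 : set (measurableTypeR R)) by exact: measurable_itv.
have i0 : (\int[mu]_(t in I01) `|(nc (f t) ^+ 2)%:E| = 0)%E.
  transitivity (sqnorm f); last by rewrite n2E ?f0.
  by apply: eq_integral => t _ /=; rewrite ger0_norm ?sqr_ge0.
have := (ae_eq_integral_abs mu m01 mf).1 i0; apply: filterS => t /= H0 t01; have [] := H0 t01 => /eqP.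
by rewrite sqrf_eq0 => /eqP /nc_eq0.
Qed.

Lemma cintegral_mulJ f : L2 f -> cintegral I01 (fun t => f t * (f t)^*) = (n2 f)%:C.
Proof.
move=> Lf; apply: eqc => /=.
  by congr fine; apply: eq_integral => t _; rewrite mulc_conj.
under eq_Rintegral do rewrite mulc_conj /=.
by rewrite /Rintegral integral0.
Qed.

(* The factor 2 comes from estimating the real and imaginary parts apart. *)
Lemma nc_cintegral_le f (g : R -> R) (t : R) : I01 t -> cmeasurable f ->
  (forall t, I01 t -> nc (f t) <= g t) -> mu.-integrable I01 (EFin \o g) ->
  nc (cintegral `[0, t] f) <= 2 * \int[mu]_(s in I01) g s.
Proof.
move=> t01 mf fg ig; have [fr fi] := cintegrable_dom mf fg ig.
have g0 s : I01 s -> 0 <= g s by move=> /fg; apply: le_trans; exact: nc_ge0.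
have H (h : R -> R) : mu.-integrable I01 (EFin \o h) ->
   (forall s, I01 s -> `|h s| <= g s) ->
   `|\int[mu]_(s in `[0, t]) h s| <= \int[mu]_(s in I01) g s.
  move=> ih hg.
  have ih' : mu.-integrable `[0, t] (EFin \o h).
    by apply: integrableS ih => //; exact: sub01.
  apply: (le_trans (le_normr_Rintegral _ ih')) => //.
  apply: fine_le.
  - apply: integrable_fin_num => //.
    exact: (integrable_norm ih').
  - exact: integrable_fin_num.
  apply: (@le_trans _ _ (\int[mu]_(x in `[0%R, t]) (g x)%:E)%E).
    apply: ge0_le_integral => //.
    + apply: measurableT_comp => //; apply: measurableT_comp => //.
      by apply/measurable_EFinP; case/integrableP: ih'.
    + apply: measurable_funS (sub01 t01) _ => //.
      by case/integrableP: ig.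
    + by move=> s st; rewrite lee_fin hg//; exact: sub01 st.
  apply: ge0_subset_integral => //; last exact: sub01.
  by case/integrableP: ig.
apply: (le_trans (nc_le_ReIm _)); rewrite mulr_natl mulr2n lerD//; apply: H => //.
  by move=> s s01; rewrite (le_trans (Re_le_nc _))// fg.
by move=> s s01; rewrite (le_trans (Im_le_nc _))// fg.
Qed.

(* Integrating [2 m |f| <= m^2 + |f|^2] with [m] the integral of [|f|] gives
   [m^2 <= n2 f]. *)
Lemma nc_cintegral_sqr f (t : R) : I01 t -> L2 f ->
  nc (cintegral `[0, t] f) ^+ 2 <= 4 * n2 f.
Proof.
move=> t01 Lf; have i2 := L2_sqr_integrable Lf.
have m01 : measurable I01 by exact: measurable_itv.
have i1 : mu.-integrable I01 (EFin \o (fun s => nc (f s))).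
  apply: le_integrable (RintegrableD m01 (cst_integrable 1) i2) => //.
    by apply/measurable_EFinP; apply: cmeasurable_nc; case: Lf.
  move=> s s01 /=; rewrite lee_fin ger0_norm ?nc_ge0// ger0_norm ?addr_ge0 ?sqr_ge0//.
  by have := sqr_ge0 (nc (f s)); have := sqr_ge0 (nc (f s) - 1); nra.
pose m := \int[mu]_(s in I01) nc (f s).
have m0 : 0 <= m by apply: Rintegral_ge0 => s _; exact: nc_ge0.
have : \int[mu]_(s in I01) (2 * m * nc (f s)) <=
    \int[mu]_(s in I01) (m ^+ 2 + nc (f s) ^+ 2).
  apply: le_Rintegral => //; first exact: RintegrableZ.
    by apply: RintegrableD => //; exact: cst_integrable.
  by move=> s _; have := sqr_ge0 (m - nc (f s)); nra.
rewrite RintegralZl// RintegralD//; last exact: cst_integrable.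
rewrite n2_const ?sqr_ge0// -/m -/(n2 f) => H.
have xm : nc (cintegral `[0, t] f) <= 2 * m.
  exact: (nc_cintegral_le t01 (L2_meas Lf) (fun _ _ => lexx _) i1).
have x0 := nc_ge0 (cintegral `[0, t] f).
have := ler_pM x0 x0 xm xm; move: H; rewrite /n2 /sqnorm /Rintegral; nra.
Qed.

End Integral.

(** * Products of primitives *)

Section RealProduct.
Context {R : realType}.
Local Notation mu := (@lebesgue_measure R).
Implicit Types (f g : R -> R) (t : R).

Lemma EFin_Rintegral (A : set R) f : measurable A -> mu.-integrable A (EFin \o f) ->
  (\int[mu]_(x in A) (f x)%:E)%E = (\int[mu]_(x in A) f x)%:E.
Proof. by move=> mA fi; rewrite /Rintegral fineK//; exact: integrable_fin_num. Qed.

Let integrable_restr (A : set R) f : measurable A -> mu.-integrable A (EFin \o f) ->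
  mu.-integrable setT (EFin \o (f \_ A)).
Proof. by move=> mA; rewrite -restrict_EFin => fi; exact/(integrable_mkcond _ _).1. Qed.

(** Fubini on the square [0, t]^2: the product of the integrals is the integral of f(x) g(y), and
    the diagonal cuts the square into y <= x, where y is integrated out, and x < y, where x is
    integrated out. Integrability of the first integrand only is obtained here; that of the second
    follows by exchanging [f] and [g]. *)
Let Rintegral_mul_aux f g t : 0 <= t ->
  mu.-integrable `[0, t] (EFin \o f) -> mu.-integrable `[0, t] (EFin \o g) ->
  mu.-integrable `[0, t] (EFin \o (fun x => f x * \int[mu]_(y in `[0, x]) g y)) /\
  (mu.-integrable `[0, t] (EFin \o (fun x => (\int[mu]_(y in `[0, x]) f y) * g x)) ->
  (\int[mu]_(x in `[0, t]) f x) * (\int[mu]_(x in `[0, t]) g x) =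
    \int[mu]_(x in `[0, t]) (f x * \int[mu]_(y in `[0, x]) g y) +
    \int[mu]_(x in `[0, t]) ((\int[mu]_(y in `[0, x]) f y) * g x)).
Proof.
move=> t0 fi gi; pose A := `[0, t]%classic : set R.
(* Extension by zero, so that Fubini applies on the whole plane. *)
pose f' : R -> R := f \_ A; pose g' : R -> R := g \_ A.
have mA : measurable A by exact: measurable_itv.
have f'i : mu.-integrable setT (EFin \o f') by exact: integrable_restr.
have g'i : mu.-integrable setT (EFin \o g') by exact: integrable_restr.
have /measurable_int/measurable_EFinP mf' := f'i.
have /measurable_int/measurable_EFinP mg' := g'i.
pose TR := measurableTypeR R.
have mf1 : measurable_fun setT (fun z : TR * TR => f' z.1).
  exact: (measurableT_comp mf' measurable_fst).
have mg2 : measurable_fun setT (fun z : TR * TR => g' z.2).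
  exact: (measurableT_comp mg' measurable_snd).
pose h (z : TR * TR) : R := f' z.1 * g' z.2.
have mh : measurable_fun setT h by exact: measurable_funM.
pose ind (z : TR * TR) : R := if (z.2 : R) <= z.1 then 1 else 0.
have mind : measurable_fun setT ind.
  apply: measurable_fun_ifT => //.
  by apply: measurable_fun_ler; [exact: measurable_snd|exact: measurable_fst].
have maf : measurable_fun setT (fun x : TR => `|(f' x)%:E|%E).
  by apply: measurableT_comp => //; exact/measurable_EFinP.
have mag : measurable_fun setT (fun x : TR => `|(g' x)%:E|%E).
  by apply: measurableT_comp => //; exact/measurable_EFinP.
have hi : (mu \x mu)%E.-integrable setT (EFin \o h).
  apply/integrable12ltyP; first exact/measurable_EFinP.
  have -> : (\int[mu]_x \int[mu]_y `|(EFin \o h) (x, y)| =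
      (\int[mu]_x `|(f' x)%:E|) * (\int[mu]_y `|(g' y)%:E|))%E.
    transitivity (\int[mu]_x (`|(f' x)%:E| * \int[mu]_y `|(g' y)%:E|))%E.
      apply: eq_integral => x _; rewrite -ge0_integralZl//.
      by apply: eq_integral => y _; rewrite /h /= normrM EFinM.
    by rewrite ge0_integralZr// integral_ge0.
  case/integrableP: f'i => _ f'i; case/integrableP: g'i => _ g'i.
  by apply: lte_mul_pinfty; rewrite ?integral_ge0 ?ge0_fin_numE ?integral_ge0.
have hind (k : TR * TR -> R) : measurable_fun setT k ->
   (forall z, `|k z| <= 1) -> (mu \x mu)%E.-integrable setT (EFin \o (fun z => h z * k z)).
  move=> mk k1; apply: le_integrable hi => //.
    by apply/measurable_EFinP; exact: measurable_funM.
  by move=> z _ /=; rewrite lee_fin normrM ler_piMr.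
pose k1 (z : TR * TR) : R := 1 - ind z.
have ind01 z : ind z = 0 \/ ind z = 1 by rewrite /ind; case: ifP; [right|left].
have mk1 : measurable_fun setT k1 by exact: measurable_funB.
have h1i : (mu \x mu)%E.-integrable setT (EFin \o (fun z => h z * ind z)).
  by apply: hind => // z; case: (ind01 z) => ->; rewrite ?normr0 ?normr1.
have h2i : (mu \x mu)%E.-integrable setT (EFin \o (fun z => h z * k1 z)).
  apply: hind => // z; rewrite /k1.
  by case: (ind01 z) => ->; rewrite ?subr0 ?subrr ?normr0 ?normr1.
have sub x : A x -> `[0, x] `<=` A.
  rewrite /A /= in_itv/= => /andP[x0 xt] y /=; rewrite !in_itv/= => /andP[-> yx].
  exact: le_trans yx xt.
have intT (u : R -> R) : mu.-integrable A (EFin \o u) ->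
    (\int[mu]_x (u \_ A) x)%R = \int[mu]_(x in A) u x.
  by move=> ui; rewrite [RHS]Rintegral_mkcond.
have Hh : (\int[mu \x mu]_z (EFin \o h) z =
   ((\int[mu]_(x in A) f x) * (\int[mu]_(x in A) g x))%:E)%E.
  rewrite -integral12_prod_meas1//.
  transitivity (\int[mu]_x ((f' x) * \int[mu]_(x in A) g x)%:E)%E.
    apply: eq_integral => x _; rewrite /fubini_F -intT// -/g'.
    rewrite -RintegralZl// EFin_Rintegral//.
    by have := RintegrableZ (f' x) measurableT g'i.
  rewrite EFin_Rintegral//; last first.
    by apply: Rintegrable_eq (RintegrableZ _ _ f'i) => // x _; rewrite mulrC.
  by rewrite RintegralZr// intT.
have F1 x : fubini_F mu (EFin \o (fun z : TR * TR => h z * ind z)%R) x =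
   (((fun x => f x * \int[mu]_(y in `[0, x]) g y) \_ A) x)%:E.
  rewrite /fubini_F patchE; case: ifPn => [/set_mem Ax|xA]; last first.
    rewrite -[RHS](@integral0 _ _ _ mu setT); apply: eq_integral => y _ /=.
    by rewrite /h /f' /= patchE (negbTE xA) !mul0r.
  have gx : mu.-integrable `[0, x] (EFin \o g).
    by apply: integrableS gi => //; exact: sub.
  have gx' := integrable_restr (measurable_itv _) gx.
  transitivity (\int[mu]_y (f x * (g \_ `[0, x]) y)%:E)%E.
    apply: eq_integral => y _ /=; rewrite /h /f' /g' /ind /= !patchE.
    rewrite (mem_set Ax) -mulrA; congr (_ * _)%:E.
    have [y0|/negP y0] := boolP (y \in `[0, x]%classic).
      move: (set_mem y0) => yx; rewrite (mem_set (sub _ Ax _ yx)).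
      by move: yx; rewrite /= in_itv/= => /andP[_ ->]; rewrite mulr1.
    case: ifPn => [/set_mem|_]; last by rewrite mul0r.
    rewrite /A /= in_itv/= => /andP[y00 yt]; case: ifPn => yx; rewrite ?mulr0//.
    by case: y0; apply/mem_set; rewrite /= in_itv/= y00.
  rewrite EFin_Rintegral//; last by have := RintegrableZ (f x) measurableT gx'.
  by rewrite RintegralZl// -Rintegral_mkcond.
have F2 y : fubini_G mu (EFin \o (fun z : TR * TR => h z * k1 z)%R) y =
   (((fun x => (\int[mu]_(y in `[0, x]) f y) * g x) \_ A) y)%:E.
  rewrite /fubini_G patchE; case: ifPn => [/set_mem Ay|yA]; last first.
    rewrite -[RHS](@integral0 _ _ _ mu setT); apply: eq_integral => x _ /=.
    by rewrite /h /g' /= [_ y]patchE (negbTE yA) mulr0 mul0r.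
  have fy : mu.-integrable `[0, y] (EFin \o f).
    by apply: integrableS fi => //; exact: sub.
  (* The complement of the region y <= x is x < y with strict inequality, hence the half-open
     interval; the missing endpoint does not change the integral. *)
  have fyo : mu.-integrable `[0, y[ (EFin \o f).
    by apply: integrableS fy => //; exact: subset_itv_co_cc.
  have fy' := integrable_restr (measurable_itv _) fyo.
  transitivity (\int[mu]_x (g y * (f \_ `[0, y[) x)%:E)%E.
    apply: eq_integral => x _ /=; rewrite /h /f' /g' /k1 /ind /= !patchE.
    rewrite (mem_set Ay) mulrAC mulrC; congr (_ * _)%:E.
    have [x0|/negP x0] := boolP (x \in `[0, y[%classic).
      move: (set_mem x0) => xy; rewrite (mem_set (sub _ Ay _ (subset_itv_co_cc xy))).
      by move: xy; rewrite /= in_itv/= => /andP[_]; rewrite ltNge => /negbTE ->; rewrite subr0 mulr1.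
    case: ifPn => [/set_mem|_]; last by rewrite mul0r.
    rewrite /A /= in_itv/= => /andP[x00 xt]; case: ifPn => xy; rewrite ?subrr ?mulr0//.
    by case: x0; apply/mem_set; rewrite /= in_itv/= x00 ltNge.
  rewrite EFin_Rintegral//; last by have := RintegrableZ (g y) measurableT fy'.
  by rewrite RintegralZl// -Rintegral_mkcond mulrC Rintegral_itv_bndo_bndc.
have i1 : mu.-integrable A (EFin \o (fun x => f x * \int[mu]_(y in `[0, x]) g y)).
  apply/(integrable_mkcond _ _).2 => //; rewrite restrict_EFin.
  have := integrable_fubini_F h1i.
  by congr (mu.-integrable _ _); apply/funext => x; rewrite F1.
split=> // i2; apply: EFin_inj; rewrite -Hh.
transitivity (\int[(mu \x mu)%E]_z (EFin \o (fun z => h z * ind z)%R) z +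
              \int[(mu \x mu)%E]_z (EFin \o (fun z => h z * k1 z)%R) z)%E.
  rewrite -integralD//; apply: eq_integral => z _ /=.
  by rewrite -EFinD /k1; congr EFin; ring.
rewrite -integral12_prod_meas1// -[X in (_ + X)%E]integral21_prod_meas1//.
rewrite EFinD -!EFin_Rintegral//; congr (_ + _)%E.
  rewrite [RHS]integral_mkcond; apply: eq_integral => x _.
  by rewrite F1 !patchE; case: ifP.
rewrite [RHS]integral_mkcond; apply: eq_integral => x _.
by rewrite F2 !patchE; case: ifP.
Qed.

Lemma Rintegral_mul f g t : 0 <= t ->
  mu.-integrable `[0, t] (EFin \o f) -> mu.-integrable `[0, t] (EFin \o g) ->
  [/\ mu.-integrable `[0, t] (EFin \o (fun x => f x * \int[mu]_(y in `[0, x]) g y)),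
      mu.-integrable `[0, t] (EFin \o (fun x => (\int[mu]_(y in `[0, x]) f y) * g x)) &
  (\int[mu]_(x in `[0, t]) f x) * (\int[mu]_(x in `[0, t]) g x) =
    \int[mu]_(x in `[0, t]) (f x * \int[mu]_(y in `[0, x]) g y) +
    \int[mu]_(x in `[0, t]) ((\int[mu]_(y in `[0, x]) f y) * g x)].
Proof.
move=> t0 fi gi; have [i1 E] := Rintegral_mul_aux t0 fi gi.
have [i2 _] := Rintegral_mul_aux t0 gi fi.
have i2' : mu.-integrable `[0, t]
    (EFin \o (fun x => (\int[mu]_(y in `[0, x]) f y) * g x)).
  by apply: Rintegrable_eq i2 => // x _; rewrite mulrC.
by split=> //; exact: E.
Qed.

End RealProduct.

(** * Primitives of integrable real functions and their product rule *)

Section RealPrimitive.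
Context {R : realType}.
Local Notation mu := (@lebesgue_measure R).
Local Notation I01 := (`[(0 : R), 1]%classic : set R).
Implicit Types (U u V v : R -> R) (t : R).

Definition rprimitive U u := mu.-integrable I01 (EFin \o u) /\
  forall t, I01 t -> U t = U 0 + \int[mu]_(x in `[0, t]) u x.

Lemma m01 : measurable I01. Proof. exact: measurable_itv. Qed.

Lemma mem01 t : I01 t -> 0 <= t /\ t <= 1.
Proof. by rewrite /= in_itv/= => /andP[]. Qed.

Lemma in01_0 : I01 0. Proof. by rewrite /= in_itv/= lexx ler01. Qed.
Lemma in01_1 : I01 1. Proof. by rewrite /= in_itv/= lexx ler01. Qed.

Lemma Rintegrable_sub u t : I01 t -> mu.-integrable I01 (EFin \o u) ->
  mu.-integrable `[0, t] (EFin \o u).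
Proof. by move=> t01; apply: integrableS => //; exact: sub01. Qed.

Lemma rprimitiveD U u V v : rprimitive U u -> rprimitive V v ->
  rprimitive (fun t => U t + V t) (fun t => u t + v t).
Proof.
move=> [ui Uu] [vi Vv]; split; first exact: (RintegrableD m01 ui vi).
move=> t t01; rewrite RintegralD//; try exact: Rintegrable_sub.
by rewrite (Uu t)// (Vv t)//; ring.
Qed.

Lemma rprimitiveB U u V v : rprimitive U u -> rprimitive V v ->
  rprimitive (fun t => U t - V t) (fun t => u t - v t).
Proof.
move=> [ui Uu] [vi Vv]; split; first exact: (RintegrableB m01 ui vi).
move=> t t01; rewrite RintegralB//; try exact: Rintegrable_sub.
by rewrite (Uu t)// (Vv t)//; ring.
Qed.

Lemma rprimitive_ext U u V v : (forall t, I01 t -> U t = V t) ->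
  (forall t, I01 t -> u t = v t) -> rprimitive U u -> rprimitive V v.
Proof.
move=> UV uv [ui Uu]; split; first exact: Rintegrable_eq ui.
move=> t t01; rewrite -UV// -UV; last exact: in01_0.
rewrite Uu//; congr (_ + _); apply: eq_Rintegral => s /set_mem st.
by rewrite uv//; exact: sub01 st.
Qed.

(** Each factor is its value at 0 plus an integral. The product of the two integrals is given by
    [Rintegral_mul]; the remaining terms are linear. *)
Lemma rprimitiveM U u V v : rprimitive U u -> rprimitive V v ->
  rprimitive (fun t => U t * V t) (fun t => u t * V t + U t * v t).
Proof.
move=> [ui Uu] [vi Vv].
have E t x : I01 t -> `[0, t]%classic x ->
   (u x * (\int[mu]_(y in `[0, x]) v y) + (\int[mu]_(y in `[0, x]) u y) * v x)
    + (V 0 * u x + U 0 * v x) = u x * V x + U x * v x.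
  by move=> t01 /(sub01 t01) x01; rewrite (Uu x)// (Vv x)//; ring.
have L t : I01 t -> mu.-integrable `[0, t] (EFin \o (fun x => V 0 * u x + U 0 * v x)).
  by move=> t01; apply: RintegrableD => //; apply: RintegrableZ => //;
    exact: Rintegrable_sub.
have P t (t01 : I01 t) := Rintegral_mul (mem01 t01).1
  (Rintegrable_sub t01 ui) (Rintegrable_sub t01 vi).
split.
  have [i1 i2 _] := P _ in01_1.
  apply: Rintegrable_eq (RintegrableD m01 (RintegrableD m01 i1 i2) (L _ in01_1)).
    by [].
  by move=> x; exact: E in01_1.
move=> t t01; have [i1 i2 e] := P _ t01.
have -> : \int[mu]_(x in `[0, t]) (u x * V x + U x * v x) =
   \int[mu]_(x in `[0, t]) ((u x * (\int[mu]_(y in `[0, x]) v y) +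
     (\int[mu]_(y in `[0, x]) u y) * v x) + (V 0 * u x + U 0 * v x)).
  by apply: eq_Rintegral => x /set_mem xt; rewrite (E t).
rewrite RintegralD//; [|by apply: RintegrableD|exact: L].
rewrite RintegralD// -e RintegralD//; try (by apply: RintegrableZ => //;
    exact: Rintegrable_sub).
rewrite !RintegralZl//; try exact: Rintegrable_sub.
by rewrite (Uu t)// (Vv t)//; ring.
Qed.

Lemma rprimitive_continuous U u : rprimitive U u -> {within I01, continuous U}.
Proof.
move=> [ui Uu].
have c := @parameterized_integral_continuous R 0 1 u ler01 ui.
have : {within I01, continuous (fun t => U 0 + parameterized_integral mu 0 t u)}.
  move=> x; apply: cvgD; [exact: cvg_cst|exact: c].
apply: subspace_eq_continuous => x x01.
by rewrite [RHS]Uu//; exact: set_mem x01.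
Qed.

Lemma rprimitive_measurable U u : rprimitive U u -> measurable_fun I01 U.
Proof.
move=> /rprimitive_continuous c.
by apply: subspace_continuous_measurable_fun => //; exact: m01.
Qed.

End RealPrimitive.

(** * Complex functions of class W_2^1: end values and products *)

Section Primitive.
Context {R : realType}.
Local Notation C := R[i].
Local Notation Re := (@complex.Re R).
Local Notation Im := (@complex.Im R).
Local Notation nc := (@Normc.normc R).
Local Notation mu := (@lebesgue_measure R).
Local Notation I01 := (`[(0 : R), 1]%classic : set R).
Implicit Types (F f G g : R -> C) (t : R).

(** Says that [F] is the absolutely continuous representative of an element of W_2^1[0, 1] with
    derivative [f]. *)
Definition ac F f := L2 f /\ is_primitive F f.

Lemma is_primitiveP F f : cintegrable I01 f ->
  is_primitive F f <-> rprimitive (Re \o F) (Re \o f) /\ rprimitive (Im \o F) (Im \o f).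
Proof.
move=> [fr fi]; split.
  by move=> Ff; split; (split=> // t t01 /=); rewrite Ff// cE.
by move=> [[_ r] [_ i]] t t01; apply: eqc; rewrite cE; [exact: r|exact: i].
Qed.

Lemma ac_parts F f : ac F f ->
  rprimitive (Re \o F) (Re \o f) /\ rprimitive (Im \o F) (Im \o f).
Proof. by move=> [Lf]; apply: (is_primitiveP _ (L2_integrable Lf)).1. Qed.

Lemma ac_measurable F f : ac F f -> cmeasurable F.
Proof.
by move=> /ac_parts[r i]; split;
  [exact: rprimitive_measurable r|exact: rprimitive_measurable i].
Qed.

Lemma nc_sqr_le (z w : C) (r s : R) : nc z ^+ 2 <= r -> nc w ^+ 2 <= s ->
  nc (z + w) ^+ 2 <= 2 * r + 2 * s.
Proof. by move=> zr ws; rewrite (le_trans (nc_sqrD _ _))// mulrDr lerD// ler_pM2l. Qed.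

(** The 8 is the 4 of [nc_cintegral_sqr], doubled by |z + w|^2 <= 2 |z|^2 + 2 |w|^2. *)
Lemma ac_bound F f t : ac F f -> I01 t ->
  nc (F t) ^+ 2 <= 2 * nc (F 0) ^+ 2 + 8 * n2 f.
Proof.
move=> [Lf Ff] t01; rewrite Ff//.
have := nc_sqr_le (lexx (nc (F 0) ^+ 2)) (nc_cintegral_sqr t01 Lf).
by rewrite mulrA -natrM.
Qed.

Lemma ac_L2 F f : ac F f -> L2 F /\ n2 F <= 2 * nc (F 0) ^+ 2 + 8 * n2 f.
Proof.
move=> Ff; apply: L2_bd; first exact: ac_measurable Ff.
by move=> t t01; exact: ac_bound.
Qed.

(** F(0) differs from F(t) by the integral of [f] over [0, t]; the resulting bound is averaged over
    t in [0, 1]. *)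
Lemma ac_bound0 F f : ac F f -> nc (F 0) ^+ 2 <= 2 * n2 F + 8 * n2 f.
Proof.
move=> Ff; have [LF _] := ac_L2 Ff; have i2 := L2_sqr_integrable LF.
have c := cst_integrable (8 * n2 f); have z := RintegrableZ 2 m01 i2.
have : \int[mu]_(t in I01) (nc (F 0) ^+ 2) <=
    \int[mu]_(t in I01) (2 * nc (F t) ^+ 2 + 8 * n2 f).
  apply: le_Rintegral => //; first exact: cst_integrable.
    exact: (RintegrableD m01 z c).
  move=> t t01; case: Ff => Lf Ff.
  have -> : F 0 = F t + - cintegral `[0, t] f by rewrite (Ff t)// addrK.
  have H : nc (- cintegral `[0, t] f) ^+ 2 <= 4 * n2 f.
    by rewrite ncN; exact: nc_cintegral_sqr.
  by have := nc_sqr_le (lexx (nc (F t) ^+ 2)) H; rewrite mulrA -natrM.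
rewrite (n2_const (sqr_ge0 (nc (F 0)))) RintegralD//.
rewrite (RintegralZl 2 _ i2)// (n2_const (_ : 0 <= 8 * n2 f)) ?mulr_ge0 ?n2_ge0//.
Qed.

Lemma acD F f G g : ac F f -> ac G g -> ac (fun t => F t + G t) (fun t => f t + g t).
Proof.
move=> [Lf Ff] [Lg Gg]; split; first exact: (L2D Lf Lg).1.
have ? := L2_integrable Lf; have ? := L2_integrable Lg.
move=> t t01; rewrite cintegralD//; try exact: cintegrable_sub.
by rewrite Ff// Gg//; ring.
Qed.

Lemma acZ (c : C) F f : ac F f -> ac (fun t => c * F t) (fun t => c * f t).
Proof.
move=> [Lf Ff]; split; first exact: (L2Z c Lf).1.
have ? := L2_integrable Lf.
move=> t t01; rewrite cintegralZ//; last exact: cintegrable_sub.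
by rewrite Ff//; ring.
Qed.

Lemma ac_cst (c : C) : ac (fun=> c) (fun=> 0).
Proof.
split; first exact: L2_cst.
move=> t _; apply: eqc; rewrite cE /=; rewrite /Rintegral integral0 /=; ring.
Qed.

Lemma ac_conj F f : ac F f -> ac (fun t => (F t)^*) (fun t => (f t)^*).
Proof.
move=> [Lf Ff]; split; first exact: (L2_conj Lf).
have ? := L2_integrable Lf.
move=> t t01; rewrite cintegral_conj//; last exact: cintegrable_sub.
by rewrite Ff//; apply: eqc; rewrite !cE//; ring.
Qed.

Lemma ac_ext F f G g : (forall t, I01 t -> F t = G t) ->
  (forall t, I01 t -> f t = g t) -> ac F f -> ac G g.
Proof.
move=> FG fg [Lf Ff]; split.
  have mg := eq_cmeasurable fg (L2_meas Lf).
  exact: ae_eq_L2 mg (eq_ae_eq01 fg) Lf.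
move=> t t01; rewrite -FG// -FG; last exact: in01_0.
by rewrite Ff//; congr (_ + _); apply: eq_cintegral => s /(sub01 t01) /fg.
Qed.

Lemma ac_bdd F f : ac F f -> exists K : R, forall t, I01 t -> nc (F t) <= K.
Proof.
move=> Ff; pose K := 2 * nc (F 0) ^+ 2 + 8 * n2 f; exists (1 + K) => t t01.
have := ac_bound Ff t01; rewrite -/K => h.
by have := nc_ge0 (F t); have := sqr_ge0 (nc (F t) - 1); nra.
Qed.

(** Both factors are bounded, so the derivative of the product stays in L2; the product rule itself
    is that of the real and imaginary parts. *)
Lemma acM F f G g : ac F f -> ac G g ->
  ac (fun t => F t * G t) (fun t => f t * G t + F t * g t).
Proof.
move=> Ff Gg.
have [KF bF] := ac_bdd Ff; have [KG bG] := ac_bdd Gg.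
have [L1 _] := L2_bdM (ac_measurable Ff) Gg.1 bF.
have [L2 _] := L2_bdM (ac_measurable Gg) Ff.1 bG.
have L3 : Defs.L2 (fun t => f t * G t + F t * g t).
  have [+ _] := L2D L2 L1.
  by congr Defs.L2; apply/funext => t; rewrite (mulrC (f t)).
split=> //; apply/(is_primitiveP _ (L2_integrable L3)).
have [Fr Fi] := ac_parts Ff; have [Gr Gi] := ac_parts Gg; split.
- apply: rprimitive_ext (rprimitiveB (rprimitiveM Fr Gr) (rprimitiveM Fi Gi)).
    by move=> t _ /=; rewrite !cE.
  by move=> t _ /=; rewrite !cE /=; ring.
- apply: rprimitive_ext (rprimitiveD (rprimitiveM Fr Gi) (rprimitiveM Fi Gr)).
    by move=> t _ /=; rewrite !cE.
  by move=> t _ /=; rewrite !cE /=; ring.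
Qed.

Lemma ac_integral (a : C) f : L2 f -> ac (fun t => a + cintegral `[0, t] f) f.
Proof.
move=> Lf; split=> // t t01; congr (_ + _).
suff -> : cintegral `[0, 0] f = 0 by rewrite addr0.
by apply: eqc => /=; rewrite set_itv1 Rintegral_set1.
Qed.

Lemma ac1 F f : ac F f -> F 1 = F 0 + cintegral I01 f.
Proof. by move=> [_ /(_ _ in01_1)]. Qed.

End Primitive.

(** * The complex exponential on an edge *)

Section Cexp.
Context {R : realType}.
Local Notation C := R[i].
Local Notation Re := (@complex.Re R).
Local Notation Im := (@complex.Im R).
Local Notation nc := (@Normc.normc R).
Local Notation mu := (@lebesgue_measure R).
Local Notation I01 := (`[(0 : R), 1]%classic : set R).

Lemma continuous_rprimitive (U u : R -> R) : continuous u ->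
  (forall x, is_derive x (1 : R) U (u x)) -> rprimitive U u.
Proof.
move=> cu dU; have cI (a b : R) : {within `[a, b], continuous u}.
  exact: continuous_subspaceT.
have cU : continuous U.
  by move=> x; apply/differentiable_continuous/derivable1_diffP; apply: ex_derive.
have ui (a b : R) : mu.-integrable `[a, b] (EFin \o u).
  by apply: continuous_compact_integrable => //; exact: segment_compact.
(* The fundamental theorem is applied on a nondegenerate interval, so t = 0 is treated apart. *)
split=> // t /mem01[]; rewrite le_eqVlt => /predU1P[<- _|t0 _].
  by rewrite set_itv1 Rintegral_set1 addr0.
rewrite /Rintegral (@continuous_FTC2 _ u U)//.
- by rewrite -EFinB /= addrC subrK.
- split.
  + by move=> x _; exact: ex_derive.
  + exact/cvg_at_right_filter/cU.
  + exact/cvg_at_left_filter/cU.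
- by move=> x _; rewrite derive1E; exact: derive_val.
Qed.

(** The exponential e^(b t) for complex b, assembled from the real functions; it serves as the
    integrating factor on an edge. *)
Definition cexp (b : C) (t : R) : C :=
  (expR (Re b * t))%:C * (cos (Im b * t) +i* sin (Im b * t)).

Lemma cexp0 b : cexp b 0 = 1.
Proof. by rewrite /cexp !mulr0 expR0 cos0 sin0 mul1r. Qed.

Lemma cexpM b c t : cexp b t * cexp c t = cexp (b + c) t.
Proof.
rewrite /cexp !cE !mulrDl expRD cosD sinD; apply: eqc; rewrite !cE /=; ring.
Qed.

Lemma cexpN b t : cexp b t * cexp (- b) t = 1.
Proof.
by rewrite cexpM subrr /cexp /= !mul0r expR0 cos0 sin0 mul1r.
Qed.

Lemma nc_cexp b t : nc (cexp b t) = expR (Re b * t).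
Proof.
rewrite /cexp ncM nc_real ger0_norm ?expR_ge0//= cos2Dsin2 sqrtr1 mulr1//.
Qed.

Lemma nc_cexp_le (B : R) b t : nc b <= B -> I01 t -> nc (cexp b t) <= expR B.
Proof.
move=> bB /mem01[t0 t1]; rewrite nc_cexp ler_expR.
rewrite (le_trans (ler_norm _))// normrM (ger0_norm t0).
by rewrite (le_trans (ler_piMr _ _))// (le_trans (Re_le_nc _)).
Qed.

Lemma cexp_neq0 b t : cexp b t != 0.
Proof.
apply/eqP => h; have := cexpN b t; rewrite h mul0r => /eqP.
by rewrite eq_sym oner_eq0.
Qed.

Lemma ac_cexp b : ac (cexp b) (fun t => b * cexp b t).
Proof.
pose er t : R := expR (Re b * t); pose co t : R := cos (Im b * t).
pose si t : R := sin (Im b * t).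
have reE t : Re (cexp b t) = er t * co t.
  by rewrite /cexp cE /= -/(er t) -/(co t); ring.
have imE t : Im (cexp b t) = er t * si t.
  by rewrite /cexp cE /= -/(er t) -/(si t); ring.
have comp (f : R -> R) (df : R -> R) (a : R) :
    (forall x, is_derive x (1 : R) f (df x)) -> continuous df ->
    rprimitive (fun t => f (a * t)) (fun t => a * df (a * t)).
  move=> dfP cdf.
  have da x : is_derive x (1 : R) (fun t : R => a * t) a.
    have := @is_deriveZ R R R id a x 1 1 (is_derive_id x 1).
    by rewrite /GRing.scale/= mulr1.
  apply: continuous_rprimitive.
    move=> x; apply: cvgM; first exact: cvg_cst.
    apply: (continuous_comp (f := fun t : R => a * t)); last exact: cdf.
    by apply: cvgM; [exact: cvg_cst|exact: cvg_id].
  by move=> x; rewrite mulrC; exact: (@is_derive1_comp _ f (fun t => a * t) x).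
have per : rprimitive er (fun t => Re b * er t).
  by apply: (comp expR expR) => //; exact: continuous_expR.
have pco : rprimitive co (fun t => Im b * - si t).
  apply: (comp cos (fun x => - sin x)) => x; exact/continuousN/continuous_sin.
have psi : rprimitive si (fun t => Im b * co t).
  by apply: (comp sin cos); exact: continuous_cos.
have [pr pi] := (rprimitiveM per pco, rprimitiveM per psi).
have mc : cmeasurable (cexp b).
  have [mr mi] := (rprimitive_measurable pr, rprimitive_measurable pi).
  apply: (@eq_cmeasurable _ (fun t => (er t * co t) +i* (er t * si t))).
    by move=> t _; apply: eqc; rewrite ?reE ?imE.
  by split.
have L : L2 (fun t => b * cexp b t).
  apply: (proj1 (L2Z b _)); apply: (proj1 (@L2_bd _ (expR (nc b) ^+ 2) _ mc _)).
  move=> t t01; rewrite ler_pXn2r ?nnegrE ?nc_ge0 ?expR_ge0//.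
  exact: nc_cexp_le.
split=> //; apply/is_primitiveP; first exact: L2_integrable.
split.
- apply: rprimitive_ext pr => t _; first by rewrite -[RHS]/(Re (cexp b t)) reE.
  by rewrite -[RHS]/(Re (b * cexp b t)) cE reE imE; ring.
- apply: rprimitive_ext pi => t _; first by rewrite -[RHS]/(Im (cexp b t)) imE.
  by rewrite -[RHS]/(Im (b * cexp b t)) cE reE imE; ring.
Qed.

Lemma L2_cexp b : L2 (cexp b).
Proof. exact: (ac_L2 (ac_cexp b)).1. Qed.

End Cexp.

(** * Density of [W_2^2] functions vanishing with their derivative at both ends *)

Section Density.
Context {R : realType}.
Local Notation C := R[i].
Local Notation Re := (@complex.Re R).
Local Notation Im := (@complex.Im R).
Local Notation nc := (@Normc.normc R).
Local Notation mu := (@lebesgue_measure R).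
Local Notation I01 := (`[(0 : R), 1]%classic : set R).
Implicit Types (f g : R -> C) (u v w : R -> R).

Definition W20 (d0 d1 d2 : R -> C) : Prop :=
  [/\ ac d0 d1, ac d1 d2, d0 0 = 0 /\ d0 1 = 0 & d1 0 = 0 /\ d1 1 = 0].

Definition approx f : Prop := L2 f /\ forall eps : R, 0 < eps ->
  exists d0 d1 d2, W20 d0 d1 d2 /\ n2 (fun t => f t - d0 t) < eps.

Lemma W20D d0 d1 d2 e0 e1 e2 : W20 d0 d1 d2 -> W20 e0 e1 e2 ->
  W20 (fun t => d0 t + e0 t) (fun t => d1 t + e1 t) (fun t => d2 t + e2 t).
Proof.
move=> [a b [c d] [e f]] [a' b' [c' d'] [e' f']]; split.
- exact: acD.
- exact: acD.
- by rewrite c c' d d' addr0.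
- by rewrite e e' f f' addr0.
Qed.

Lemma W20Z (z : C) d0 d1 d2 : W20 d0 d1 d2 ->
  W20 (fun t => z * d0 t) (fun t => z * d1 t) (fun t => z * d2 t).
Proof.
move=> [a b [c d] [e f]]; split; [exact: acZ|exact: acZ| |].
- by rewrite c d mulr0.
- by rewrite e f mulr0.
Qed.

Lemma L2B f g : L2 f -> L2 g -> L2 (fun t => f t - g t).
Proof. by move=> Lf Lg; exact: (L2D Lf (L2N Lg).1).1. Qed.

Lemma n2_triangle f g h : L2 f -> L2 g -> L2 h ->
  n2 (fun t => f t - h t) <= 2 * (n2 (fun t => f t - g t) + n2 (fun t => g t - h t)).
Proof.
move=> Lf Lg Lh; have [_] := L2D (L2B Lf Lg) (L2B Lg Lh).
by congr (_ <= _); apply: eq_n2 => t _; rewrite addrA subrK.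
Qed.

Lemma W20_L2 d0 d1 d2 : W20 d0 d1 d2 -> L2 d0.
Proof. by case=> /ac_L2[]. Qed.

Lemma approx_closed f : L2 f ->
  (forall eps : R, 0 < eps -> exists g, approx g /\ n2 (fun t => f t - g t) < eps) ->
  approx f.
Proof.
(* [n2_triangle] is for squared norms and has a factor 2, so two errors below eps / 4 add up to less
   than eps. *)
move=> Lf H; split=> // eps e0; have e40 : 0 < eps / 4 by rewrite divr_gt0.
have [g [[Lg ag] fg]] := H _ e40; have [d0 [d1 [d2 [Wd gd]]]] := ag _ e40.
exists d0, d1, d2; split=> //; have := n2_triangle Lf Lg (W20_L2 Wd); lra.
Qed.

Lemma approxD f g : approx f -> approx g -> approx (fun t => f t + g t).
Proof.
move=> [Lf af] [Lg ag]; split; first exact: (L2D Lf Lg).1.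
move=> eps e0; have e40 : 0 < eps / 4 by rewrite divr_gt0.
have [d0 [d1 [d2 [Wd fd]]]] := af _ e40; have [e0' [e1 [e2 [We ge]]]] := ag _ e40.
exists (fun t => d0 t + e0' t), (fun t => d1 t + e1 t), (fun t => d2 t + e2 t).
split; first exact: W20D.
have [_] := L2D (L2B Lf (W20_L2 Wd)) (L2B Lg (W20_L2 We)).
rewrite (@eq_n2 _ _ (fun t => f t + g t - (d0 t + e0' t))); first lra.
by move=> t _; ring.
Qed.

Lemma approxZ (z : C) f : approx f -> approx (fun t => z * f t).
Proof.
move=> [Lf af]; split; first exact: (L2Z z Lf).1.
move=> eps e0; have K0 : 0 < nc z ^+ 2 + 1.
  by rewrite (@lt_le_trans _ _ 1)// lerDr sqr_ge0.
have e40 : 0 < eps / (nc z ^+ 2 + 1) by rewrite divr_gt0.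
have [d0 [d1 [d2 [Wd fd]]]] := af _ e40.
exists (fun t => z * d0 t), (fun t => z * d1 t), (fun t => z * d2 t).
split; first exact: W20Z.
rewrite (@eq_n2 _ _ (fun t => z * (f t - d0 t))); last by move=> t _; ring.
have [_ /le_lt_trans] := L2Z z (L2B Lf (W20_L2 Wd)); apply.
rewrite ltr_pdivlMr// in fd; apply: le_lt_trans fd.
by rewrite mulrC ler_wpM2l ?n2_ge0// lerDl.
Qed.

Definition rc u : R -> C := fun t => (u t)%:C.

Lemma rc_measurable u : measurable_fun I01 u -> cmeasurable (rc u).
Proof. by move=> mu; split. Qed.

Lemma nc_rc u t : nc (rc u t) ^+ 2 = u t ^+ 2.
Proof. by rewrite nc_real real_normK ?num_real. Qed.

Lemma n2_rc u : n2 (rc u) = \int[mu]_(t in I01) u t ^+ 2.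
Proof. by congr fine; apply: eq_integral => t _; rewrite nc_rc. Qed.

Lemma L2_rc (K : R) u : measurable_fun I01 u -> (forall t, I01 t -> `|u t| <= K) ->
  L2 (rc u).
Proof.
move=> mu uK; apply: (proj1 (@L2_bd _ (K ^+ 2) _ (rc_measurable mu) _)) => t t01.
rewrite nc_rc -(@real_normK _ (u t)) ?num_real// ler_sqr ?nnegrE ?uK//.
exact: le_trans (normr_ge0 _) (uK _ t01).
Qed.

Lemma dct01 (v : nat -> R -> R) w : (forall n, measurable_fun I01 (v n)) ->
  mu.-integrable I01 (EFin \o w) ->
  (forall n t, I01 t -> 0 <= v n t <= w t) ->
  {ae mu, forall t, I01 t -> v ^~ t @ \oo --> 0} ->
  forall eps : R, 0 < eps -> exists n, \int[mu]_(t in I01) v n t < eps.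
Proof.
move=> mv iw vw v0 eps e0.
have v0' : {ae mu, forall t, I01 t -> (fun n => (v n t)%:E) @ \oo --> (cst 0%E : R -> \bar R) t}.
  apply: filterS v0 => t v0 t01; apply: cvg_EFin; first exact: nearW.
  exact: v0 t01.
have vw' : {ae mu, forall t n, I01 t -> (`|(v n t)%:E| <= (EFin \o w) t)%E}.
  apply: filterE => t n t01; have /andP[a b] := vw n t t01.
  by rewrite /= lee_fin ger0_norm.
have mv' n : measurable_fun (I01 : set (measurableTypeR R)) (fun t => (v n t)%:E).
  by apply/measurable_EFinP; exact: mv.
have iv n : mu.-integrable I01 (EFin \o v n).
  apply: le_integrable iw => //; first exact: mv'.
  move=> t t01; rewrite /= lee_fin; have /andP[a b] := vw n t t01.
  by rewrite ger0_norm// (le_trans b)// ler_norm.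
have m01' : measurable (I01 : set (measurableTypeR R)) by exact: m01.
have [_ _] := @dominated_convergence _ _ _ mu _ m01' _ (cst 0%E) _ mv'
  (measurable_cst _) v0' iw vw'.
rewrite integral0 => /fine_cvgP[_ /=] /cvgrPdist_lt /(_ _ e0)[n _] /(_ n (leqnn n)).
rewrite sub0r normrN /= => h; exists n; apply: le_lt_trans h.
exact: ler_norm.
Qed.

Lemma square_integrable_bd (K : R) u : measurable_fun I01 u ->
  (forall t, I01 t -> `|u t| <= K) -> mu.-integrable I01 (EFin \o u).
Proof.
move=> mu_ uK; apply: le_integrable (cst_integrable K) => //.
  by apply/measurable_EFinP; exact: mu_.
by move=> t t01; rewrite /= lee_fin (le_trans (uK _ t01))// ler_norm.
Qed.

(** Continuous functions approximate [u] in L1. Clamping them to [-K, K] does not increase the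
    distance to [u], and |u - c|^2 <= 2 K |u - c| then turns L1 closeness into L2 closeness. *)
Lemma bounded_approx_continuous (K : R) u : measurable_fun I01 u ->
  (forall t, I01 t -> `|u t| <= K) -> forall eps : R, 0 < eps ->
  exists c : R -> R, [/\ continuous c, forall t, `|c t| <= K &
    n2 (fun t => rc u t - rc c t) < eps].
Proof.
move=> mu_ uK eps e0; have iu := square_integrable_bd mu_ uK.
have K0 : 0 <= K by apply: le_trans (normr_ge0 _) (uK 0 in01_0).
(* The added 1 keeps the divisor positive when K = 0. *)
have K2 : 0 < 2 * K + 1 by rewrite ltr_wpDl// mulr_ge0.
have [g_ [cg ig /fine_cvgP[_ /=]]] := approximation_continuous_integrable (m01 : measurable (I01 : set (measurableTypeR R))) mu01_lty iu.
have e1 : 0 < eps / (2 * K + 1) by rewrite divr_gt0.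
move=> /cvgrPdist_lt /(_ _ e1)[n _] /(_ n (leqnn n)).
rewrite sub0r normrN /= => h.
pose c t := Num.max (- K) (Num.min K (g_ n t)).
have cc : continuous c.
  exact: (max_fun_continuous (@cst_continuous _ _ (- K))
    (min_fun_continuous (@cst_continuous _ _ K) (cg n))).
have cK t : `|c t| <= K.
  by rewrite ler_norml /c le_max lexx/= ge_max ge_min lexx/= andbT ge0_cp.
exists c; split=> //.
have mc : measurable_fun I01 c.
  by apply: measurable_funTS; exact: continuous_measurable_fun.
have mgn : measurable_fun I01 (g_ n).
  by apply: measurable_funTS; exact: continuous_measurable_fun.
have iug : mu.-integrable I01 (EFin \o (fun t => `|u t - g_ n t|)).
  exact: integrable_norm (RintegrableB m01 iu (ig n)).
have ug t : I01 t -> `|u t - c t| <= `|u t - g_ n t|.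
  move=> /uK; rewrite ler_norml /c => /andP[a b].
  case: (leP K (g_ n t)) => h1.
    rewrite max_r; last lra.
    by rewrite !ler0_norm; lra.
  case: (leP (-K) (g_ n t)) => h2//.
  by rewrite !ger0_norm; lra.
have [|_] := L2_intro (cmeasurableD (rc_measurable mu_) (cmeasurableN (rc_measurable mc)))
  (RintegrableZ (2 * K) m01 iug).
  move=> t t01; rewrite -[X in nc X](_ : rc (fun t => u t - c t) t = _); last first.
    by apply: eqc; rewrite !cE /= ?subr0 ?oppr0 ?addr0.
  rewrite nc_rc -real_normK ?num_real// expr2 ler_pM//; last exact: ug.
  have := uK _ t01; have := cK t; have := ler_normB (u t) (c t); lra.
move=> /le_lt_trans; apply; rewrite RintegralZl//.
have h' : \int[mu]_(t in I01) `|u t - g_ n t| < eps / (2 * K + 1).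
  apply: le_lt_trans h; apply: le_trans (ler_norm _).
  by rewrite le_eqVlt; apply/orP; left; apply/eqP.
rewrite ltr_pdivlMr// in h'; apply: le_lt_trans h'.
rewrite mulrC ler_wpM2l ?lerDl//.
by apply: Rintegral_ge0.
Qed.

(** The vanishing is imposed on the whole line and not only in [0, 1], because shifted arguments and
    primitives starting at -oo are used below. *)
Definition supported (d : R) u := forall t, t < d \/ 1 - d < t -> u t = 0.

Lemma continuous_measurable01 u : continuous u -> measurable_fun I01 u.
Proof. by move=> cu; apply: measurable_funTS; exact: continuous_measurable_fun. Qed.

Lemma ae_neq (a : R) : {ae mu, forall t : R, t != a}.
Proof.
exists [set a]; split; [exact: measurable_set1|exact: lebesgue_measure_set1|].
by move=> t /= /negP; rewrite negbK => /eqP.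
Qed.

Lemma continuous_L2 u : continuous u -> L2 (rc u).
Proof.
move=> cu; have c2 : continuous (fun t => u t ^+ 2).
  by move=> t; apply: cvgM; exact: cu.
have i2 : mu.-integrable I01 (EFin \o (fun t => u t ^+ 2)).
  apply: continuous_compact_integrable; first exact: segment_compact.
  exact: continuous_subspaceT.
apply: (proj1 (L2_intro (rc_measurable (continuous_measurable01 cu)) i2 _)) => t _.
by rewrite nc_rc.
Qed.

Lemma n2_rcB u v : n2 (fun t => rc u t - rc v t) = \int[mu]_(t in I01) (u t - v t) ^+ 2.
Proof.
rewrite -n2_rc; apply: eq_n2 => t _.
by apply: eqc; rewrite !cE /= ?subr0 ?oppr0 ?addr0.
Qed.

Lemma cutoff (K : R) (c : R -> R) : continuous c -> (forall t, `|c t| <= K) ->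
  forall eps : R, 0 < eps -> exists (g : R -> R) (d : R), [/\ 0 < d, continuous g, supported d g,
    (forall t, `|g t| <= K) & n2 (fun t => rc c t - rc g t) < eps].
Proof.
move=> cc cK eps e0.
(* A continuous trapezoid: 0 outside [0, 1] and within 1/(n+1) of the endpoints, 1 at distance at
   least 2/(n+1) from them inside. It tends to 1 at every interior point, and dominated convergence
   applies. *)
pose chi (n : nat) (t : R) := Num.max 0 (Num.min 1 (n.+1%:R * Num.min t (1 - t) - 1)).
have chi01 n t : 0 <= chi n t /\ chi n t <= 1.
  by rewrite /chi le_max lexx/= ge_max ge_min lexx/= ler01.
have cchi n : continuous (chi n).
  have cm : continuous (fun t : R => n.+1%:R * Num.min t (1 - t) - 1).
    move=> t; apply: cvgB; last exact: cvg_cst.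
    apply: cvgM; first exact: cvg_cst.
    have c1 : continuous (fun t : R => 1 - t).
      by move=> x; apply: cvgB; [exact: cvg_cst|exact: cvg_id].
    have ci : continuous (@idfun R) by move=> x; exact: cvg_id.
    exact: (min_fun_continuous ci c1).
  exact: (max_fun_continuous (@cst_continuous _ _ (0 : R))
    (min_fun_continuous (@cst_continuous _ _ (1 : R)) cm)).
have cg n : continuous (fun t => c t * chi n t).
  by move=> t; apply: cvgM; [exact: cc|exact: cchi].
have K0 : 0 <= K by apply: le_trans (normr_ge0 _) (cK 0).
have [] := @dct01 (fun n t => (c t - c t * chi n t) ^+ 2) (fun=> K ^+ 2) _
  (cst_integrable _) _ _ _ e0.
- move=> n; apply: continuous_measurable01 => t.
  by apply: cvgM; apply: cvgB; [exact: cc|exact: cg|exact: cc|exact: cg].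
- move=> n t _; rewrite sqr_ge0/=.
  have -> : c t - c t * chi n t = c t * (1 - chi n t) by ring.
  rewrite exprMn -(real_normK (num_real (c t))).
  have [a b] := chi01 n t.
  rewrite -[leRHS]mulr1 ler_pM ?sqr_ge0//.
    by rewrite ler_sqr ?nnegrE// cK.
  by rewrite expr_le1//; lra.
- apply: filterS2 (ae_neq 0) (ae_neq 1) => t t0 t1 /mem01[t0' t1'].
  have m0 : 0 < Num.min t (1 - t).
    by rewrite lt_min lt_neqAle eq_sym t0 t0'/= subr_gt0 lt_neqAle t1.
  apply: cvg_near_cst; near=> n.
  suff -> : chi n t = 1 by rewrite mulr1 subrr expr0n.
  rewrite /chi min_l ?max_r// lerBrDr -ler_pdivrMr//.
  rewrite (@le_trans _ _ n%:R)//; last by rewrite ler_nat.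
  by near: n; exact: nbhs_infty_ger.
move=> n; rewrite -n2_rcB => h.
exists (fun t => c t * chi n t), (n.+1%:R^-1); split=> //.
  move=> t ht; suff -> : chi n t = 0 by rewrite mulr0.
  rewrite /chi max_l// ge_min; apply/orP; right; rewrite subr_le0.
  rewrite -ler_pdivlMl// mulr1 ge_min.
  by case: ht => [/ltW ->//|h1]; rewrite orbC lerBlDl -lerBlDr ltW.
move=> t; rewrite normrM -[leRHS]mulr1 ler_pM//.
by have [a b] := chi01 n t; rewrite ger0_norm.
Unshelve. all: by end_near. Qed.

(** The difference quotient with step h. Applied to a primitive of g it is the mean of g over
    [x, x + h], a smoothing that gains one derivative. *)
Definition avg (h : R) u : R -> R := fun x => (u (x + h) - u x) / h.

Lemma avg_derive (h : R) (G g : R -> R) : (forall x, is_derive x (1 : R) G (g x)) ->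
  forall x, is_derive x (1 : R) (avg h G) (avg h g x).
Proof.
move=> dG x.
have d1 : is_derive x (1 : R) (G \o shift h) (g (x + h)).
  rewrite -[g _]mulr1.
  by apply: is_derive1_comp; first [exact: is_derive_shift|exact: dG].
have d2 := is_deriveZ (h^-1) (is_deriveB d1 (dG x)).
have -> : avg h g x = h^-1 *: (g (x + h) - g x) by rewrite /avg mulrC.
by have -> : avg h G = h^-1 \*: ((G \o shift h) - G);
  last exact: d2; apply/funext => y; rewrite /avg mulrC.
Qed.

Lemma is_derive_continuous (G g : R -> R) : (forall x, is_derive x (1 : R) G (g x)) ->
  continuous G.
Proof.
by move=> dG x; apply/differentiable_continuous/derivable1_diffP; apply: ex_derive.
Qed.

Lemma avg_continuous (h : R) u : continuous u -> continuous (avg h u).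
Proof.
move=> cu x; apply: cvgM; last exact: cvg_cst.
apply: cvgB; last exact: cu.
apply: (continuous_comp (f := shift h)); last exact: cu.
by apply: cvgD; [exact: cvg_id|exact: cvg_cst].
Qed.

Lemma avg_supported (d h : R) u : 0 <= h <= d / 2 -> supported d u -> supported (d / 2) (avg h u).
Proof.
move=> /andP[h0 hd] su t [td|td]; rewrite /avg !su ?subrr ?mul0r//.
- by left; lra.
- by left; lra.
- by right; lra.
- by right; lra.
Qed.

(** Since the mean of g over [x, x + h] is a value of g at an intermediate point, its bounds, its
    support and its convergence to g as h tends to 0 can all be read off without estimating an
    integral. *)
Lemma avg_MVT (h x : R) (G g : R -> R) : 0 < h -> (forall x, is_derive x (1 : R) G (g x)) ->
  exists2 c, x < c < x + h & avg h G x = g c.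
Proof.
move=> h0 dG; have xh : x < x + h by rewrite ltrDl.
have [|c] := MVT xh (fun x _ => dG x).
  exact/continuous_subspaceT/is_derive_continuous.
rewrite in_itv/= => xc e; exists c => //.
by rewrite /avg e addrAC subrr add0r mulfK// gt_eqF.
Qed.

Lemma avg_primitive_supported (d h : R) (G g : R -> R) :
  0 < h <= d / 2 -> (forall x, is_derive x (1 : R) G (g x)) -> supported d g ->
  supported (d / 2) (avg h G).
Proof.
move=> /andP[h0 hd] dG sg t td; have [c /andP[c1 c2] ->] := avg_MVT t h0 dG.
by apply: sg; case: td => td; [left|right]; lra.
Qed.

Lemma ac_rc (U u : R -> R) : continuous u -> (forall x, is_derive x (1 : R) U (u x)) ->
  ac (rc U) (rc u).
Proof.
move=> cu dU; have Lu := continuous_L2 cu; split=> //.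
apply/(is_primitiveP _ (L2_integrable Lu)); split.
  by apply: rprimitive_ext (continuous_rprimitive cu dU).
have z : mu.-integrable I01 (EFin \o (fun=> 0 : R)) by exact: cst_integrable.
by split=> // t _; rewrite /= Rintegral_cst// mul0r addr0.
Qed.

Lemma supported_out (d : R) (g : R -> R) x : 0 < d -> supported d g -> ~ I01 x -> g x = 0.
Proof.
move=> d0 sg x01; apply: sg; have [x0|x0] := ltP x 0; first by left; lra.
have [x1|x1] := ltP 1 x; first by right; lra.
by case: x01; rewrite /= in_itv/= x0 x1.
Qed.

Lemma supported_primitive (d : R) (g : R -> R) : 0 < d -> continuous g ->
  supported d g -> exists G : R -> R, forall x, is_derive x (1 : R) G (g x).
Proof.
move=> d0 cg sg.
have ig : mu.-integrable setT (EFin \o g).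
  have -> : g = g \_ I01.
    apply/funext => x; rewrite patchE; case: ifPn => // x01.
    by rewrite (supported_out d0 sg)// => /mem_set; exact/negP.
  rewrite -restrict_EFin; apply/(integrable_mkcond _ _).1; first exact: m01.
  by apply: continuous_compact_integrable; [exact: segment_compact|exact: continuous_subspaceT].
(* Starting the integral at -oo makes the fundamental theorem give the derivative at every real
   point, including 0 and 1. *)
exists (fun x => \int[mu]_(t in `]-oo, x]) g t) => x.
have iu (y : R) : mu.-integrable `]-oo, y] (EFin \o g) by exact: integrableS ig.
have xx : x < x + 1 by rewrite ltrDl.
have [|dG Gx] := @continuous_FTC1 R g -oo%O x (x + 1) xx (iu _) _ (cg x).
  by rewrite ltNyr.
by apply: DeriveDef => //; rewrite -derive1E.
Qed.

Lemma average (K d : R) (g : R -> R) : 0 < d -> continuous g -> supported d g ->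
  (forall t, `|g t| <= K) -> forall eps : R, 0 < eps ->
  exists (h : R) (G : R -> R), [/\ 0 < h <= d / 2,
    forall x, is_derive x (1 : R) G (g x) &
    n2 (fun t => rc g t - rc (avg h G) t) < eps].
Proof.
move=> d0 cg sg gK eps e0; have [G dG] := supported_primitive d0 cg sg.
have h0 n : 0 < d / 2 / n.+1%:R by rewrite !divr_gt0.
have cG := is_derive_continuous dG.
have [] := @dct01 (fun n t => (g t - avg (d / 2 / n.+1%:R) G t) ^+ 2) (fun=> (2 * K) ^+ 2) _
  (cst_integrable _) _ _ _ e0.
- move=> n; apply: continuous_measurable01 => t.
  by apply: cvgM; apply: cvgB; try exact: cg; exact: avg_continuous.
- move=> n t _; rewrite sqr_ge0/= -real_normK ?num_real//.
  have [c _ ->] := avg_MVT t (h0 n) dG.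
  rewrite ler_sqr ?nnegrE//.
    by rewrite (le_trans (ler_normB _ _))//; have := gK t; have := gK c; lra.
  by have := gK t; have := normr_ge0 (g t); lra.
- apply: filterE => t _.
  suff H : g t - avg (d / 2 / n.+1%:R) G t @[n --> \oo] --> 0.
    by rewrite -[0](mulr0 0); exact: (cvgM H H).
  apply/cvgrPdist_lt => e e1.
  have /cvgrPdist_lt /(_ _ e1) [r /= r0 hr] := cg t.
  near=> n; rewrite sub0r opprB.
  have [c /andP[c1 c2] ->] := avg_MVT t (h0 n) dG.
  rewrite distrC; apply: hr => /=; rewrite ltr0_norm ?opprB; last by rewrite subr_lt0.
  rewrite ltrBlDl (lt_trans c2)// ltrD2l.
  rewrite ltr_pdivrMr// -ltr_pdivrMl// (@lt_le_trans _ _ n%:R)//; last by rewrite ler_nat.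
  near: n; exact: nbhs_infty_gtr.
move=> n; rewrite -n2_rcB => h; exists (d / 2 / n.+1%:R), G; split=> //.
by rewrite h0/= ler_pdivrMr// ler_peMr ?ler1n// divr_ge0// ltW.
Unshelve. all: by end_near. Qed.

Lemma avg_bounded (K h : R) (G g : R -> R) : 0 < h -> (forall x, is_derive x (1 : R) G (g x)) ->
  (forall t, `|g t| <= K) -> forall t, `|avg h G t| <= K.
Proof. by move=> h0 dG gK t; have [c _ ->] := avg_MVT t h0 dG. Qed.

(** Averaging twice: the first mean [avg h G] of [g] is of class C^1, and averaging it again gives a
    function with two continuous derivatives. Each averaging halves the margin to the endpoints,
    which stays positive, so the result and its derivative vanish at 0 and 1. *)
Lemma approx_supported (K d : R) (g : R -> R) : 0 < d -> continuous g -> supported d g ->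
  (forall t, `|g t| <= K) -> approx (rc g).
Proof.
move=> d0 cg sg gK; apply: approx_closed; first exact: continuous_L2.
move=> eps e0; have [h [G [h0 dG e]]] := average d0 cg sg gK e0.
exists (rc (avg h G)); split=> //.
have hp : 0 < h by case/andP: h0.
have d20 : 0 < d / 2 by rewrite divr_gt0.
have c1 := @avg_continuous h _ (is_derive_continuous dG).
have s1 := avg_primitive_supported h0 dG sg.
have b1 := avg_bounded hp dG gK; have dg1 := @avg_derive h _ _ dG.
have sh : supported (d / 2) (avg h g).
  by apply: avg_supported => //; case/andP: h0 => /ltW -> ->.
split; first exact: continuous_L2.
move=> eta eta0; have [h' [G1 [h'0 dG1 e']]] := average d20 c1 s1 b1 eta0.
exists (rc (avg h' G1)), (rc (avg h' (avg h G))), (rc (avg h' (avg h g))); split=> //.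
have s2 := avg_primitive_supported h'0 dG1 s1.
have s3 : supported (d / 2 / 2) (avg h' (avg h G)).
  by apply: avg_supported => //; case/andP: h'0 => /ltW -> ->.
have z (u : R -> R) : supported (d / 2 / 2) u -> rc u 0 = 0 /\ rc u 1 = 0.
  by move=> su; rewrite /rc !su//; [right|left]; lra.
split; [| |exact: z|exact: z].
- by apply: ac_rc; [exact: avg_continuous|exact: avg_derive].
- apply: ac_rc; last exact: avg_derive.
  by do 2 apply: avg_continuous.
Qed.

(** Truncating the values at n gives a bounded function, which is close to a continuous one, which
    is close to one vanishing near the endpoints; [approx_closed] absorbs each error in turn. *)
Lemma approx_real u : L2 (rc u) -> approx (rc u).
Proof.
move=> Lu; have mu_ : measurable_fun I01 u by case: (Lu) => -[].
have i2 : mu.-integrable I01 (EFin \o (fun t => u t ^+ 2)).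
  by apply: Rintegrable_eq (L2_sqr_integrable Lu) => [|t _]; rewrite ?nc_rc//; exact: m01.
pose v (n : nat) t := Num.max (- n%:R) (Num.min n%:R (u t)).
have mv n : measurable_fun I01 (v n).
  by apply: measurable_maxr; [exact: measurable_cst|apply: measurable_minr; [exact: measurable_cst|]].
have vn n t : `|v n t| <= n%:R.
  rewrite ler_norml /v le_max lexx/= ge_max ge_min lexx/= andbT.
  by rewrite ge0_cp// ler0n.
apply: approx_closed => // eps e0.
have [] := @dct01 (fun n t => (u t - v n t) ^+ 2) (fun t => u t ^+ 2) _ i2 _ _ _ e0.
- by move=> n; apply: measurable_funX; exact: measurable_funB.
- move=> n t _; rewrite sqr_ge0/= /v.
  have n0 : 0 <= n%:R :> R by [].
  case: (leP n%:R (u t)) => h1; first by rewrite max_r; nra.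
  by case: (leP (- n%:R) (u t)) => h2; nra.
- apply: filterE => t _; apply: cvg_near_cst; near=> n.
  suff -> : v n t = u t by rewrite subrr expr0n.
  have : `|u t| <= n%:R by near: n; exact: nbhs_infty_ger.
  by rewrite ler_norml /v => /andP[a b]; rewrite min_r ?max_r.
move=> n; rewrite -n2_rcB => h; exists (rc (v n)); split=> //.
apply: approx_closed; first exact: L2_rc (mv n) (fun t _ => vn n t).
move=> eta eta0.
have [c [cc cK e1]] := bounded_approx_continuous (mv n) (fun t _ => vn n t) eta0.
exists (rc c); split=> //; apply: approx_closed; first exact: continuous_L2.
move=> eta1 eta10; have [g [d [d0 cg sg gK e2]]] := cutoff cc cK eta10.
by exists (rc g); split=> //; exact: approx_supported d0 cg sg gK.
Unshelve. all: by end_near. Qed.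

Theorem W20_dense f : L2 f -> approx f.
Proof.
move=> Lf; have [[mr mi] _] := Lf.
have Lr : L2 (rc (Re \o f)).
  apply: (proj1 (@le_n2 _ _ f 1 (rc_measurable mr) Lf _)) => t _.
  by rewrite nc_rc mul1r nc_sqr lerDl sqr_ge0.
have Li : L2 (rc (Im \o f)).
  apply: (proj1 (@le_n2 _ _ f 1 (rc_measurable mi) Lf _)) => t _.
  by rewrite nc_rc mul1r nc_sqr lerDr sqr_ge0.
have := approxD (approx_real Lr) (approxZ ('i)%C (approx_real Li)).
congr approx; apply/funext => t; apply: eqc; rewrite !cE /=; ring.
Qed.

End Density.

(** * Series *)

Section NonnegSeries.
Context {R : realType}.
Implicit Types (u v w : nat -> R) (k : nat -> nat).

Definition nns w : \bar R := (\sum_(i <oo) (w i)%:E)%E.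
Definition sm w : Prop := (nns w < +oo)%E.

Lemma nns_ge0 w : (forall i, 0 <= w i) -> (0 <= nns w)%E.
Proof. by move=> w0; apply: nneseries_ge0 => i _ _; rewrite lee_fin. Qed.

Lemma le_nns u w : (forall i, 0 <= u i) -> (forall i, u i <= w i) -> (nns u <= nns w)%E.
Proof.
by move=> u0 uw; apply: lee_nneseries => i *; rewrite lee_fin.
Qed.

Lemma nnsD u w : (forall i, 0 <= u i) -> (forall i, 0 <= w i) ->
  (nns (fun i => u i + w i)%R = nns u + nns w)%E.
Proof.
by move=> u0 w0; rewrite -nneseriesD// => i *; rewrite lee_fin.
Qed.

Lemma nnsZ (c : R) w : (forall i, 0 <= w i) -> (nns (fun i => c * w i)%R = c%:E * nns w)%E.
Proof. by move=> w0; rewrite -nneseriesZl// => i *; rewrite lee_fin. Qed.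

Lemma eq_nns u w : (forall i, u i = w i) -> nns u = nns w.
Proof. by move=> uw; congr nns; apply/funext. Qed.

Lemma sm_le u w : (forall i, 0 <= u i) -> (forall i, u i <= w i) -> sm w -> sm u.
Proof. by move=> u0 uw; apply: le_lt_trans; exact: le_nns. Qed.

Lemma smD u w : (forall i, 0 <= u i) -> (forall i, 0 <= w i) -> sm u -> sm w ->
  sm (fun i => u i + w i).
Proof. by move=> u0 w0 su sw; rewrite /sm nnsD// lte_add_pinfty. Qed.

Lemma smZ (c : R) w : 0 <= c -> (forall i, 0 <= w i) -> sm w -> sm (fun i => c * w i).
Proof.
by move=> c0 w0 sw; rewrite /sm nnsZ// lte_mul_pinfty ?lee_fin.
Qed.

Lemma sm_cvg w : (forall i, 0 <= w i) -> sm w -> cvgn (series w).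
Proof. exact: nnseries_is_cvg. Qed.

Lemma nns_lim w : (forall i, 0 <= w i) -> sm w -> nns w = (limn (series w))%:E.
Proof.
move=> w0 sw; rewrite -EFin_lim; last exact: sm_cvg.
by apply/congr_lim/funext => n /=; rewrite sumEFin.
Qed.

Lemma le_nns_term w i : (forall i, 0 <= w i) -> ((w i)%:E <= nns w)%E.
Proof.
move=> w0; apply: le_trans (nneseries_lim_ge i.+1 _); last by move=> *; rewrite lee_fin.
by rewrite big_nat_recr//= leeDr// sume_ge0// => *; rewrite lee_fin.
Qed.

Lemma nns_single (j : nat) (a : R) : 0 <= a ->
  nns (fun i => if j == i then a else 0) = a%:E.
Proof.
move=> a0; rewrite /nns (@nneseriesD1 _ _ j)//=; last first.
  by move=> i _; rewrite lee_fin; case: ifP.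
rewrite eqxx eseries0 ?adde0// => i _ /=.
by rewrite eq_sym => /negbTE ->.
Qed.

(** The restriction of [w] to the fibre of [k] over [j]. For the parent map this keeps the terms of
    the edges leaving the vertex v_j. *)
Definition fib k w (j n : nat) : R := if k n == j then w n else 0.

Lemma fib_ge0 k w j n : (forall i, 0 <= w i) -> 0 <= fib k w j n.
Proof. by move=> w0; rewrite /fib; case: ifP. Qed.

Lemma fib_le k w j n : (forall i, 0 <= w i) -> fib k w j n <= w n.
Proof. by move=> w0; rewrite /fib; case: ifP. Qed.

(** Regrouping by fibres is an interchange of two nonnegative sums: for fixed n only j = k n
    contributes. *)
Lemma nns_fib k w : (forall i, 0 <= w i) ->
  nns w = (\sum_(j <oo) nns (fib k w j))%E.
Proof.
move=> w0; rewrite /nns nneseries_interchange; last first.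
  by move=> i j; rewrite lee_fin fib_ge0.
apply: eq_eseriesr => n _.
by rewrite -[RHS]/(nns (fun i => if k n == i then w n else 0)) nns_single.
Qed.

Lemma sm_fib k w j : (forall i, 0 <= w i) -> sm w -> sm (fib k w j).
Proof. by move=> w0; apply: sm_le => i; [exact: fib_ge0|exact: fib_le]. Qed.

Definition asm u := sm (fun i => `|u i|).

Lemma asm_cvg u : asm u -> cvgn (series u).
Proof. by move=> su; apply: normed_cvg; exact: (@sm_cvg (fun i => `|u i|)). Qed.

Lemma series_fib_nneg k w : (forall i, 0 <= w i) -> sm w ->
  sm (fun j => limn (series (fib k w j))) /\
  limn (series w) = limn (series (fun j => limn (series (fib k w j)))).
Proof.
move=> w0 sw.
have e j : nns (fib k w j) = (limn (series (fib k w j)))%:E.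
  by apply: nns_lim; [move=> i; exact: fib_ge0|exact: sm_fib].
have l0 j : 0 <= limn (series (fib k w j)).
  by rewrite -lee_fin -e nns_ge0// => i; exact: fib_ge0.
have E : nns w = nns (fun j => limn (series (fib k w j))).
  by rewrite (nns_fib k w0); apply: eq_eseriesr => j _; rewrite e.
have s : sm (fun j => limn (series (fib k w j))) by rewrite /sm -E.
by split=> //; apply: EFin_inj; rewrite -nns_lim// E nns_lim.
Qed.

(* Signed case: write [u = (u + |u|) - |u|]. *)
Lemma series_fib k u : asm u ->
  asm (fun j => limn (series (fib k u j))) /\
  limn (series u) = limn (series (fun j => limn (series (fib k u j)))).
Proof.
move=> su; pose p i := u i + `|u i|; pose q i := `|u i|.
have p0 i : 0 <= p i by rewrite /p -lerBlDr sub0r lerNnormlW.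
have q0 i : 0 <= q i by rewrite /q.
have sp : sm p.
  apply: (@sm_le _ (fun i => 2 * `|u i|)) => //; last exact: smZ.
  by move=> i; rewrite /p mulr_natl mulr2n lerD2r ler_norm.
have sq : sm q by [].
have upq : u = p - q by apply/funext => i; rewrite /p /q !fctE addrK.
have [fp ep] := series_fib_nneg k p0 sp; have [fq eq] := series_fib_nneg k q0 sq.
have fu j : limn (series (fib k u j)) = limn (series (fib k p j)) - limn (series (fib k q j)).
  rewrite -lim_seriesB; [|by apply: sm_cvg; [move=> i; exact: fib_ge0|exact: sm_fib]..].
  congr (limn (series _)); apply/funext => i; rewrite !fctE /fib {1}upq.
  by case: ifP => _; rewrite ?subr0.
have l0 w : (forall i, 0 <= w i) -> sm w -> forall j, 0 <= limn (series (fib k w j)).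
  move=> w0 sw j; rewrite -lee_fin -nns_lim; [|by move=> i; exact: fib_ge0|exact: sm_fib].
  by apply: nns_ge0 => i; exact: fib_ge0.
split.
  apply: (@sm_le _ (fun j => limn (series (fib k p j)) + limn (series (fib k q j)))) => //.
    by move=> j; rewrite fu (le_trans (ler_normB _ _))// !ger0_norm// l0.
  by apply: smD => //; apply: l0.
rewrite {1}upq lim_seriesB; [|exact: sm_cvg p0 sp|exact: sm_cvg q0 sq].
rewrite ep eq -lim_seriesB; [|by apply: sm_cvg => //; apply: l0..].
by congr (limn (series _)); apply/funext => j; rewrite !fctE fu.
Qed.

Lemma asm_lim_le u : asm u -> `|limn (series u)| <= limn (series (fun i => `|u i|)).
Proof. by move=> su; apply: lim_series_norm; exact: (@sm_cvg (fun i => `|u i|)). Qed.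

End NonnegSeries.

(** * Absolutely convergent complex series *)

Section ComplexSeries.
Context {R : realType}.
Local Notation C := R[i].
Local Notation Re := (@complex.Re R).
Local Notation Im := (@complex.Im R).
Local Notation nc := (@Normc.normc R).
Implicit Types (u v w : nat -> C) (k : nat -> nat).

Definition cs u := sm (fun i => nc (u i)).

Lemma cs_parts u : cs u -> asm (Re \o u) /\ asm (Im \o u).
Proof.
by move=> su; split; apply: sm_le su => // i; [exact: Re_le_nc|exact: Im_le_nc].
Qed.

Lemma parts_cs u : asm (Re \o u) -> asm (Im \o u) -> cs u.
Proof.
move=> r i; apply: sm_le (smD _ _ r i) => // n; first exact: nc_ge0.
exact: nc_le_ReIm.
Qed.

Lemma cs_le (w : nat -> R) u : (forall i, nc (u i) <= w i) -> sm w -> cs u.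
Proof. by move=> uw; apply: sm_le => // i; exact: nc_ge0. Qed.

Lemma csD u v : cs u -> cs v -> cs (fun i => u i + v i).
Proof.
move=> su sv; apply: cs_le (smD _ _ su sv) => i; try exact: nc_ge0.
exact: ncD.
Qed.

Lemma csZ (c : C) u : cs u -> cs (fun i => c * u i).
Proof.
move=> su; apply: cs_le (smZ (nc_ge0 c) _ su) => i; last exact: nc_ge0.
by rewrite ncM.
Qed.

Lemma cs0 : cs (fun=> 0).
Proof.
rewrite /cs /sm /nns eseries0 ?ltry// => i _ _.
by rewrite nc0.
Qed.

Lemma eq_csum u v : (forall i, u i = v i) -> csum u = csum v.
Proof. by move=> uv; congr csum; apply/funext. Qed.

Lemma csumD u v : cs u -> cs v -> csum (fun i => u i + v i) = csum u + csum v.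
Proof.
move=> /cs_parts[ru iu] /cs_parts[rv iv]; apply: eqc; rewrite cE /=.
- rewrite -lim_seriesD; [|exact: asm_cvg..].
  by congr (limn (series _)); apply/funext => i; rewrite cE.
- rewrite -lim_seriesD; [|exact: asm_cvg..].
  by congr (limn (series _)); apply/funext => i; rewrite cE.
Qed.

Lemma csumZ (c : C) u : cs u -> csum (fun i => c * u i) = c * csum u.
Proof.
move=> /cs_parts[ru iu]; apply: eqc; rewrite cE /=.
- rewrite -[X in X - _]/(_ *: _) -[X in _ - X]/(_ *: _) -!lim_seriesZ; [|exact: asm_cvg..].
  rewrite -lim_seriesB; [|by apply: is_cvg_seriesZ; exact: asm_cvg..].
  by congr (limn (series _)); apply/funext => i; rewrite cE.
- rewrite -[X in X + _]/(_ *: _) -[X in _ + X]/(_ *: _) -!lim_seriesZ; [|exact: asm_cvg..].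
  rewrite -lim_seriesD; [|by apply: is_cvg_seriesZ; exact: asm_cvg..].
  by congr (limn (series _)); apply/funext => i; rewrite cE.
Qed.

Lemma csum_conj u : cs u -> csum (fun i => (u i)^*) = (csum u)^*.
Proof.
move=> /cs_parts[ru iu]; apply: eqc; rewrite cE /=.
- by congr (limn (series _)); apply/funext => i; rewrite cE.
- rewrite -lim_seriesN; last exact: asm_cvg.
  by congr (limn (series _)); apply/funext => i; rewrite cE.
Qed.

Lemma csum_real (w : nat -> R) : csum (fun i => (w i)%:C) = (limn (series w))%:C.
Proof.
apply: eqc => //=; apply/cvg_lim => //.
rewrite (_ : series _ = fun=> 0); first exact: cvg_cst.
by apply/funext => n; rewrite /series/= big1.
Qed.

Lemma csum0 : csum (fun=> 0 : C) = 0.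
Proof.
have -> : csum (fun=> 0 : C) = csum (fun=> 0 * 0) by apply: eq_csum => i; rewrite mulr0.
by rewrite csumZ ?mul0r//; exact: cs0.
Qed.

Definition cfib k u (j n : nat) : C := if k n == j then u n else 0.

Lemma csum_fib k u : cs u -> cs (fun j => csum (cfib k u j)) /\
  csum u = csum (fun j => csum (cfib k u j)).
Proof.
move=> /cs_parts[ru iu].
have er j : Re \o cfib k u j = fib k (Re \o u) j.
  by apply/funext => n; rewrite /= /cfib /fib; case: ifP.
have ei j : Im \o cfib k u j = fib k (Im \o u) j.
  by apply/funext => n; rewrite /= /cfib /fib; case: ifP.
have [sr fr] := series_fib k ru; have [si fi] := series_fib k iu.
have Er : Re \o (fun j => csum (cfib k u j)) = fun j => limn (series (fib k (Re \o u) j)).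
  by apply/funext => j; rewrite -er.
have Ei : Im \o (fun j => csum (cfib k u j)) = fun j => limn (series (fib k (Im \o u) j)).
  by apply/funext => j; rewrite -ei.
split; first by apply: parts_cs; rewrite ?Er ?Ei.
apply: eqc; first by rewrite -[RHS]/(limn (series (Re \o _))) Er -fr.
by rewrite -[RHS]/(limn (series (Im \o _))) Ei -fi.
Qed.

Lemma nc_csum_le (w : nat -> R) u : (forall i, nc (u i) <= w i) -> sm w ->
  nc (csum u) <= 2 * limn (series w).
Proof.
move=> uw sw; have [ru iu] := cs_parts (cs_le uw sw).
have w0 i : 0 <= w i by apply: le_trans (uw i); exact: nc_ge0.
have H (r : nat -> R) : asm r -> (forall i, `|r i| <= w i) ->
    `|limn (series r)| <= limn (series w).
  move=> ar rw; apply: le_trans (asm_lim_le ar) _.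
  by rewrite -lee_fin -!nns_lim//; apply: le_nns.
apply: (le_trans (nc_le_ReIm _)); rewrite mulr_natl mulr2n lerD//; apply: H => // i.
  by apply: le_trans (uw i); exact: Re_le_nc.
by apply: le_trans (uw i); exact: Im_le_nc.
Qed.

End ComplexSeries.

(** * The operator on one edge *)

Section Edge.
Context {R : realType}.
Local Notation C := R[i].
Local Notation Re := (@complex.Re R).
Local Notation Im := (@complex.Im R).
Local Notation nc := (@Normc.normc R).
Local Notation mu := (@lebesgue_measure R).
Local Notation I01 := (`[(0 : R), 1]%classic : set R).
Implicit Types (b : C) (f y z : R -> C) (B : R).

Lemma nc_sqr_leM (K : R) (x y : C) : nc x <= K -> nc (x * y) ^+ 2 <= K ^+ 2 * nc y ^+ 2.
Proof.
move=> xK; have K0 : 0 <= K := le_trans (nc_ge0 _) xK.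
by rewrite nc_sqrM ler_wpM2r ?sqr_ge0// ler_pXn2r ?nnegrE ?nc_ge0.
Qed.

Lemma cintegral_00 f : cintegral `[0, 0] f = 0.
Proof. by apply: eqc => /=; rewrite set_itv1 Rintegral_set1. Qed.

Lemma L2_cexpM B b f : nc b <= B -> L2 f ->
  L2 (fun t => cexp b t * f t) /\ n2 (fun t => cexp b t * f t) <= expR B ^+ 2 * n2 f.
Proof.
move=> bB Lf; apply: L2_bdM => //; first exact: L2_meas (L2_cexp b).
by move=> t; exact: nc_cexp_le.
Qed.

(** One factor e^(2B) comes from removing the integrating factor, the 2 and the 8 from [ac_bound],
    and the inner e^(2B) from the norm of the integrating factor times y' + b y. *)
Definition C1 B : R := expR B ^+ 2 * (2 + 8 * expR B ^+ 2).

Lemma C1_ge0 B : 0 <= C1 B.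
Proof. by rewrite mulr_ge0 ?sqr_ge0// addr_ge0// mulr_ge0 ?sqr_ge0. Qed.

(* [(e^(b t) y)' = e^(b t) (y' + b y)] *)
Lemma edge_bound B b y y' : nc b <= B -> ac y y' -> forall t, I01 t ->
  nc (y t) ^+ 2 <= C1 B * (nc (y 0) ^+ 2 + n2 (fun t => y' t + b * y t)).
Proof.
move=> bB Hy t t01; have [Ly _] := ac_L2 Hy.
have Lu : L2 (fun t => y' t + b * y t) := (L2D Hy.1 (L2Z b Ly).1).1.
have [Lg ng] := L2_cexpM bB Lu.
have Hg : ac (fun t => cexp b t * y t) (fun t => cexp b t * (y' t + b * y t)).
  by apply: ac_ext (acM (ac_cexp b) Hy) => // s _; ring.
have := ac_bound Hg t01; rewrite cexp0 mul1r => h.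
have -> : y t = cexp (- b) t * (cexp b t * y t).
  by rewrite mulrA (mulrC (cexp (- b) t)) cexpN mul1r.
have bB' : nc (- b) <= B by rewrite ncN.
apply: (le_trans (nc_sqr_leM _ (nc_cexp_le bB' t01))).
rewrite /C1 -mulrA ler_wpM2l ?sqr_ge0// (le_trans h)//.
move: ng; set N := n2 _; set m := n2 _ => ng.
have X0 := sqr_ge0 (expR B); have a0 := sqr_ge0 (nc (y 0)).
have m0 : 0 <= m by exact: n2_ge0.
by have := mulr_ge0 X0 a0; nra.
Qed.

Lemma edge_bound_n2 B b y y' : nc b <= B -> ac y y' ->
  n2 y <= C1 B * (nc (y 0) ^+ 2 + n2 (fun t => y' t + b * y t)).
Proof.
move=> bB Hy; apply: (proj2 (L2_bd (ac_measurable Hy) _)) => t t01.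
exact: edge_bound.
Qed.

Lemma green b (y0 y1 y2 z0 z1 : R -> C) : ac y0 y1 -> ac y1 y2 -> ac z0 z1 ->
  cintegral I01 (fun t => (- y2 t - 2%:R * 'i * (Im b)%:C * y1 t + `|b| ^+ 2 * y0 t) * (z0 t)^*) =
  cintegral I01 (fun t => (y1 t + b * y0 t) * (z1 t + b * z0 t)^*)
  - (y1 1 + b * y0 1) * (z0 1)^* + (y1 0 + b * y0 0) * (z0 0)^*.
Proof.
move=> H0 H1 Hz.
have Hu : ac (fun t => y1 t + b * y0 t) (fun t => y2 t + b * y1 t) := acD H1 (acZ b H0).
have Huz := acM Hu (ac_conj Hz).
have [Ly0 _] := ac_L2 H0; have [Lz0 _] := ac_L2 Hz.
have Lu : L2 (fun t => y1 t + b * y0 t) := (L2D H0.1 (L2Z b Ly0).1).1.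
have Lw : L2 (fun t => z1 t + b * z0 t) := (L2D Hz.1 (L2Z b Lz0).1).1.
have iuw : cintegrable I01 (fun t => (y1 t + b * y0 t) * (z1 t + b * z0 t)^*).
  exact: L2_mul_integrable Lu (L2_conj Lw).
have iuz := L2_integrable Huz.1.
have E := ac1 Huz; rewrite /= in E.
(* With this identity the differential expression becomes -u' + conj(b) u for u = y' + b y, and the
   derivative term is integrated against conj(z) by the product rule. *)
have b2i : 2%:R * 'i * (Im b)%:C = b - b^*.
  by apply: eqc; case: (b) => p q; rewrite -complexiE !cE /=; ring.
rewrite (@eq_cintegral _ _ _ (fun t => (y1 t + b * y0 t) * (z1 t + b * z0 t)^* +
  - ((y2 t + b * y1 t) * (z0 t)^* + (y1 t + b * y0 t) * (z1 t)^*))); last first.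
  by move=> t _; rewrite b2i sqrc_norm !rmorphD !rmorphM/=; ring.
rewrite cintegralD//; last exact: (cintegrableN m01 iuz).
rewrite cintegralN//.
have -> : cintegral I01 (fun t => (y2 t + b * y1 t) * (z0 t)^* +
   (y1 t + b * y0 t) * (z1 t)^*) =
  (y1 1 + b * y0 1) * (z0 1)^* - (y1 0 + b * y0 0) * (z0 0)^*.
  by rewrite E; ring.
by ring.
Qed.

Lemma nc_cintegral_mul_le f g : L2 f -> L2 g ->
  nc (cintegral I01 (fun t => f t * (g t)^*)) <= 2 * (n2 f + n2 g).
Proof.
move=> Lf Lg; have if2 := L2_sqr_integrable Lf; have ig2 := L2_sqr_integrable Lg.
have := nc_cintegral_le in01_1 (cmeasurableM (L2_meas Lf) (L2_meas (L2_conj Lg)))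
  (fun t _ => nc_mul_le (f t) ((g t)^*)).
under [X in EFin \o X]eq_fun do rewrite nc_conj.
move=> /(_ (RintegrableD m01 if2 ig2)); congr (_ <= 2 * _).
under eq_Rintegral do rewrite nc_conj.
by rewrite RintegralD.
Qed.

(* The solutions of the edge equation, parametrized by [a = y(0)] and
   [c = (y' + b y)(0)], have end values affine in [(a, c)]; the coefficients [E],
   [P], [Q] depend on [b] and [f] only. *)
Record edge_solver B (K : R) b f (E : R) (P Q : C) : Prop := EdgeSolver {
  es_E : expR (- (B + B)) <= E;
  es_P : nc P ^+ 2 <= K * n2 f;
  es_Q : nc Q ^+ 2 <= K * n2 f;
  es_sol : forall a c : C, exists d0 d1 d2 : R -> C,
    [/\ ac d0 d1 /\ ac d1 d2,
        d0 0 = a /\ d1 0 + b * d0 0 = c,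
        d0 1 = cexp (- b) 1 * (a + c * E%:C - P) /\
          d1 1 + b * d0 1 = cexp (b^*) 1 * (c - Q),
        (forall t, - d2 t - 2%:R * 'i * (Im b)%:C * d1 t + `|b| ^+ 2 * d0 t = f t) &
        let S := nc a ^+ 2 + nc c ^+ 2 + n2 f in
        [/\ n2 d0 <= K * S, n2 d1 <= K * S, n2 d2 <= K * S & nc (d0 1) ^+ 2 <= K * S] ]
}.

Lemma cexp_conj_mul b t : cexp b t * cexp (b^*) t = (expR ((Re b + Re b) * t))%:C.
Proof.
rewrite cexpM /cexp !cE subrr mul0r cos0 sin0.
by apply: eqc; rewrite !cE /=; ring.
Qed.

Lemma n2_add_le (x y : R -> C) : L2 x -> L2 y -> forall r s : R,
  n2 x <= r -> n2 y <= s -> n2 (fun t => x t + y t) <= 2 * (r + s).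
Proof.
move=> Lx Ly r s xr ys; apply: le_trans (L2D Lx Ly).2 _.
by rewrite ler_wpM2l// lerD.
Qed.

Lemma exponent_bound B b t : 0 <= B -> nc b <= B -> 0 <= t -> t <= 1 ->
  - (B + B) <= (Re b + Re b) * t.
Proof.
move=> B0 bB t0 t1.
have := le_trans (Re_le_nc b) bB; rewrite ler_norml => /andP[r1 r2].
have : 0 <= (Re b + B) * t by rewrite mulr_ge0//; lra.
have : 0 <= B * (1 - t) by rewrite mulr_ge0//; lra.
lra.
Qed.

Lemma u_bound (X a c n : R) : 0 <= X -> 0 <= a -> 0 <= c -> 0 <= n ->
  2 * c + 8 * (X * n) <= (2 + 8 * X) * (a + c + n).
Proof.
move=> X0 a0 c0 n0.
by have := mulr_ge0 X0 a0; have := mulr_ge0 X0 c0; lra.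
Qed.

Lemma le_sum5 (a1 a2 a3 a4 a5 : R) : 0 <= a1 -> 0 <= a2 -> 0 <= a3 -> 0 <= a4 ->
  0 <= a5 -> [/\ 0 <= a1 + a2 + a3 + a4 + a5, a2 <= a1 + a2 + a3 + a4 + a5,
    a3 <= a1 + a2 + a3 + a4 + a5, a4 <= a1 + a2 + a3 + a4 + a5 &
    a5 <= a1 + a2 + a3 + a4 + a5].
Proof. by move=> *; split; lra. Qed.

(** Two first-order equations are integrated in turn. From u' = conj(b) u - f and u(0) = c one gets
    u = e^(conj(b) t) (c - Phi), with Phi the integral of e^(-conj(b) s) f; from y' = u - b y and
    y(0) = a one gets y = e^(-b t) (a + the integral of e^(b s) u). Hence E is the integral of e^(2
    t Re b), P that of e^(2 t Re b) Phi, and Q = Phi(1). The constant depends on the bound B only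
    and is thus common to all edges. *)
Lemma edge_solve B : 0 <= B -> exists2 K, 0 <= K &
  forall b f, nc b <= B -> L2 f -> exists E P Q, edge_solver B K b f E P Q.
Proof.
move=> B0; pose X := expR B ^+ 2.
have X1 : 1 <= X by apply: exprn_ege1; rewrite -expR0 ler_expR.
(* [Ku] controls u, [Ky] controls y and y(1), [K1] and [K2] the two derivatives, and [KP] below P
   and Q; [K] is their sum and so dominates each of them. *)
pose Ku := X * (2 + 8 * X); pose Ky := C1 B * (1 + Ku).
pose B2 := B ^+ 2.
pose K1 := 2 * (Ku + B2 * Ky); pose K2 := 2 * (2 * (B2 * Ku + 1) + B2 * K1).
have X0 : 0 <= X by exact: le_trans X1.
have B20 : 0 <= B2 by exact: sqr_ge0.
have Ku0 : 0 <= Ku by rewrite mulr_ge0// addr_ge0// mulr_ge0.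
have Ky0 : 0 <= Ky by rewrite mulr_ge0 ?C1_ge0// addr_ge0.
have K10 : 0 <= K1 by rewrite mulr_ge0// addr_ge0// mulr_ge0.
have K20 : 0 <= K2 by rewrite mulr_ge0// addr_ge0 ?mulr_ge0// addr_ge0// mulr_ge0.
pose KP := 32 * X ^+ 3 + 4 * X.
have X30 : 0 <= X ^+ 3 by rewrite exprn_ge0.
have KP0 : 0 <= KP by rewrite addr_ge0// mulr_ge0.
have [] := le_sum5 Ku0 Ky0 K10 K20 KP0.
set K := Ku + _ + _ + _ + _ => K_ge0 KyK K1K K2K KPK; exists K => //; clearbody K.
move=> b f bB Lf.
have bcB : nc (b^*) <= B by rewrite nc_conj.
have bnB : nc (- b) <= B by rewrite ncN.
have bcnB : nc (- b^*) <= B by rewrite ncN.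
have [LF nF] := L2_cexpM bcnB Lf.
(* The summand 0 gives [Phi] the shape of [ac_integral]. *)
pose Phi t := 0 + cintegral `[0, t] (fun t => cexp (- b^*) t * f t).
have HPhi : ac Phi (fun t => cexp (- b^*) t * f t) by exact: ac_integral.
have Phi0 : Phi 0 = 0 by rewrite /Phi cintegral_00 addr0.
have [LPhi nPhi] := ac_L2 HPhi.
rewrite Phi0 nc0 expr0n/= mulr0 add0r in nPhi.
have LeP : L2 (fun t => cexp b t * (cexp (b^*) t * Phi t)).
  by apply: (L2_cexpM bB _).1; exact: (L2_cexpM bcB _).1.
have LcP := L2_cexpM bcB LPhi.
have nP := (L2_cexpM bB LcP.1).2.
pose E := \int[mu]_(t in I01) expR ((Re b + Re b) * t).
pose P := cintegral I01 (fun t => cexp b t * (cexp (b^*) t * Phi t)).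
have f0 := n2_ge0 f.
have HP : nc P ^+ 2 <= KP * n2 f.
  apply: le_trans (nc_cintegral_sqr in01_1 LeP) _.
  apply: (@le_trans _ _ (4 * (X * (X * (8 * (X * n2 f)))))).
    rewrite ler_wpM2l// (le_trans nP)// ler_wpM2l// (le_trans LcP.2)// ler_wpM2l//.
    by rewrite (le_trans nPhi)// ler_wpM2l.
  rewrite (_ : 4 * _ = 32 * X ^+ 3 * n2 f); last by ring.
  by rewrite ler_wpM2r// lerDl mulr_ge0.
have HQ : nc (Phi 1) ^+ 2 <= KP * n2 f.
  rewrite /Phi add0r; apply: le_trans (nc_cintegral_sqr in01_1 LF) _.
  apply: (@le_trans _ _ (4 * X * n2 f)); first by rewrite -mulrA ler_wpM2l.
  by rewrite ler_wpM2r// lerDr mulr_ge0.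
have LE : L2 (fun t => cexp b t * cexp (b^*) t).
  exact: (L2_cexpM bB (L2_cexp (b^*))).1.
have IE : cintegral I01 (fun t => cexp b t * cexp (b^*) t) = E%:C.
  rewrite (@eq_cintegral _ _ _ (fun t => (expR ((Re b + Re b) * t))%:C)); last first.
    by move=> t _; exact: cexp_conj_mul.
  by apply: eqc => //=; rewrite Rintegral_cst//= mul0r.
exists E, P, (Phi 1); split.
- have iE : mu.-integrable I01 (EFin \o (fun t => expR ((Re b + Re b) * t))).
    by apply: (Rintegrable_eq m01 _ (L2_integrable LE).1) => t _; rewrite /comp cexp_conj_mul.
  rewrite -[leLHS](n2_const (expR_ge0 _)); apply: le_Rintegral => //.
    exact: cst_integrable.
  move=> t /mem01[t0 t1]; rewrite ler_expR.
  exact: exponent_bound.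
- by rewrite (le_trans HP)// ler_wpM2r.
- by rewrite (le_trans HQ)// ler_wpM2r.
move=> a c.
have Hv : ac (fun t => c - Phi t) (fun t => - (cexp (- b^*) t * f t)).
  by apply: ac_ext (acD (ac_cst c) (acZ (-1) HPhi)) => t _; ring.
have ecn t : cexp (b^*) t * cexp (- b^*) t = 1 by exact: cexpN.
have ebn t : cexp (- b) t * cexp b t = 1 by rewrite mulrC cexpN.
pose u t := cexp (b^*) t * (c - Phi t).
have Hu : ac u (fun t => b^* * u t - f t).
  apply: ac_ext (acM (ac_cexp (b^*)) Hv) => // t _.
  by rewrite /u mulrN [_ * (_ * f t)]mulrA ecn; ring.
have [Lv nv] := ac_L2 Hv; rewrite Phi0 subr0 in nv.
have [Lu nu] := L2_cexpM bcB Lv.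
have [Lg ng] := L2_cexpM bB Lu.
pose y t := cexp (- b) t * (a + cintegral `[0, t] (fun t => cexp b t * u t)).
have Hy : ac y (fun t => u t - b * y t).
  apply: ac_ext (acM (ac_cexp (- b)) (ac_integral a Lg)) => // t _.
  by rewrite /y [_ * (_ * u t)]mulrA ebn; ring.
have Hy1 : ac (fun t => u t - b * y t) (fun t => (b^* * u t - f t) - b * (u t - b * y t)).
  by apply: ac_ext (acD Hu (acZ (- b) Hy)) => t _; ring.
have y0 : y 0 = a by rewrite /y cexp0 mul1r cintegral_00 addr0.
have u0 : u 0 = c by rewrite /u cexp0 mul1r Phi0 subr0.
have uy t : u t - b * y t + b * y t = u t by rewrite subrK.
have [Ly _] := ac_L2 Hy.
exists y, (fun t => u t - b * y t), (fun t => (b^* * u t - f t) - b * (u t - b * y t)).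
split=> //.
- by rewrite uy.
- split; last by rewrite uy.
  rewrite /y; congr (_ * _); rewrite -addrA; congr (_ + _).
  rewrite (@eq_cintegral _ _ _ (fun t => c * (cexp b t * cexp (b^*) t) +
     - (cexp b t * (cexp (b^*) t * Phi t)))); last by move=> t _; rewrite /u; ring.
  have i1 := L2_integrable LE; have i2 := L2_integrable LeP.
  rewrite cintegralD//; [|exact: (cintegrableZ c m01 i1)|exact: (cintegrableN m01 i2)].
  by rewrite cintegralZ// cintegralN// IE.
- move=> t; rewrite sqrc_norm.
  have -> : 2%:R * 'i * (Im b)%:C = b - b^*.
    by apply: eqc; case: (b) => p q; rewrite -complexiE !cE /=; ring.
  by ring.
have Ea := sqr_ge0 (nc a); have Ec := sqr_ge0 (nc c).
set S := nc a ^+ 2 + nc c ^+ 2 + n2 f.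
have S0 : 0 <= S by rewrite !addr_ge0.
have nu' : n2 u <= Ku * S.
  apply: (@le_trans _ _ (X * (2 * nc c ^+ 2 + 8 * (X * n2 f)))).
    rewrite (le_trans nu)// ler_wpM2l// (le_trans nv)// lerD2l ler_wpM2l//.
    apply: le_trans nF; apply: le_trans (L2N LF).2; exact: lexx.
  rewrite /Ku -mulrA ler_wpM2l// /S; exact: u_bound.
have eu : n2 (fun t => u t - b * y t + b * y t) = n2 u by apply: eq_n2 => t _.
have ny' : n2 y <= Ky * S.
  have := edge_bound_n2 bB Hy; rewrite eu y0 => /le_trans; apply.
  rewrite /Ky -mulrA ler_wpM2l ?C1_ge0// mulrDl mul1r lerD//.
  by rewrite /S -addrA lerDl addr_ge0.
have y1' : nc (y 1) ^+ 2 <= Ky * S.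
  have := edge_bound bB Hy in01_1; rewrite eu y0 => /le_trans; apply.
  rewrite /Ky -mulrA ler_wpM2l ?C1_ge0// mulrDl mul1r lerD//.
  by rewrite /S -addrA lerDl addr_ge0.
have bB2 : nc b ^+ 2 <= B2 by rewrite ler_pXn2r ?nnegrE ?nc_ge0.
have Z (z : C) (x : R -> C) (k : R) : L2 x -> nc z ^+ 2 <= B2 -> n2 x <= k * S ->
    n2 (fun t => z * x t) <= B2 * k * S.
  move=> Lx zB xk; apply: le_trans (L2Z z Lx).2 _; rewrite -mulrA.
  by rewrite ler_pM ?sqr_ge0 ?n2_ge0.
have nd1 : n2 (fun t => u t - b * y t) <= K1 * S.
  have bn : nc (- b) ^+ 2 <= B2 by rewrite ncN.
  have := n2_add_le Lu (L2Z (- b) Ly).1 nu' (Z (- b) y Ky Ly bn ny').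
  rewrite -mulrDl mulrA -/K1.
  by rewrite (@eq_n2 _ _ (fun t => u t - b * y t))// => t _; rewrite mulNr.
have Ld1 := Hy.1.
have nf' : n2 (fun t => - f t) <= 1 * S.
  by rewrite mul1r (le_trans (L2N Lf).2)// /S lerDr addr_ge0.
have nd2 : n2 (fun t => (b^* * u t - f t) - b * (u t - b * y t)) <= K2 * S.
  have b2 : nc (b^*) ^+ 2 <= B2 by rewrite nc_conj.
  have h1 := n2_add_le (L2Z (b^*) Lu).1 (L2N Lf).1 (Z _ u Ku Lu b2 nu') nf'.
  have b3 : nc (- b) ^+ 2 <= B2 by rewrite ncN.
  have := n2_add_le (L2D (L2Z (b^*) Lu).1 (L2N Lf).1).1 (L2Z (- b) Ld1).1 h1
    (Z _ _ K1 Ld1 b3 nd1).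
  rewrite -mulrDl mulrA -mulrDl mulrA -/K2.
  rewrite (@eq_n2 _ _ (fun t => (b^* * u t - f t) - b * (u t - b * y t)))// => t _.
  by rewrite mulNr.
have le k : 0 <= k -> k <= K -> forall r, r <= k * S -> r <= K * S.
  by move=> k0 kK r /le_trans; apply; rewrite ler_wpM2r.
split.
- exact: (le Ky).
- exact: (le K1).
- exact: (le K2).
- exact: (le Ky).
Qed.

End Edge.

(** * Weighted sums over the tree *)

Section Tree.
Context {R : realType} (T : nat) (hT : (2 <= T)%N)
  (k nu : nat -> nat) (htree : is_tree T k nu).
Local Notation C := R[i].
Local Notation nc := (@Normc.normc R).

Lemma N1_gt0 j : N1 T j -> (0 < j)%N.
Proof. by rewrite /N1; case: ifP => _; case: j. Qed.

Lemma parent_N1 j : (2 <= j)%N -> N1 T (k j).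
Proof.
move=> j2; have j0 : (0 < j)%N by exact: ltnW.
have : [set m | N1 T m \/ m = 0%N] (k j).
  by rewrite -(tree_onto htree); exists j.
case=> // kj; have : out_edges k 0%N j by [].
by rewrite (tree_root htree) => j1; move: j2; rewrite j1.
Qed.

Lemma parent_N2 j n : N2 T j -> (0 < n)%N -> k n != j.
Proof.
move=> /andP[j0 jN1] n0; apply/eqP => kn.
have : [set m | N1 T m \/ m = 0%N] j by rewrite -(tree_onto htree) -kn; exists n.
by case=> [|j00]; [exact/negP|move: j0; rewrite j00].
Qed.

Lemma child_ge2 j n : N1 T j -> (0 < n)%N -> k n = j -> (2 <= n)%N.
Proof.
move=> /N1_gt0 j0 n0 kn; case: n n0 kn => [//|[|//]] _.
by rewrite (tree_k1 htree) => kn; move: j0; rewrite -kn.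
Qed.

Lemma N1_or_N2 j : (0 < j)%N -> N1 T j \/ N2 T j.
Proof. by rewrite /N2 => ->; case: (N1 T j); [left|right]. Qed.

Lemma nu1 : nu 1 = 0%N.
Proof.
have := tree_depth htree (isT : (0 < 1)%N); case: (nu 1) => // m.
rewrite iterSr (tree_k1 htree) => h.
suff z i : iter i k 0%N = 0%N by rewrite z in h.
by elim: i => //= i ->; exact: tree_k0 htree.
Qed.

Let iter0 i : iter i k 0%N = 0%N.
Proof. by elim: i => //= i ->; exact: tree_k0 htree. Qed.

(** After reaching 1 the iteration moves to 0 and stays there, so it visits 1 at most once. *)
Lemma iter_uniq a b j : iter a k j = 1%N -> iter b k j = 1%N -> a = b.
Proof.
wlog ab : a b / (a <= b)%N.
  by move=> H ha hb; case/orP: (leq_total a b) => ab; [|symmetry]; apply: H.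
move=> ha; rewrite -(subnK ab) iterD ha; case E : (b - a)%N => [|m] //.
by rewrite iterSr (tree_k1 htree) iter0.
Qed.

Lemma nuS j : (2 <= j)%N -> nu j = (nu (k j)).+1.
Proof.
move=> j2; have kj := N1_gt0 (parent_N1 j2).
have hk := tree_depth htree kj; have hj := tree_depth htree (ltnW j2).
by apply: (iter_uniq hj); rewrite iterSr.
Qed.

Lemma nu_lt j : (0 < j)%N -> (nu j < T)%N.
Proof.
case/N1_or_N2 => [/(tree_internal htree)|/(tree_leaf htree)]; rewrite addn1.
  by move=> /leq_trans; apply; exact: leq_subr.
by move=> <-.
Qed.

Lemma nu_eq0 j : (0 < j)%N -> nu j = 0%N -> j = 1%N.
Proof. by move=> j0 nj; have := tree_depth htree j0; rewrite nj. Qed.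

Context (p : nat -> R) (hp0 : forall l : nat, 0 < p l)
    (hp1 : (series p : nat -> R) @ \oo --> (1 : R))
    (e : nat -> nat -> nat)
    (he_inj : forall j : nat, N1 T j -> injective (e j))
    (he_range : forall j : nat, N1 T j -> range (e j) = out_edges k j)
    (pt : nat -> R)
    (hpt : forall j l : nat, N1 T j -> pt (e j l) = p l).

Lemma edge_index n : (2 <= n)%N -> exists l, n = e (k n) l.
Proof.
move=> n2; have N := parent_N1 n2.
have : out_edges k (k n) n by split=> //; exact: ltnW.
by rewrite -he_range// => -[l _ E]; exists l; rewrite E.
Qed.

Lemma pt_gt0 n : (2 <= n)%N -> 0 < pt n.
Proof.
move=> n2; have [l E] := edge_index n2.
by rewrite E hpt//; exact: parent_N1.
Qed.

Local Notation al := (alpha k nu pt).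

Lemma al1 : al 1 = 1. Proof. by rewrite /alpha nu1 big_ord0. Qed.

Lemma alS n : (2 <= n)%N -> al n = pt n * al (k n).
Proof.
move=> n2; rewrite /alpha nuS// big_ord_recl; congr (_ * _).
by apply: eq_bigr => i _; rewrite lift0 iterSr.
Qed.

Lemma al_gt0 j : (0 < j)%N -> 0 < al j.
Proof.
have [m] := ubnP (nu j); elim: m j => // m IH j nj j0.
case: (ltnP 1 j) => [j2|]; last by case: j j0 {nj} => [|[|]]// _ _; rewrite al1.
rewrite alS// mulr_gt0 ?pt_gt0//; apply: IH.
  by rewrite nuS in nj.
exact: N1_gt0 (parent_N1 j2).
Qed.

(** For an internal vertex these weights form a probability distribution on the edge indices,
    carried by the edges leaving v_j. *)
Definition child_wt (j n : nat) : R := if (0 < n)%N && (k n == j) then pt n else 0.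

Lemma ptV_ge0 j n : N1 T j -> 0 <= child_wt j n.
Proof.
move=> jN; rewrite /child_wt; case: ifP => // /andP[n0 /eqP kn].
by rewrite ltW// pt_gt0//; exact: child_ge2 kn.
Qed.

Lemma nns_p : nns p = 1%E.
Proof.
have -> : 1%E = (limn (series p))%:E by rewrite (cvg_lim _ hp1).
rewrite -EFin_lim; last by apply/cvg_ex; exists 1.
by apply/congr_lim/funext => n /=; rewrite sumEFin.
Qed.

(** The terms are nonnegative, so the sum over the edges leaving v_j may be taken in the order of
    the enumeration [e j], where it is the sum of the p_l. *)
Lemma nns_ptV j : N1 T j -> nns (child_wt j) = 1%E.
Proof.
move=> jN; rewrite -nns_p /nns.
rewrite nneseries_esumT; last by move=> n; rewrite lee_fin ptV_ge0.
transitivity (\esum_(n in out_edges k j) (pt n)%:E).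
  rewrite [RHS]esum_mkcond; apply: eq_esum => n _.
  rewrite /child_wt; case: ifP => [/andP[n0 /eqP kn]|/negP nk].
    by rewrite mem_set.
  rewrite memNset// => -[n0 kn]; apply: nk.
  by rewrite n0 kn eqxx.
rewrite -he_range// esum_image; last by move=> a b _ _; exact: he_inj.
rewrite -nneseries_esumT; first by apply: eq_eseriesr => l _; rewrite hpt.
by move=> l; rewrite lee_fin hpt// ltW.
Qed.

Definition alpha_wt (z : nat -> R) (j : nat) : R := if (0 < j)%N then al j * z j else 0.

Lemma wt_ge0 z j : (forall j, (0 < j)%N -> 0 <= z j) -> 0 <= alpha_wt z j.
Proof.
move=> z0; rewrite /alpha_wt; case: ifP => // j0.
by rewrite mulr_ge0 ?z0// ltW// al_gt0.
Qed.

Lemma wt_le y z j : (forall j, (0 < j)%N -> y j <= z j) -> alpha_wt y j <= alpha_wt z j.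
Proof. by move=> yz; rewrite /alpha_wt; case: ifP => // j0; rewrite ler_wpM2l ?yz// ltW// al_gt0. Qed.

(** Conservation of mass: alpha_n = pt_n alpha_j on the edges leaving v_j, and the pt_n add up to 1,
    so handing x_j down to all children preserves its total weight. *)
Lemma nns_parent (x : nat -> R) : (forall j, (0 < j)%N -> 0 <= x j) ->
  nns (fun n => if (2 <= n)%N then al n * x (k n) else 0) =
  nns (fun j => if N1 T j then al j * x j else 0).
Proof.
move=> x0; rewrite (nns_fib k); last first.
  move=> n; case: ifP => // n2; have N := N1_gt0 (parent_N1 n2).
  by rewrite mulr_ge0 ?x0// ltW// al_gt0// ltnW.
apply: eq_eseriesr => j _; case: ifPn => [jN|jN].
  transitivity (nns (fun n => al j * x j * child_wt j n)).
    apply: eq_nns => n; rewrite /fib /child_wt; case: eqP => kn; last by rewrite andbF mulr0.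
    rewrite andbT; case: n kn => [|[|n]] kn /=; rewrite ?mulr0//.
      by move: (N1_gt0 jN); rewrite -kn (tree_k1 htree).
    by rewrite alS// kn; ring.
  rewrite nnsZ ?nns_ptV ?mule1// => n; exact: ptV_ge0.
rewrite /nns eseries0// => n _ _; rewrite /fib; case: eqP => // kn.
by case: ifP => // n2; move: (parent_N1 n2); rewrite kn (negbTE jN).
Qed.

Lemma nns_parent_le (x : nat -> R) : (forall j, (0 < j)%N -> 0 <= x j) ->
  (nns (fun n => if (2 <= n)%N then al n * x (k n) else 0)%R <= nns (alpha_wt x))%E.
Proof.
move=> x0; rewrite nns_parent//; apply: le_nns => j.
  by case: ifP => // /N1_gt0 j0; rewrite mulr_ge0 ?x0// ltW// al_gt0.
rewrite /alpha_wt; case: ifP => [/N1_gt0 ->//|_]; case: ifP => // j0.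
by rewrite mulr_ge0 ?x0// ltW// al_gt0.
Qed.

(** Induction on the tier up to which [z] is kept: each tier is bounded by the previous one through
    [nns_parent_le], and the depth is finite. The estimate is stated in the extended reals, so no
    summability of [z] is presupposed. *)
Lemma tree_forward (c : R) : 0 <= c -> exists2 K : R, 0 <= K &
  forall z g : nat -> R, (forall j, (0 < j)%N -> 0 <= z j) ->
    (forall j, (0 < j)%N -> 0 <= g j) -> z 1%N = 0 ->
    (forall n, (2 <= n)%N -> z n <= c * (z (k n) + g (k n))) ->
    (nns (alpha_wt z) <= K%:E * nns (alpha_wt g))%E.
Proof.
move=> c0.
have H m : exists2 K : R, 0 <= K &
  forall z g : nat -> R, (forall j, (0 < j)%N -> 0 <= z j) ->
    (forall j, (0 < j)%N -> 0 <= g j) -> z 1%N = 0 ->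
    (forall n, (2 <= n)%N -> z n <= c * (z (k n) + g (k n))) ->
    (nns (alpha_wt (fun j => if (nu j <= m)%N then z j else 0%R)) <= K%:E * nns (alpha_wt g))%E.
  elim: m => [|m [K K0 IH]].
    exists 0 => // z g z0 g0 z1 _; rewrite mul0e.
    rewrite /nns eseries0// => j _ _; rewrite /alpha_wt; case: ifP => // j0.
    case: ifP; rewrite ?mulr0// leqn0 => /eqP nj.
    by rewrite (nu_eq0 j0 nj) z1 mulr0.
  (* The tiers already treated contribute K, the source [g] contributes 1, and one step from parents
     to children costs c. *)
  exists (c * (K + 1)); first by rewrite mulr_ge0// addr_ge0.
  move=> z g z0 g0 z1 zc; pose x j := (if (nu j <= m)%N then z j else 0) + g j.
  have x0 j : (0 < j)%N -> 0 <= x j.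
    by move=> j0; rewrite addr_ge0 ?g0//; case: ifP; rewrite ?z0.
  have cx0 j : (0 < j)%N -> 0 <= c * x j by move=> j0; rewrite mulr_ge0 ?x0.
  apply: (@le_trans _ _ (nns (alpha_wt (fun j => c * x j)))).
    apply: le_trans (nns_parent_le cx0); apply: le_nns => j.
      by apply: wt_ge0 => i i0; case: ifP; rewrite ?z0.
    rewrite /alpha_wt; case: j => [//|[|j]] /=; first by rewrite z1 if_same mulr0.
    rewrite nuS//= ltnS /x; case: ifP => h.
      by rewrite ler_wpM2l ?zc// ltW// al_gt0.
    rewrite mulr0; apply: mulr_ge0; first by rewrite ltW// al_gt0.
    by apply: mulr_ge0 => //; rewrite add0r g0//; exact: N1_gt0 (parent_N1 _).
  have -> : nns (alpha_wt (fun j => c * x j)) = (c%:E *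
     (nns (alpha_wt (fun j => if (nu j <= m)%N then z j else 0%R)) + nns (alpha_wt g)))%E.
    have w1 j : 0 <= alpha_wt (fun j => if (nu j <= m)%N then z j else 0) j.
      by apply: wt_ge0 => i i0; case: ifP; rewrite ?z0.
    have w2 j : 0 <= alpha_wt g j by exact: wt_ge0.
    rewrite -nnsD// -nnsZ; last by move=> j; rewrite addr_ge0.
    by apply: eq_nns => j; rewrite /alpha_wt /x; case: ifP => _; ring.
  rewrite EFinM -muleA; apply: lee_wpmul2l; first by rewrite lee_fin.
  rewrite EFinD ge0_muleDl ?lee_fin// mul1e; apply: leeD2r.
  exact: IH.
have [K K0 HK] := H T; exists K => // z g z0 g0 z1 zc.
apply: le_trans (HK z g z0 g0 z1 zc); apply: le_nns => j; first exact: wt_ge0.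
by apply: wt_le => i i0; rewrite (ltnW (nu_lt i0)).
Qed.

(** Induction from the last tier upwards. The estimate at an internal vertex is available only once
    the mean over its children is known to converge, so summability over the tiers below has to be
    established before the estimate is used. *)
Lemma tree_backward (c : R) (x g : nat -> R) : 0 <= c ->
  (forall j, (0 < j)%N -> 0 <= x j) -> (forall j, (0 < j)%N -> 0 <= g j) ->
  (forall j, N2 T j -> x j <= c * g j) ->
  (forall j, N1 T j -> sm (fun n => child_wt j n * x n) ->
     x j <= c * (g j + limn (series (fun n => child_wt j n * x n)))) ->
  sm (alpha_wt g) -> sm (alpha_wt x).
Proof.
move=> c0 x0 g0 leaf int sg.
(* The condition selects the m + 1 last tiers; for m = 0 these are the leaf edges. *)
have H m : sm (alpha_wt (fun j => if (T <= nu j + m.+1)%N then x j else 0)).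
  elim: m => [|m IH].
    apply: sm_le (smZ c0 _ sg) => j.
    - by apply: wt_ge0 => i i0; case: ifP; rewrite ?x0.
    - rewrite /alpha_wt; case: ifP => j0; last by rewrite mulr0.
      have a0 := al_gt0 j0; rewrite mulrCA; apply: ler_wpM2l; first exact: ltW.
      have cg0 : 0 <= c * g j by apply: mulr_ge0 => //; exact: g0.
      case: ifP => h //.
      apply: leaf; rewrite /N2 j0/=; apply/negP => /(tree_internal htree).
      by rewrite leqNgt; case: (T) h hT => // t; rewrite subn1/= ltnS => ->.
    - exact: wt_ge0.
  pose w := alpha_wt (fun j => if (T <= nu j + m.+1)%N then x j else 0).
  have w0 j : 0 <= w j by apply: wt_ge0 => i i0; case: ifP; rewrite ?x0.
  have [sl _] := series_fib_nneg k w0 IH.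
  have l0 j : 0 <= limn (series (fib k w j)).
    rewrite -lee_fin -nns_lim; [|by move=> i; exact: fib_ge0|exact: sm_fib].
    by apply: nns_ge0 => i; exact: fib_ge0.
  have wg j : 0 <= alpha_wt g j by exact: wt_ge0.
  have wl0 j : 0 <= alpha_wt g j + limn (series (fib k w j)) by exact: addr_ge0.
  apply: sm_le (smZ c0 wl0 (smD wg l0 sg sl)) => j.
  - by apply: wt_ge0 => i i0; case: ifP; rewrite ?x0.
  - rewrite /alpha_wt; case: ifP => j0; last by rewrite add0r; exact: mulr_ge0.
    have a0 := al_gt0 j0.
    have ag0 : 0 <= al j * g j by apply: mulr_ge0; [exact: ltW|exact: g0].
    case: ifP => h; last by rewrite mulr0; apply: mulr_ge0 => //; exact: addr_ge0.
    case: (N1_or_N2 j0) => jN; last first.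
      apply: (@le_trans _ _ (al j * (c * g j))); first by rewrite ler_wpM2l ?leaf// ltW.
      by rewrite mulrCA mulrDr lerDl; exact: mulr_ge0.
    (* The truncation is inactive on these children: they lie one tier below [j], within the range
       of the induction hypothesis. *)
    have E n : fib k w j n = al j * (child_wt j n * x n).
      rewrite /fib /w /alpha_wt /child_wt; case: eqP => kn; last by rewrite andbF mul0r mulr0.
      rewrite andbT; case: ifP => n0; last by rewrite mul0r mulr0.
      have n2 := child_ge2 jN n0 kn.
      rewrite nuS// kn addSnnS h alS// kn; ring.
    have E' n : child_wt j n * x n = (al j)^-1 * fib k w j n.
      by rewrite E mulKf// gt_eqF.
    have s : sm (fun n => child_wt j n * x n).
      rewrite /sm (@eq_nns _ _ (fun n => (al j)^-1 * fib k w j n))//.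
      apply: smZ; first by rewrite invr_ge0 ltW.
        by move=> i; exact: fib_ge0.
      exact: sm_fib.
    apply: le_trans (_ : al j * (c * (g j + limn (series (fun n => child_wt j n * x n)))) <= _).
      by rewrite ler_wpM2l ?int// ltW.
    rewrite mulrCA mulrDr ler_wpM2l// lerD2l.
    have -> : limn (series (fun n => child_wt j n * x n)) = (al j)^-1 * limn (series (fib k w j)).
      rewrite -[RHS]/(_ *: _) -lim_seriesZ; last first.
        by apply: sm_cvg; [move=> i; exact: fib_ge0|exact: sm_fib].
      by congr (limn (series _)); apply/funext => n; rewrite E'.
    by rewrite mulVKf// gt_eqF.
apply: sm_le (H T) => j; first exact: wt_ge0.
by apply: wt_le => i i0; rewrite addnS ltnW// ltnS leq_addl.
Qed.

End Tree.

(** * The operator on the tree *)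

(* Inside a product, [x^*] is parsed as [Num.conj x] instead of [conjc x]. *)
Lemma conjE {R : realType} (x : R[i]) : Num.conj x = conjc x.
Proof. by []. Qed.

Lemma conjcM {R : realType} (x y : R[i]) : conjc (x * y) = conjc x * conjc y.
Proof. exact: rmorphM. Qed.

Section Operator.
Context {R : realType} (T : nat) (hT : (2 <= T)%N)
  (k nu : nat -> nat) (htree : is_tree T k nu)
  (p : nat -> R) (hp0 : forall l : nat, 0 < p l)
  (hp1 : (series p : nat -> R) @ \oo --> (1 : R))
  (e : nat -> nat -> nat)
  (he_inj : forall j : nat, N1 T j -> injective (e j))
  (he_range : forall j : nat, N1 T j -> range (e j) = out_edges k j)
  (pt : nat -> R)
  (hpt : forall j l : nat, N1 T j -> pt (e j l) = p l)
  (b : nat -> R[i]) (B : R) (B0 : 0 <= B)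
  (bB : forall j, (0 < j)%N -> Normc.normc (b j) <= B).
Local Notation C := R[i].
Local Notation Re := (@complex.Re R).
Local Notation Im := (@complex.Im R).
Local Notation nc := (@Normc.normc R).
Local Notation mu := (@lebesgue_measure R).
Local Notation I01 := (`[(0 : R), 1]%classic : set R).
Local Notation al := (alpha k nu pt).
Local Notation wt := (alpha_wt k nu pt).
Local Notation ptV := (child_wt k pt).
Local Notation tuples := (nat -> R -> C).
Implicit Types (y z f g : tuples) (d : nat -> nat -> R -> C).

Let al_gt0' j : (0 < j)%N -> 0 < al j.
Proof. exact: (al_gt0 htree hp0 he_range hpt). Qed.

Let wt_ge0' (x : nat -> R) j : (forall j, (0 < j)%N -> 0 <= x j) -> 0 <= wt x j.
Proof. exact: (wt_ge0 htree hp0 he_range hpt). Qed.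

Let wt_le' (x y : nat -> R) j : (forall j, (0 < j)%N -> x j <= y j) -> wt x j <= wt y j.
Proof. exact: (wt_le htree hp0 he_range hpt). Qed.

(** * The weighted space and its inner product *)

Lemma wtZD (c : R) (x y : nat -> R) j : wt (fun j => c * (x j + y j)) j = c * (wt x j + wt y j).
Proof. by rewrite /alpha_wt; case: ifP => _; ring. Qed.

Lemma sm_wt_le (c : R) (w x y : nat -> R) : 0 <= c ->
  (forall j, (0 < j)%N -> 0 <= w j) ->
  (forall j, (0 < j)%N -> 0 <= x j) -> (forall j, (0 < j)%N -> 0 <= y j) ->
  (forall j, (0 < j)%N -> w j <= c * (x j + y j)) -> sm (wt x) -> sm (wt y) ->
  sm (wt w).
Proof.
move=> c0 w0 x0 y0 wc sx sy.
have wx j : 0 <= wt x j by exact: wt_ge0'.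
have wy j : 0 <= wt y j by exact: wt_ge0'.
have wxy j : 0 <= wt x j + wt y j by exact: addr_ge0.
apply: sm_le (smZ c0 wxy (smD wx wy sx sy)) => j; first exact: wt_ge0'.
by rewrite -wtZD; exact: wt_le'.
Qed.

Lemma esum_wt (F : nat -> \bar R) (x : nat -> R) :
  (forall j, (0 < j)%N -> F j = (x j)%:E) ->
  (\sum_(1 <= j <oo) (al j)%:E * F j = nns (wt x))%E.
Proof.
move=> Fx; rewrite ereal_series eseries_mkcond; apply: eq_eseriesr => j _.
by rewrite /alpha_wt; case: ifP => // /Fx ->.
Qed.

Lemma L2aP y : L2a al y <->
  (forall j, (0 < j)%N -> L2 (y j)) /\ sm (wt (fun j => n2 (y j))).
Proof.
split=> -[Ly s]; split=> //; first by move: s; rewrite (esum_wt (fun j j0 => n2E (Ly j j0))).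
by rewrite (esum_wt (fun j j0 => n2E (Ly j j0))).
Qed.

Definition ipt y z (j : nat) : C := if j == 0%N then 0
  else (al j)%:C * cintegral I01 (fun t => y j t * (z j t)^*).

Lemma ipaE y z : ipa al y z = csum (ipt y z). Proof. by []. Qed.

Lemma nc_al j : (0 < j)%N -> nc ((al j)%:C) = al j.
Proof. by move=> j0; rewrite nc_real ger0_norm// ltW// al_gt0'. Qed.

Lemma cs_wt (x : nat -> R) (w : nat -> C) :
  (forall j, (0 < j)%N -> nc (w j) <= x j) -> sm (wt x) ->
  cs (fun j => if j == 0%N then 0 else (al j)%:C * w j).
Proof.
move=> wx; apply: cs_le => j; rewrite /alpha_wt.
case: (posnP j) => [_|j0]; first by rewrite nc0.
by rewrite ncM nc_al// ler_wpM2l ?wx// ltW// al_gt0'.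
Qed.

Lemma cs_ipt y z : L2a al y -> L2a al z -> cs (ipt y z).
Proof.
move=> /L2aP[Ly sy] /L2aP[Lz sz].
apply: (@cs_wt (fun j => 2 * (n2 (y j) + n2 (z j)))) => [j j0|].
  by apply: nc_cintegral_mul_le; [exact: Ly|exact: Lz].
by apply: (@sm_wt_le 2 _ _ _ _ _ _ _ _ sy sz) => // j _; rewrite ?n2_ge0//;
  apply: mulr_ge0 => //; apply: addr_ge0; exact: n2_ge0.
Qed.

Lemma eq_ipa y y' z z' : (forall j, (0 < j)%N ->
    cintegral I01 (fun t => y j t * (z j t)^*) = cintegral I01 (fun t => y' j t * (z' j t)^*)) ->
  ipa al y z = ipa al y' z'.
Proof.
move=> H; apply: eq_csum => j; case: eqP => // /eqP.
by rewrite -lt0n => /H ->.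
Qed.

Lemma ae_eq_ipa y y' z z' : (forall j, (0 < j)%N -> cmeasurable (y j) /\ cmeasurable (y' j)) ->
  (forall j, (0 < j)%N -> cmeasurable (z j) /\ cmeasurable (z' j)) ->
  (forall j, (0 < j)%N -> ae_eq01 (y j) (y' j)) ->
  (forall j, (0 < j)%N -> ae_eq01 (z j) (z' j)) ->
  ipa al y z = ipa al y' z'.
Proof.
move=> my mz yy zz; apply: eq_ipa => j j0.
have [my1 my2] := my j j0; have [mz1 mz2] := mz j j0.
apply: ae_eq_cintegral; try by apply: cmeasurableM => //; exact: cmeasurable_conj.
by apply: ae_eq01_M (yy _ j0) _; apply: ae_eq01_conj; exact: zz.
Qed.

Lemma ipa_conj y z : L2a al y -> L2a al z -> ipa al z y = (ipa al y z)^*.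
Proof.
move=> Ly Lz; rewrite -csum_conj; last exact: cs_ipt.
apply: eq_csum => j; rewrite /ipt; case: eqP => [_|/eqP]; first by rewrite conjc0.
rewrite -lt0n => j0; rewrite conjcM conjc_real; congr (_ * _).
have /L2aP[/(_ _ j0) Lyj _] := Ly; have /L2aP[/(_ _ j0) Lzj _] := Lz.
rewrite -cintegral_conj//; last exact: L2_mul_integrable Lyj (L2_conj Lzj).
by apply: eq_cintegral => t _; rewrite !conjE conjcM conjcK mulrC.
Qed.

Lemma L2a_lin (a : C) y z : L2a al y -> L2a al z -> L2a al (a *: y + z).
Proof.
move=> /L2aP[Ly sy] /L2aP[Lz sz]; apply/L2aP.
have H j : (0 < j)%N -> L2 ((a *: y + z) j) /\
    n2 ((a *: y + z) j) <= (2 * nc a ^+ 2 + 2) * (n2 (y j) + n2 (z j)).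
  move=> j0; have [L1 n1] := L2Z a (Ly _ j0); have [L2 n2'] := L2D L1 (Lz _ j0).
  split=> //; apply: le_trans n2' _.
  have := n2_ge0 (y j); have := n2_ge0 (z j); have := sqr_ge0 (nc a).
  move: n1; set N := n2 _; set Y := n2 (y j); set Z := n2 (z j); set A := nc a ^+ 2.
  by move=> n1 A0 Z0 Y0; have := mulr_ge0 A0 Z0; nra.
split; first by move=> j /H[].
apply: (@sm_wt_le (2 * nc a ^+ 2 + 2) _ _ _ _ _ _ _ _ sy sz) =>
  [|j _|j _|j _|j /H[_]//]; rewrite ?n2_ge0//.
by apply: addr_ge0 => //; apply: mulr_ge0 => //; exact: sqr_ge0.
Qed.

Lemma L2a_0 : L2a al 0.
Proof.
apply/L2aP; split=> [j _|]; first exact: (L2_cst 0).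
rewrite /sm /nns eseries0 ?ltry// => j _ _; rewrite /alpha_wt; case: ifP => // _.
suff -> : n2 (0 : R -> C) = 0 by rewrite mulr0.
rewrite /n2 /sqnorm integral0_eq// => t _.
by rewrite nc0 expr0n.
Qed.

Lemma L2a_B y z : L2a al y -> L2a al z -> L2a al (y - z).
Proof.
by move=> Ly Lz; have := L2a_lin (-1) Lz Ly; rewrite scaleN1r addrC.
Qed.

Lemma ipa_linl (a : C) y y' z : L2a al y -> L2a al y' -> L2a al z ->
  ipa al (a *: y + y') z = a * ipa al y z + ipa al y' z.
Proof.
move=> Ly Ly' Lz; rewrite !ipaE -csumZ; last exact: cs_ipt.
rewrite -csumD; [|apply: csZ; exact: cs_ipt|exact: cs_ipt].
apply: eq_csum => j; rewrite /ipt; case: eqP => [_|/eqP]; first by rewrite mulr0 addr0.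
rewrite -lt0n => j0.
have /L2aP[/(_ _ j0) Lyj _] := Ly; have /L2aP[/(_ _ j0) Lyj' _] := Ly'.
have /L2aP[/(_ _ j0) /L2_conj Lzj _] := Lz.
have i1 := L2_mul_integrable Lyj Lzj; have i2 := L2_mul_integrable Lyj' Lzj.
rewrite mulrCA -mulrDr; congr (_ * _).
rewrite -cintegralZ// -cintegralD//; last exact: (cintegrableZ a m01 i1).
apply: eq_cintegral => t _.
by rewrite -[(a *: y + y') j t]/(a * y j t + y' j t); ring.
Qed.

Lemma ipa_Br y z z' : L2a al y -> L2a al z -> L2a al z' ->
  ipa al y (z - z') = ipa al y z - ipa al y z'.
Proof.
move=> Ly Lz Lz'; have LB := L2a_lin (-1) Lz' Lz.
have -> : z - z' = (-1) *: z' + z by rewrite scaleN1r addrC.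
rewrite (ipa_conj LB Ly) ipa_linl// (ipa_conj Ly Lz) (ipa_conj Ly Lz').
move: (ipa al y z) (ipa al y z') => [u1 u2] [v1 v2].
by apply: eqc; rewrite !cE /=; ring.
Qed.

Lemma ipa_sqr y : L2a al y ->
  ipa al y y = (limn (series (wt (fun j => n2 (y j)))))%:C.
Proof.
move=> /L2aP[Ly sy]; rewrite -csum_real; apply: eq_csum => j.
rewrite /alpha_wt; case: (posnP j) => [//|j0].
by rewrite cintegral_mulJ ?rmorphM//; exact: Ly.
Qed.

Lemma lim_wt_ge0 y : L2a al y -> 0 <= limn (series (wt (fun j => n2 (y j)))).
Proof.
move=> /L2aP[Ly sy]; have w0 j : 0 <= wt (fun j => n2 (y j)) j.
  by apply: wt_ge0' => *; exact: n2_ge0.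
by rewrite -lee_fin -nns_lim// nns_ge0.
Qed.

Lemma nullP y : L2a al y -> null (ipa al) y <-> (forall j, (0 < j)%N -> n2 (y j) = 0).
Proof.
move=> Ly; have /L2aP[L sy] := Ly; rewrite /null ipa_sqr//.
have w0 j : 0 <= wt (fun j => n2 (y j)) j by apply: wt_ge0' => *; exact: n2_ge0.
split=> [[h] j j0|H].
  have := le_nns_term j w0; rewrite nns_lim// h lee_fin /alpha_wt j0 => h1.
  apply/eqP; rewrite eq_le n2_ge0 andbT.
  by rewrite -(pmulr_rle0 _ (al_gt0' j0)).
have -> : limn (series (wt (fun j => n2 (y j)))) = 0; last by [].
apply: EFin_inj; rewrite -nns_lim// /nns eseries0// => j _ _.
by rewrite /alpha_wt; case: ifP => // j0; rewrite H// mulr0.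
Qed.

(** * The domain of the operator, described by the derivatives of the components *)

Record dom d : Prop := Dom {
  dom_ac0 : forall j, (0 < j)%N -> ac (d j 0%N) (d j 1%N);
  dom_ac1 : forall j, (0 < j)%N -> ac (d j 1%N) (d j 2%N);
  dom_sm : forall m, (m <= 2)%N -> sm (wt (fun j => n2 (d j m)));
  dom_bc : boundary_conditions T k pt b d
}.

Lemma dom_L2 d j m : dom d -> (0 < j)%N -> (m <= 2)%N -> L2 (d j m).
Proof.
move=> D j0; case: m => [|[|[|//]]] _.
- by have [] := ac_L2 (dom_ac0 D j0).
- by have [] := dom_ac0 D j0.
- by have [] := dom_ac1 D j0.
Qed.

(** Separates the two roles in the definition of the domain: [d] carries all regularity and vertex
    conditions, while [y] is tied to it only by almost everywhere equality. *)
Lemma W2aP y d : W2a al 2 y d /\ boundary_conditions T k pt b d <->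
  dom d /\ forall j, (0 < j)%N -> cmeasurable (y j) /\ ae_eq01 (y j) (d j 0%N).
Proof.
have sumE (F : nat -> \bar R) : (\sum_(m < 3) F m = F 0%N + F 1%N + F 2%N)%E.
  by rewrite !big_ord_recr /= big_ord0 add0e.
have tot d' : (forall j, (0 < j)%N -> forall m, (m <= 2)%N -> L2 (d' j m)) ->
  (\sum_(1 <= j <oo) (al j)%:E * (\sum_(m < 3) sqnorm (d' j m))%E =
   nns (wt (fun j => n2 (d' j 0%N) + n2 (d' j 1%N) + n2 (d' j 2%N))%R))%E.
  move=> L; apply: esum_wt => j j0.
  by rewrite (sumE (fun m => sqnorm (d' j m))) !n2E ?EFinD//; apply: L.
split.
  move=> [[W s] bc]; split; last by move=> j /W[].
  have L j (j0 : (0 < j)%N) m (m2 : (m <= 2)%N) : L2 (d j m).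
    by have [_ H _] := W j j0; exact: H.
  split=> //.
  - by move=> j j0; have [_ _ H] := W j j0; split; [exact: L|exact: H].
  - by move=> j j0; have [_ _ H] := W j j0; split; [exact: L|exact: H].
  move=> m m2; rewrite tot in s; last exact: L.
  apply: sm_le s => j; first by apply: wt_ge0' => *; exact: n2_ge0.
  apply: wt_le' => i i0; have := n2_ge0 (d i 0%N); have := n2_ge0 (d i 1%N).
  by have := n2_ge0 (d i 2%N); case: m m2 => [|[|[|//]]] _; lra.
move=> [D my]; split; last exact: dom_bc.
have L j (j0 : (0 < j)%N) m (m2 : (m <= 2)%N) : L2 (d j m) by exact: dom_L2.
split.
  move=> j j0; split; [exact: my|by move=> m; exact: L|].
  move=> [|[|//]] _; first by have [] := dom_ac0 D j0.
  by have [] := dom_ac1 D j0.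
rewrite tot//.
have s0 := dom_sm D (isT : (0 <= 2)%N); have s1 := dom_sm D (isT : (1 <= 2)%N).
have s2 := dom_sm D (isT : (2 <= 2)%N).
have s01 : sm (wt (fun j => n2 (d j 0%N) + n2 (d j 1%N))).
  by apply: (@sm_wt_le 1 _ _ _ _ _ _ _ _ s0 s1) => // j _; rewrite ?mul1r ?addr_ge0 ?n2_ge0.
by apply: (@sm_wt_le 1 _ _ _ _ _ _ _ _ s01 s2) => // j _;
  rewrite ?mul1r ?addr_ge0 ?n2_ge0.
Qed.

Lemma LopP y f : Lop T k nu pt b y f <-> exists d,
  [/\ dom d, forall j, (0 < j)%N -> cmeasurable (y j) /\ ae_eq01 (y j) (d j 0%N)
   & forall j, (0 < j)%N -> cmeasurable (f j) /\ ae_eq01 (f j) (Lexpr b d j)].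
Proof.
split=> -[d [H1 H2 H3]]; exists d.
  by have [D my] := (W2aP y d).1 (conj H1 H2).
by have [] := (W2aP y d).2 (conj H1 H2).
Qed.

(** The coefficients satisfy |2 i Im b_j|^2 <= 4 B^2 and |b_j|^4 <= B^4; the leading 4 comes from
    splitting a sum of three terms by two applications of [L2D]. *)
Lemma n2_Lexpr d : dom d -> forall j, (0 < j)%N -> L2 (Lexpr b d j) /\
  n2 (Lexpr b d j) <= 4 * (1 + 4 * B ^+ 2 + (B ^+ 2) ^+ 2) *
    (n2 (d j 0%N) + n2 (d j 1%N) + n2 (d j 2%N)).
Proof.
move=> D j j0; have L m m2 := @dom_L2 d j m D j0 m2.
pose c1 : C := - (2%:R * 'i * (Im (b j))%:C); pose c0 : C := `|b j| ^+ 2.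
have B2 : nc (b j) ^+ 2 <= B ^+ 2 by rewrite ler_pXn2r ?nnegrE ?nc_ge0 ?bB.
have Im2 : Im (b j) ^+ 2 <= B ^+ 2.
  by apply: le_trans B2; rewrite nc_sqr lerDr sqr_ge0.
have n1 : nc c1 ^+ 2 <= 4 * B ^+ 2.
  rewrite /c1 ncN !nc_sqrM nc_real real_normK ?num_real// -complexiE.
  have -> : nc 'i%C ^+ 2 = 1 by rewrite nc_sqr /= expr0n expr1n add0r.
  have -> : nc 2%:R ^+ 2 = 4 by rewrite nc_sqr; rewrite -[2%:R]/(1 + 1) !cE /=; ring.
  by rewrite mulr1 ler_wpM2l.
have n0 : nc c0 ^+ 2 <= (B ^+ 2) ^+ 2.
  rewrite /c0 sqrc_norm mulc_conj nc_real ger0_norm ?sqr_ge0//.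
  by rewrite ler_pXn2r ?nnegrE ?sqr_ge0.
have [LN nN] := L2N (L 2%N isT).
have [L1 nn1] := L2Z c1 (L 1%N isT); have [L0 nn0] := L2Z c0 (L 0%N isT).
have [L21 n21] := L2D LN L1; have [L210 n210] := L2D L21 L0.
have E t : (- d j 2%N t + c1 * d j 1%N t) + c0 * d j 0%N t = Lexpr b d j t.
  by rewrite /Lexpr /c1 mulNr.
have <- : (fun t => (- d j 2%N t + c1 * d j 1%N t) + c0 * d j 0%N t) = Lexpr b d j.
  by apply/funext => t; rewrite E.
split=> //; apply: le_trans n210 _.
have p0 := n2_ge0 (d j 0%N); have p1 := n2_ge0 (d j 1%N); have p2 := n2_ge0 (d j 2%N).
have q1 := ler_wpM2r p1 n1; have q0 := ler_wpM2r p0 n0.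
have B20 := sqr_ge0 B; have B40 := sqr_ge0 (B ^+ 2).
have := mulr_ge0 B20 p0; have := mulr_ge0 B20 p2; have := mulr_ge0 B40 p1.
have := mulr_ge0 B40 p2; have := mulr_ge0 B20 p1; have := mulr_ge0 B40 p0; lra.
Qed.

Lemma dom_sum d : dom d -> sm (wt (fun j => n2 (d j 0%N) + n2 (d j 1%N))).
Proof.
move=> D; have s0 := dom_sm D (isT : (0 <= 2)%N); have s1 := dom_sm D (isT : (1 <= 2)%N).
by apply: (@sm_wt_le 1 _ _ _ _ _ _ _ _ s0 s1) => // j _; rewrite ?mul1r ?addr_ge0 ?n2_ge0.
Qed.

Lemma L2a_dom0 d : dom d -> L2a al (fun j => d j 0%N).
Proof.
move=> D; apply/L2aP; split; last exact: (@dom_sm d D 0%N isT).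
by move=> j j0; exact: dom_L2.
Qed.

Lemma L2a_Lexpr d : dom d -> L2a al (Lexpr b d).
Proof.
move=> D; apply/L2aP; split; first by move=> j /(n2_Lexpr D)[].
apply: (@sm_wt_le _ _ _ _ _ _ _ _ _ (dom_sum D) (dom_sm D (isT : (2 <= 2)%N))) => [|j _|j _|j _|j j0].
- shelve.
- exact: n2_ge0.
- by rewrite addr_ge0 ?n2_ge0.
- exact: n2_ge0.
- exact: (n2_Lexpr D j0).2.
Unshelve.
by rewrite mulr_ge0// !addr_ge0// ?mulr_ge0// sqr_ge0.
Qed.

Lemma L2a_ae y y' : L2a al y' -> (forall j, (0 < j)%N -> cmeasurable (y j)) ->
  (forall j, (0 < j)%N -> ae_eq01 (y j) (y' j)) -> L2a al y.
Proof.
move=> /L2aP[L s] my yy; apply/L2aP; split.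
  by move=> j j0; apply: ae_eq_L2 (ae_eq01_sym (yy j j0)) (L j j0); exact: my.
apply: sm_le s => j; first by apply: wt_ge0' => *; exact: n2_ge0.
apply: wt_le' => i i0; rewrite (ae_eq_n2 (my i i0) _ (yy i i0))//.
exact: L2_meas (L i i0).
Qed.

Lemma Lop_L2a y f : Lop T k nu pt b y f -> L2a al y /\ L2a al f.
Proof.
move=> /LopP[d [D my mf]]; split.
  by apply: L2a_ae (L2a_dom0 D) _ _ => j /my[].
by apply: L2a_ae (L2a_Lexpr D) _ _ => j /mf[].
Qed.

(** * End values, Kirchhoff's condition and symmetry *)

Definition uu d (j : nat) (t : R) : C := d j 1%N t + b j * d j 0%N t.

Lemma n2_uu d j : dom d -> (0 < j)%N -> L2 (uu d j) /\
  n2 (uu d j) <= 2 * (1 + B ^+ 2) * (n2 (d j 0%N) + n2 (d j 1%N)).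
Proof.
move=> D j0; have [L n1] := L2Z (b j) (dom_L2 D j0 (isT : (0 <= 2)%N)).
have [LL n] := L2D (dom_L2 D j0 (isT : (1 <= 2)%N)) L; split=> //.
apply: le_trans n _.
have B2 : nc (b j) ^+ 2 <= B ^+ 2 by rewrite ler_pXn2r ?nnegrE ?nc_ge0 ?bB.
have p0 := n2_ge0 (d j 0%N); have p1 := n2_ge0 (d j 1%N).
have q0 := ler_wpM2r p0 B2; have := mulr_ge0 (sqr_ge0 B) p1; lra.
Qed.

Lemma L2a_uu d : dom d -> L2a al (uu d).
Proof.
move=> D; apply/L2aP; split; first by move=> j /(n2_uu D)[].
have s0 := dom_sm D (isT : (0 <= 2)%N); have s1 := dom_sm D (isT : (1 <= 2)%N).
apply: (@sm_wt_le (2 * (1 + B ^+ 2)) _ _ _ _ _ _ _ _ s0 s1) => [|j _|j _|j _|j /(n2_uu D)[_]//].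
- by rewrite mulr_ge0// addr_ge0// sqr_ge0.
- exact: n2_ge0.
- exact: n2_ge0.
- exact: n2_ge0.
Qed.

(** Inserting [ac_bound0] into [ac_bound] gives 4 |F|^2 + 24 |g|^2. *)
Lemma trace_le (F g : R -> C) t : ac F g -> I01 t -> nc (F t) ^+ 2 <= 24 * (n2 F + n2 g).
Proof.
move=> H t01; have := ac_bound H t01; have := ac_bound0 H.
by have := n2_ge0 F; have := n2_ge0 g; lra.
Qed.

Lemma sm_trace (F G : tuples) t : I01 t -> (forall j, (0 < j)%N -> ac (F j) (G j)) ->
  sm (wt (fun j => n2 (F j))) -> sm (wt (fun j => n2 (G j))) ->
  sm (wt (fun j => nc (F j t) ^+ 2)).
Proof.
move=> t01 H s0 s1.
apply: (@sm_wt_le 24 _ _ _ _ _ _ _ _ s0 s1) => // j j0; rewrite ?sqr_ge0 ?n2_ge0//.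
exact: trace_le (H j j0) t01.
Qed.

Lemma sm_uu_trace d t : dom d -> I01 t -> sm (wt (fun j => nc (uu d j t) ^+ 2)).
Proof.
move=> D t01; have s0 := sm_trace t01 (dom_ac0 D) (dom_sm D (isT : (0 <= 2)%N)) (dom_sm D (isT : (1 <= 2)%N)).
have s1 := sm_trace t01 (dom_ac1 D) (dom_sm D (isT : (1 <= 2)%N)) (dom_sm D (isT : (2 <= 2)%N)).
have b0 : 0 <= 2 * (1 + B ^+ 2) by rewrite mulr_ge0// addr_ge0// sqr_ge0.
apply: (@sm_wt_le _ _ _ _ b0 _ _ _ _ s0 s1) => // j j0; rewrite ?sqr_ge0//.
apply: le_trans (nc_sqrD _ _) _; rewrite nc_sqrM.
have B2 : nc (b j) ^+ 2 <= B ^+ 2 by rewrite ler_pXn2r ?nnegrE ?nc_ge0 ?bB.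
have p0 := sqr_ge0 (nc (d j 0%N t)); have p1 := sqr_ge0 (nc (d j 1%N t)).
have q0 := ler_wpM2r p0 B2; have := mulr_ge0 (sqr_ge0 B) p1; lra.
Qed.

Let alS' n : (2 <= n)%N -> al n = pt n * al (k n).
Proof. exact: (alS htree). Qed.

Let ptV_ge0' j n : N1 T j -> 0 <= ptV j n.
Proof. exact: (ptV_ge0 htree hp0 he_range hpt). Qed.

Lemma ptVE j n : N1 T j -> ptV j n = if (0 < n)%N && (k n == j) then al n / al j else 0.
Proof.
move=> jN; rewrite /child_wt; case: ifP => // /andP[n0 /eqP kn].
by rewrite alS' ?(child_ge2 htree jN n0 kn)// kn mulfK// gt_eqF// al_gt0'// (N1_gt0 jN).
Qed.

(** From |x| <= 1 + |x|^2: the weights have total mass 1, and pt_n |x_n|^2 is the alpha-weighted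
    term divided by alpha_j. *)
Lemma cs_ptV j (x : nat -> C) : N1 T j -> sm (wt (fun n => nc (x n) ^+ 2)) ->
  cs (fun n => (ptV j n)%:C * x n).
Proof.
move=> jN s; have aj : 0 < al j by exact: al_gt0' (N1_gt0 jN).
have s1 : sm (ptV j).
  by rewrite /sm (nns_ptV htree hp0 hp1 he_inj he_range hpt)// ltry.
have x0 n : 0 <= wt (fun n => nc (x n) ^+ 2) n by apply: wt_ge0' => *; exact: sqr_ge0.
have ia : 0 <= (al j)^-1 by rewrite invr_ge0 ltW.
have ix n : 0 <= (al j)^-1 * wt (fun n => nc (x n) ^+ 2) n by exact: mulr_ge0.
apply: cs_le (smD (fun n => ptV_ge0' n jN) ix s1 (smZ ia x0 s)) => n.
have p0 := ptV_ge0' n jN; rewrite ncM nc_real ger0_norm//.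
have h : ptV j n * nc (x n) ^+ 2 <= (al j)^-1 * wt (fun n => nc (x n) ^+ 2) n.
  rewrite ptVE//; case: ifP => [/andP[n0 _]|_]; last by rewrite mul0r.
  by rewrite /alpha_wt n0 le_eqVlt; apply/orP; left; apply/eqP; ring.
apply: (le_trans _ (lerD (lexx (ptV j n)) h)).
rewrite -[X in X + _]mulr1 -mulrDr ler_wpM2l//.
by have := sqr_ge0 (nc (x n) - 1); have := nc_ge0 (x n); nra.
Qed.

Lemma cs_ptV_b j : N1 T j -> cs (fun n => (ptV j n)%:C * b n).
Proof.
move=> jN; have s1 : sm (ptV j).
  by rewrite /sm (nns_ptV htree hp0 hp1 he_inj he_range hpt)// ltry.
apply: cs_le (smZ B0 (fun n => ptV_ge0' n jN) s1) => n.
have p0 := ptV_ge0' n jN; rewrite ncM nc_real ger0_norm// mulrC.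
move: p0; rewrite /child_wt; case: ifP => [/andP[n0 _] p0|_ _]; last by rewrite !mulr0.
by rewrite ler_wpM2r// bB.
Qed.

Lemma sum_outE j (x : nat -> C) :
  sum_out k j (fun n => (pt n)%:C * x n) = csum (fun n => (ptV j n)%:C * x n).
Proof.
by apply: eq_csum => n; rewrite /child_wt; case: ifP => // _; rewrite mul0r.
Qed.

(** By continuity y_n(0) = y_j(1) on every edge leaving v_j, so the terms pt_n b_n y_n(0) sum to
    y_j(1) times the series subtracted from b_j in beta_j. The summability hypothesis allows the
    series to be split. *)
Lemma kirchhoff_uu d j : N1 T j ->
  (forall n, (2 <= n)%N -> d (k n) 0%N 1 = d n 0%N 0) ->
  sm (wt (fun n => nc (d n 1%N 0) ^+ 2)) ->
  (d j 1%N 1 + beta k pt b j * d j 0%N 1 =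
      sum_out k j (fun n => (pt n)%:C * d n 1%N 0)) <->
  uu d j 1 = csum (fun n => (ptV j n)%:C * uu d n 0).
Proof.
move=> jN cont s; rewrite /beta !sum_outE.
have E : csum (fun n => (ptV j n)%:C * uu d n 0) =
   csum (fun n => (ptV j n)%:C * d n 1%N 0) +
   d j 0%N 1 * csum (fun n => (ptV j n)%:C * b n).
  rewrite -csumZ; last exact: cs_ptV_b.
  rewrite -csumD; [|exact: cs_ptV|by apply: csZ; exact: cs_ptV_b].
  apply: eq_csum => n; rewrite /child_wt; case: ifP => [/andP[n0 /eqP kn]|_].
    by rewrite /uu -cont ?(child_ge2 htree jN n0 kn)// kn; ring.
  by rewrite !mul0r mulr0 addr0.
rewrite E /uu; split.
  by move=> <-; ring.
move=> h; apply: (addIr (d j 0%N 1 * csum (fun n => (ptV j n)%:C * b n))).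
by rewrite -h; ring.
Qed.

Lemma cs_boundary d d' t : dom d -> dom d' -> I01 t ->
  cs (fun j => if j == 0%N then 0
               else (al j)%:C * (uu d j t * conjc (d' j 0%N t))).
Proof.
move=> D D' t01; have s0 := sm_uu_trace D t01.
have s1 := sm_trace t01 (dom_ac0 D') (dom_sm D' (isT : (0 <= 2)%N)) (dom_sm D' (isT : (1 <= 2)%N)).
apply: (@cs_wt (fun j => 1 * (nc (uu d j t) ^+ 2 + nc (d' j 0%N t) ^+ 2))) => [j j0|].
  by rewrite mul1r -(nc_conj (d' j 0%N t)); exact: nc_mul_le.
by apply: (@sm_wt_le 1 _ _ _ _ _ _ _ _ s0 s1) => // j j0;
  rewrite ?mul1r ?addr_ge0 ?sqr_ge0.
Qed.

(* Kirchhoff's condition, weighted by [alpha_j], exchanges the terms at the end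
   of an edge for those at the beginnings of its children. *)
Lemma boundary_sum d d' : dom d -> dom d' ->
  csum (fun j => if j == 0%N then 0
               else (al j)%:C * (uu d j 1 * conjc (d' j 0%N 1))) =
  csum (fun j => if j == 0%N then 0
               else (al j)%:C * (uu d j 0 * conjc (d' j 0%N 0))).
Proof.
move=> D D'; have cs0' := cs_boundary D D' in01_0.
pose w j := if j == 0%N then 0 : C
               else (al j)%:C * (uu d j 0 * conjc (d' j 0%N 0)).
have [_ ->] := csum_fib k cs0'; rewrite -/w.
have zero j : (forall n, cfib k w j n = 0) -> csum (cfib k w j) = 0.
  by move=> h; rewrite (eq_csum h) csum0.
(* Three cases. Over 0 lies the edge e_1 only, where z_1(0) = 0; a leaf has an empty fibre and
   z_j(1) = 0; at an internal vertex Kirchhoff's condition for y is combined with continuity for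
   z. *)
apply: eq_csum => j; case: (posnP j) => [->|j0].
  rewrite zero// => n; rewrite /cfib /w; case: eqP => // kn; case: eqP => // /eqP.
  rewrite -lt0n => n0; have : out_edges k 0%N n by [].
  rewrite (tree_root htree) => ->.
  by rewrite (bc_root (dom_bc D')) conjc0 !mulr0.
case: (@N1_or_N2 T j j0) => jN; last first.
  rewrite zero ?(bc_leaf (dom_bc D') jN) ?conjc0 ?mulr0//.
  move=> n; rewrite /cfib /w; case: (posnP n) => [_|n0]; first by case: ifP.
  by rewrite (negbTE (parent_N2 htree jN n0)).
have s1 := sm_trace in01_0 (dom_ac1 D) (dom_sm D (isT : (1 <= 2)%N)) (dom_sm D (isT : (2 <= 2)%N)).
have bc := dom_bc D.
have -> : uu d j 1 = csum (fun n => (ptV j n)%:C * uu d n 0).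
  by apply: (kirchhoff_uu jN _ s1).1; [exact: bc_cont bc|exact: bc_kirchhoff bc j jN].
transitivity (((al j)%:C * conjc (d' j 0%N 1)) * csum (fun n => (ptV j n)%:C * uu d n 0)).
  by ring.
rewrite -csumZ; last by apply: cs_ptV => //; exact: sm_uu_trace D in01_0.
apply: eq_csum => n; rewrite /cfib /w /child_wt.
case: (posnP n) => [->|n0] /=; first by rewrite mul0r mulr0; case: ifP.
case: eqP => kn; last by rewrite mul0r mulr0.
have n2 := child_ge2 htree jN n0 kn.
rewrite (alS' n2) kn -(bc_cont (dom_bc D') n2) kn rmorphM/=.
by ring.
Qed.

Lemma green_sum d d' : dom d -> dom d' ->
  ipa al (Lexpr b d) (fun j => d' j 0%N) = ipa al (uu d) (uu d').
Proof.
move=> D D'; have L1 := L2a_uu D; have L2 := L2a_uu D'.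
have B1 := cs_boundary D D' in01_1; have B2 := cs_boundary D D' in01_0.
have E := boundary_sum D D'.
set S1 := (fun j : nat => _) in B1 E; set S0 := (fun j : nat => _) in B2 E.
have -> : ipa al (Lexpr b d) (fun j => d' j 0%N) =
   csum (fun j => (ipt (uu d) (uu d') j + (-1) * S1 j) + S0 j).
  apply: eq_csum => j; rewrite /ipt /S1 /S0; case: (posnP j) => [_|j0].
    by rewrite /= mulr0 !addr0.
  have := green (b j) (dom_ac0 D j0) (dom_ac1 D j0) (dom_ac0 D' j0).
  rewrite /Lexpr => ->.
  by rewrite -/(uu d j 1) -/(uu d j 0) !conjE; ring.
rewrite csumD//; last by apply: csD; [exact: cs_ipt|exact: csZ].
rewrite csumD//; [|exact: cs_ipt|exact: csZ].
by rewrite csumZ// -E mulN1r subrK.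
Qed.

Lemma Lop_form y f z g d d' : dom d -> dom d' ->
  (forall j, (0 < j)%N -> cmeasurable (z j) /\ ae_eq01 (z j) (d' j 0%N)) ->
  (forall j, (0 < j)%N -> cmeasurable (f j) /\ ae_eq01 (f j) (Lexpr b d j)) ->
  ipa al f z = ipa al (uu d) (uu d').
Proof.
move=> D D' mz mf; rewrite -green_sum//; apply: ae_eq_ipa => j j0.
- by split; [case: (mf j j0)|exact: L2_meas (n2_Lexpr D j0).1].
- by split; [case: (mz j j0)|apply: L2_meas; exact: dom_L2].
- by case: (mf j j0).
- by case: (mz j j0).
Qed.

Lemma Lop_symmetric y f z g : Lop T k nu pt b y f -> Lop T k nu pt b z g ->
  ipa al f z = ipa al y g.
Proof.
move=> Hy Hz; have [Ly Lf] := Lop_L2a Hy; have [Lz Lg] := Lop_L2a Hz.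
move: Hy Hz => /LopP[d [D my mf]] /LopP[d' [D' mz mg]].
rewrite (Lop_form y g D D' mz mf) (ipa_conj Lg Ly) (Lop_form z f D' D my mg).
by rewrite (ipa_conj (L2a_uu D) (L2a_uu D')) conjcK.
Qed.

(** * Coercivity of the quadratic form *)

Lemma form_coercive : exists2 K : R, 0 <= K & forall d, dom d ->
  (nns (wt (fun j => n2 (d j 0%N))) <= K%:E * nns (wt (fun j => n2 (uu d j))))%E.
Proof.
have [K K0 HK] := tree_forward htree hp0 hp1 he_inj he_range hpt (C1_ge0 B).
exists (C1 B * (K + 1)); first by rewrite mulr_ge0 ?C1_ge0// addr_ge0.
move=> d D; have bc := dom_bc D.
(* The initial values satisfy the hypotheses of [tree_forward]: continuity makes z_n the end value
   on the parent edge, which [edge_bound] controls. *)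
pose z j := nc (d j 0%N 0) ^+ 2; pose g j := n2 (uu d j).
have uE j : n2 (uu d j) = n2 (fun t => d j 1%N t + b j * d j 0%N t) by [].
have z0 j : (0 < j)%N -> 0 <= z j by move=> _; exact: sqr_ge0.
have g0 j : (0 < j)%N -> 0 <= g j by move=> _; exact: n2_ge0.
have h : (nns (wt z) <= K%:E * nns (wt g))%E.
  apply: HK => //; first by rewrite /z (bc_root bc) nc0 expr0n.
  move=> n n2; have kn := N1_gt0 (parent_N1 htree n2).
  rewrite /z -(bc_cont bc n2) /g.
  by have := edge_bound (bB kn) (dom_ac0 D kn) in01_1.
have wz j : 0 <= wt z j by exact: wt_ge0'.
have wg j : 0 <= wt g j by exact: wt_ge0'.
have wzg j : 0 <= wt z j + wt g j by exact: addr_ge0.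
apply: (@le_trans _ _ ((C1 B)%:E * (nns (wt z) + nns (wt g)))%E).
  rewrite -nnsD// -nnsZ//; apply: le_nns => j.
    by apply: wt_ge0' => *; exact: n2_ge0.
  rewrite -wtZD; apply: wt_le' => i i0.
  by have := edge_bound_n2 (bB i0) (dom_ac0 D i0).
rewrite (EFinM (C1 B) (K + 1)) -muleA; apply: lee_wpmul2l; first by rewrite lee_fin C1_ge0.
by rewrite EFinD ge0_muleDl ?lee_fin// mul1e; apply: leeD2r.
Qed.

Theorem Lop_positive_definite : positive_definite (ipa al) (Lop T k nu pt b).
Proof.
(* The constant K may vanish, so K + 1 is inverted. *)
have [K K0 HK] := form_coercive; exists (K + 1)^-1; split.
  by rewrite invr_gt0 ltr_wpDl.
move=> y f Hy; have [Ly Lf] := Lop_L2a Hy; move: Hy => /LopP[d [D my mf]].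
rewrite (Lop_form y f D D my mf) (ipa_sqr (L2a_uu D)).
have -> : ipa al y y = ipa al (fun j => d j 0%N) (fun j => d j 0%N).
  apply: ae_eq_ipa => j j0; have [m a] := my j j0 => //; split=> //;
    by apply: L2_meas; exact: dom_L2.
rewrite (ipa_sqr (L2a_dom0 D)) -rmorphM lecR.
have := HK d D.
have [/L2aP[_ s0] /L2aP[_ su]] := (L2a_dom0 D, L2a_uu D).
have w0 j : 0 <= wt (fun j => n2 (d j 0%N)) j by apply: wt_ge0' => *; exact: n2_ge0.
have wu j : 0 <= wt (fun j => n2 (uu d j)) j by apply: wt_ge0' => *; exact: n2_ge0.
rewrite (nns_lim w0 s0) (nns_lim wu su) -EFinM lee_fin => h.
have K1 : 0 < K + 1 by rewrite ltr_wpDl.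
rewrite ler_pdivrMl// (le_trans h)// mulrDl lerDl mul1r.
exact: lim_wt_ge0 (L2a_uu D).
Qed.

(** * Density of the domain *)

Lemma sm_fin (N : nat) (w : nat -> R) : (forall j, 0 <= w j) ->
  (forall j, (N <= j)%N -> w j = 0) -> sm w.
Proof.
elim: N w => [|N IH] w w0 h.
  by rewrite /sm /nns eseries0 ?ltry// => j _ _; rewrite h.
have s1 : sm (fun j => if N == j then w N else 0) by rewrite /sm nns_single ?ltry.
have s2 : sm (fun j => if N == j then 0 else w j).
  apply: IH => [j|j Nj]; first by case: ifP.
  case: eqP => // /eqP Nj'; apply: h.
  by rewrite ltn_neqAle Nj' Nj.
apply: sm_le (smD _ _ s1 s2) => j //; try by case: ifP.
by case: eqP => [<-|_]; rewrite ?addr0 ?add0r.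
Qed.

Lemma nns_fin (N : nat) (a : R) : 0 <= a ->
  nns (fun j => if (j < N)%N then a else 0) = (N%:R * a)%:E.
Proof.
move=> a0; elim: N => [|N IH].
  by rewrite mul0r /nns eseries0.
rewrite (@eq_nns _ _ (fun j => (if (j < N)%N then a else 0) + (if N == j then a else 0))).
  rewrite nnsD ?IH ?nns_single//; first by rewrite -EFinD -natr1 mulrDl mul1r.
    by move=> j; case: ifP.
  by move=> j; case: ifP.
move=> j; rewrite ltnS leq_eqVlt eq_sym; case: eqP => [->|_] /=.
  by rewrite ltnn add0r.
by rewrite addr0.
Qed.

(** The components below an index N are approximated by functions vanishing with their derivatives
    at both ends, and the rest are replaced by zero; N is chosen so that the discarded tail is below
    eps / 2. *)
Lemma Lop_densely_defined : densely_defined (L2a al) (ipa al) (Lop T k nu pt b).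
Proof.
move=> x Lx eps e0; have /L2aP[L s] := Lx.
have w0 j : 0 <= wt (fun j => n2 (x j)) j by apply: wt_ge0' => *; exact: n2_ge0.
have e20 : 0 < eps / 2 by rewrite divr_gt0.
have := nneseries_tail_cvg s (fun j _ => w0 j : (0%:E <= (wt (fun j => n2 (x j)) j)%:E)%E).
move=> /fine_cvgP[[N1 _ fN] /cvgrPdist_lt /(_ _ e20)[N2 _ hN]].
pose N := maxn N1 N2.
have tail : (nns (fun j => if (N <= j)%N then wt (fun j => n2 (x j)) j else 0%R) < (eps / 2)%:E)%E.
  have := hN N (leq_maxr _ _); rewrite /= sub0r normrN => h.
  have fin := fN N (leq_maxl _ _).
  rewrite (_ : nns _ = (\sum_(N <= j <oo) (wt (fun j => n2 (x j)) j)%:E)%E); last first.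
    rewrite ereal_series eseries_mkcond; apply: eq_eseriesr => j _.
    by case: ifP.
  by rewrite -(fineK fin) lte_fin (le_lt_trans (ler_norm _) h).
(* At most N edges each contribute less than [eta], in total at most eps / 2; the successor keeps
   the divisor nonzero. *)
pose eta := eps / 2 / N.+1%:R.
have eta0 : 0 < eta by rewrite divr_gt0.
have ch j : exists d : nat -> R -> C, (0 < j)%N ->
   W20 (d 0%N) (d 1%N) (d 2%N) /\ al j * n2 (fun t => x j t - d 0%N t) < eta.
  case: (posnP j) => [_|j0]; first by exists (fun _ _ => 0).
  have aj := al_gt0' j0; have ea : 0 < eta / al j by rewrite divr_gt0.
  have [_ /(_ _ ea)[d0 [d1 [d2 [W lt]]]]] := W20_dense (L j j0).
  exists (fun m => if m == 0%N then d0 else if m == 1%N then d1 else d2) => _.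
  by split=> //=; rewrite mulrC -ltr_pdivlMr.
have [d0 Hd] := choice ch.
pose d (j m : nat) : R -> C := if (j < N)%N then d0 j m else fun=> 0.
have W j : (0 < j)%N -> W20 (d j 0%N) (d j 1%N) (d j 2%N).
  move=> j0; rewrite /d; case: ifP => _; first exact: (Hd j j0).1.
  by split=> //; exact: ac_cst.
have D : dom d.
  split.
  - by move=> j /W[].
  - by move=> j /W[].
  - move=> m _; apply: (@sm_fin N) => j; first by apply: wt_ge0' => *; exact: n2_ge0.
    move=> Nj; rewrite /alpha_wt; case: ifP => // j0; rewrite /d ltnNge Nj /=.
    rewrite /n2 /sqnorm integral0_eq ?mulr0// => t _.
    by rewrite nc0 expr0n.
  split.
  - by have [_ _ [h _] _] := W 1%N isT.
  - move=> j j2; have [_ _ [_ h] _] := W _ (N1_gt0 (parent_N1 htree j2)).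
    by have [_ _ [h' _] _] := W j (ltnW j2); rewrite h h'.
  - by move=> j /andP[/W[_ _ [_ h] _] _].
  - move=> j jN; have [_ _ [_ h] [_ h']] := W _ (N1_gt0 jN).
    rewrite h h' mulr0 addr0 sum_outE; apply/esym; rewrite -[RHS]csum0.
    apply: eq_csum => n; rewrite /child_wt; case: ifP => [/andP[/W[_ _ _ [h0 _]] _]|_].
      by rewrite h0 mulr0.
    by rewrite mul0r.
exists (fun j => d j 0%N), (Lexpr b d); split.
  apply/LopP; exists d; split=> // j j0; split.
  - by apply: L2_meas; exact: dom_L2.
  - exact: eq_ae_eq01.
  - exact: L2_meas (n2_Lexpr D j0).1.
  - exact: eq_ae_eq01.
have Lxd := L2a_B Lx (L2a_dom0 D).
rewrite (ipa_sqr Lxd) ltcR -lte_fin -nns_lim; last 2 first.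
- by move=> j; apply: wt_ge0' => *; exact: n2_ge0.
- by have /L2aP[_] := Lxd.
apply: (@le_lt_trans _ _ (nns (fun j => (if (j < N)%N then eta else 0) +
   (if (N <= j)%N then wt (fun j => n2 (x j)) j else 0)))).
  apply: le_nns => j; first by apply: wt_ge0' => *; exact: n2_ge0.
  rewrite {1}/alpha_wt; case: (posnP j) => [j0|j0].
    by rewrite addr_ge0//; case: ifP => // _; exact: ltW.
  rewrite -[(x - _) j]/(fun t => x j t - d j 0%N t) /d (leqNgt N j); case: ifP => jN /=.
    by rewrite addr0 ltW// (Hd j j0).2.
  rewrite add0r /alpha_wt j0 le_eqVlt; apply/orP; left; apply/eqP; congr (_ * _).
  by apply: eq_n2 => t _; rewrite subr0.
rewrite nnsD; last 2 first.
- by move=> j; case: ifP => // _; exact: ltW.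
- by move=> j; case: ifP.
have tf : nns (fun j => if (N <= j)%N then wt (fun j => n2 (x j)) j else 0) \is a fin_num.
  by rewrite ge0_fin_numE ?(lt_trans tail (ltry _))// nns_ge0// => j; case: ifP.
move: tail; rewrite nns_fin ?(ltW eta0)// -(fineK tf) -EFinD !lte_fin.
have : N%:R * eta <= eps / 2.
  rewrite /eta mulrCA ger_pMr//.
  by rewrite ler_pdivrMr// mul1r ler_nat.
lra.
Qed.

(** * Solving the equation on the tree *)

Lemma lim_series_le0 (w : nat -> R) : (forall n, w n <= 0) -> cvgn (series w) ->
  limn (series w) <= 0.
Proof.
move=> w0 cw; apply: limr_le => //; apply: nearW => n.
by rewrite /series/= sumr_le0.
Qed.

Lemma ptV_N2 j n : N2 T j -> ptV j n = 0.
Proof.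
move=> jN; rewrite /child_wt; case: (posnP n) => //= n0.
by rewrite (negbTE (parent_N2 htree jN n0)).
Qed.

Lemma sm_ptV j : N1 T j -> sm (ptV j).
Proof.
by move=> jN; rewrite /sm (nns_ptV htree hp0 hp1 he_inj he_range hpt)// ltry.
Qed.

Lemma lim_ptV j : N1 T j -> limn (series (ptV j)) = 1.
Proof.
move=> jN; apply: EFin_inj; rewrite -nns_lim; [|by move=> n; exact: ptV_ge0'|exact: sm_ptV].
by rewrite (nns_ptV htree hp0 hp1 he_inj he_range hpt).
Qed.

(* With [m] the sum of [p_n |x_n|], summing [2 m |x_n| <= m^2 + |x_n|^2] against
   the weights [p_n] of total mass 1 gives [m^2 <= sum_n p_n |x_n|^2]. *)
Lemma jensen_ptV j (x : nat -> C) : N1 T j ->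
  sm (fun n => ptV j n * nc (x n) ^+ 2) ->
  nc (csum (fun n => (ptV j n)%:C * x n)) ^+ 2 <=
    4 * limn (series (fun n => ptV j n * nc (x n) ^+ 2)).
Proof.
move=> jN s2; have p0 n := ptV_ge0' n jN; have s1 := sm_ptV jN.
have q2 n : 0 <= ptV j n * nc (x n) ^+ 2 by rewrite mulr_ge0// sqr_ge0.
have q1 n : 0 <= ptV j n * nc (x n) by rewrite mulr_ge0// nc_ge0.
have s : sm (fun n => ptV j n * nc (x n)).
  apply: sm_le (smD p0 q2 s1 s2) => // n.
  rewrite -[X in X + _]mulr1 -mulrDr ler_wpM2l//.
  by have := sqr_ge0 (nc (x n) - 1); have := nc_ge0 (x n); nra.
set L := limn _; pose m := limn (series (fun n => ptV j n * nc (x n))).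
have m0 : 0 <= m by rewrite -lee_fin -nns_lim// nns_ge0.
have mL : m ^+ 2 <= L.
  have a0 n : 0 <= m ^+ 2 * ptV j n by rewrite mulr_ge0// sqr_ge0.
  have b0 n : 0 <= (2 * m) * (ptV j n * nc (x n)) by rewrite mulr_ge0// mulr_ge0.
  have : (nns (fun n => (2 * m) * (ptV j n * nc (x n))%R)%R <=
     nns (fun n => m ^+ 2 * ptV j n + ptV j n * nc (x n) ^+ 2)%R)%E.
    apply: le_nns => // n; rewrite mulrCA (mulrC (m ^+ 2)) -mulrDr ler_wpM2l//.
    by have := sqr_ge0 (nc (x n) - m); lra.
  rewrite nnsD// !nnsZ// !nns_lim// lim_ptV// -!EFinM -EFinD lee_fin -/m -/L; lra.
have xm : nc (csum (fun n => (ptV j n)%:C * x n)) <= 2 * m.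
  by apply: nc_csum_le s => n; rewrite ncM nc_real ger0_norm.
have x0 := nc_ge0 (csum (fun n => (ptV j n)%:C * x n)).
by have := ler_pM x0 x0 xm xm; lra.
Qed.

Section Solve.
Context (E : nat -> R) (P Q : nat -> C).

(** This is e^(b_j) e^(conj(b_j)) = e^(2 Re b_j), with the factor 1 kept to match [cexp_conj_mul] at
    t = 1. *)
Definition rj j : R := expR ((Re (b j) + Re (b j)) * 1).

(* On an edge with initial value [y(0) = a], the solution of the boundary value
   problem on the subtree below has [y'(0) + b y(0) = (dh m j).1 a + (dh m j).2];
   [m] is the number of tiers below the edge. *)
Fixpoint dh (m j : nat) : R * C :=
  match m with
  | 0%N => (- (E j)^-1, ((E j)^-1)%:C * P j)
  | m'.+1 =>
    let D := limn (series (fun n => ptV j n * (dh m' n).1)) in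
    let H := csum (fun n => (ptV j n)%:C * (dh m' n).2) in
    let den := rj j - D * E j in
    (D / den, (den^-1)%:C * ((rj j)%:C * Q j - D%:C * P j + cexp (b j) 1 * H))
  end.

(** Zero at a leaf edge and one more than on the child edges elsewhere; the parent map offers no
    structural recursion from the leaves. *)
Definition fuel j := (T.-1 - nu j)%N.
Definition Dj j := (dh (fuel j) j).1.
Definition hj j := (dh (fuel j) j).2.
(** With [HV], the means over the edges leaving v_j. When c_n = D_n a_n + h_n and a_n = y_j(1) on
    these edges, Kirchhoff's condition reads u_j(1) = DV_j y_j(1) + HV_j. *)
Definition DV j := limn (series (fun n => ptV j n * Dj n)).
Definition HV j := csum (fun n => (ptV j n)%:C * hj n).

Lemma fuel_N2 j : N2 T j -> fuel j = 0%N.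
Proof. by rewrite /fuel => /(tree_leaf htree) <-; rewrite addn1 subnn. Qed.

Lemma fuel_child j n : N1 T j -> (0 < n)%N -> k n = j -> fuel j = (fuel n).+1.
Proof.
move=> jN n0 kn; have n2 := child_ge2 htree jN n0 kn.
have := tree_internal htree jN; rewrite /fuel (nuS htree n2) kn.
by case: (T) hT => [//|t _] /=; lia.
Qed.

Lemma fuel_N1 j : N1 T j -> exists m, fuel j = m.+1.
Proof.
move=> jN; have := tree_internal htree jN; rewrite /fuel.
case: (T) hT => [//|t _] /=; rewrite addn1 subn1 /= => h.
by exists (t - nu j).-1; rewrite prednK// subn_gt0.
Qed.

Lemma dh_internal j : N1 T j ->
  Dj j = DV j / (rj j - DV j * E j) /\
  hj j = ((rj j - DV j * E j)^-1)%:C *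
     ((rj j)%:C * Q j - (DV j)%:C * P j + cexp (b j) 1 * HV j).
Proof.
move=> jN; have [m fm] := fuel_N1 jN.
have e1 : (fun n => ptV j n * (dh m n).1) = (fun n => ptV j n * Dj n).
  apply/funext => n; rewrite /child_wt; case: ifP => [/andP[n0 /eqP kn]|_]; last by rewrite !mul0r.
  by rewrite /Dj; move: (fuel_child jN n0 kn); rewrite fm => -[<-].
have e2 : (fun n => (ptV j n)%:C * (dh m n).2) = (fun n => (ptV j n)%:C * hj n).
  apply/funext => n; rewrite /child_wt; case: ifP => [/andP[n0 /eqP kn]|_]; last by rewrite !mul0r.
  by rewrite /hj; move: (fuel_child jN n0 kn); rewrite fm => -[<-].
by rewrite {1}/Dj {1}/hj fm /= e1 e2.
Qed.

Context (hE : forall j, (0 < j)%N -> expR (- (B + B)) <= E j).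

Let E_gt0 j : (0 < j)%N -> 0 < E j.
Proof. by move=> /hE; apply: lt_le_trans; exact: expR_gt0. Qed.

Let E_inv j : (0 < j)%N -> (E j)^-1 <= expR (B + B).
Proof.
move=> j0; rewrite -[leRHS]invrK -expRN lef_pV2 ?posrE ?expR_gt0 ?E_gt0//.
exact: hE.
Qed.

Lemma rj_bounds j : (0 < j)%N -> expR (- (B + B)) <= rj j <= expR (B + B).
Proof.
move=> j0; rewrite /rj mulr1 !ler_expR.
have := le_trans (Re_le_nc (b j)) (bB j0); rewrite ler_norml => /andP[h1 h2].
by apply/andP; split; lra.
Qed.

(** A mean D of nonpositive numbers is nonpositive, so the denominator r - D E is at least r > 0.
    Moreover -D E <= r - D E, which gives D / (r - D E) >= -1/E, a bound independent of the tier. *)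
Lemma dh_bounds m j : (0 < j)%N -> - expR (B + B) <= (dh m j).1 <= 0.
Proof.
elim: m j => [|m IH] j j0 /=.
  by rewrite lerN2 E_inv//= oppr_le0 invr_ge0 ltW// E_gt0.
set D := limn _; have E0 := E_gt0 j0.
have /andP[r1 _] := rj_bounds j0; have e0 := expR_gt0 (- (B + B)).
have D0 : D <= 0.
  (* The induction covers every value of [m], so a leaf may come with a positive one; its child
     weights vanish and D = 0. *)
  case: (N1_or_N2 T j0) => jN; last first.
    rewrite /D (_ : (fun n => _) = fun=> 0); last first.
      by apply/funext => n; rewrite ptV_N2// mul0r.
    apply: lim_series_le0 => //; apply: (@asm_cvg _ (fun=> 0)).
    by rewrite /asm /sm /nns eseries0 ?ltry// => *; rewrite normr0.
  apply: lim_series_le0 => [n|].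
    rewrite /child_wt; case: ifP => [/andP[n0 /eqP kn]|]; last by rewrite mul0r.
    have n2 := child_ge2 htree jN n0 kn.
    rewrite mulr_ge0_le0//; last by have /andP[] := IH n n0.
    by rewrite ltW// (pt_gt0 htree hp0 he_range hpt).
  apply: asm_cvg; apply: sm_le (smZ (expR_ge0 (B + B)) (fun n => ptV_ge0' n jN) (sm_ptV jN)) => // n.
  rewrite normrM ger0_norm ?ptV_ge0'// mulrC.
  have := ptV_ge0' n jN; rewrite /child_wt; case: ifP => [/andP[n0 _] p0|_ _]; last by rewrite !mulr0.
  rewrite ler_wpM2r//; have /andP[h1 h2] := IH n n0.
  by rewrite ler0_norm// lerNl.
have den : 0 < rj j - D * E j.
  by have := mulr_le0_ge0 D0 (ltW E0); lra.
apply/andP; split; last by rewrite mulr_le0_ge0// invr_ge0 ltW.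
apply: (@le_trans _ _ (- (E j)^-1)); first by rewrite lerN2 E_inv.
rewrite lerNl -mulNr ler_pdivrMr// mulrC ler_pdivlMr//.
by lra.
Qed.

Lemma Dj_bounds j : (0 < j)%N -> - expR (B + B) <= Dj j <= 0.
Proof. exact: dh_bounds. Qed.

Lemma asm_ptV_D j : N1 T j -> asm (fun n => ptV j n * Dj n).
Proof.
move=> jN; apply: sm_le (smZ (expR_ge0 (B + B)) (fun n => ptV_ge0' n jN) (sm_ptV jN)) => // n.
rewrite normrM ger0_norm ?ptV_ge0'// mulrC.
have := ptV_ge0' n jN; rewrite /child_wt; case: ifP => [/andP[n0 _] p0|_ _]; last by rewrite !mulr0.
rewrite ler_wpM2r//; have /andP[h1 h2] := Dj_bounds n0.
by rewrite ler0_norm// lerNl.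
Qed.

Lemma DV_bounds j : N1 T j -> - expR (B + B) <= DV j <= 0.
Proof.
move=> jN; have s := asm_ptV_D jN; apply/andP; split.
  have -> : - expR (B + B) = limn (series (fun n => - expR (B + B) * ptV j n)).
    rewrite -[RHS]/(limn (series ((- expR (B + B)) *: ptV j))) lim_seriesZ.
      by rewrite lim_ptV// /GRing.scale/= mulr1.
    by apply: sm_cvg; [move=> n; exact: ptV_ge0'|exact: sm_ptV].
  apply: lim_series_le.
  - apply: (@is_cvg_seriesZ _ (ptV j)).
    by apply: sm_cvg; [move=> n; exact: ptV_ge0'|exact: sm_ptV].
  - exact: asm_cvg.
  move=> n; rewrite mulrC; have := ptV_ge0' n jN.
  rewrite /child_wt; case: ifP => [/andP[n0 _] p0|_ _]; last by rewrite !mul0r.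
  by rewrite ler_wpM2l//; have /andP[] := Dj_bounds n0.
apply: lim_series_le0 => [n|]; last exact: asm_cvg.
have := ptV_ge0' n jN; rewrite /child_wt; case: ifP => [/andP[n0 _] p0|_ _]; last by rewrite mul0r.
by rewrite mulr_ge0_le0//; have /andP[] := Dj_bounds n0.
Qed.

Lemma den_gt j : N1 T j -> expR (- (B + B)) <= rj j - DV j * E j.
Proof.
move=> jN; have j0 := N1_gt0 jN; have /andP[r1 _] := rj_bounds j0.
have /andP[_ d0] := DV_bounds jN.
by have := mulr_le0_ge0 d0 (ltW (E_gt0 j0)); lra.
Qed.

(** Multiplied by e^(b_j), Kirchhoff's condition becomes r_j (c - Q_j) = DV_j (a + c E_j - P_j) +
    e^(b_j) HV_j. This is linear in c with the positive coefficient r_j - DV_j E_j, and the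
    recursion for D_j and h_j is its solution. *)
Lemma solve_algebra j (a : C) : N1 T j ->
  let c := (Dj j)%:C * a + hj j in
  cexp (conjc (b j)) 1 * (c - Q j) =
    (DV j)%:C * (cexp (- b j) 1 * (a + c * (E j)%:C - P j)) + HV j.
Proof.
move=> jN c; have den := den_gt jN; have e0 := expR_gt0 (- (B + B)).
have d0 : rj j - DV j * E j != 0 by rewrite gt_eqF//; exact: lt_le_trans e0 den.
apply: (mulfI (cexp_neq0 (b j) 1)).
have -> : cexp (b j) 1 * (cexp (conjc (b j)) 1 * (c - Q j)) = (rj j)%:C * (c - Q j).
  by rewrite mulrA; congr (_ * _); exact: cexp_conj_mul.
rewrite [RHS]mulrDr.
rewrite [_ * ((DV j)%:C * _)]mulrCA (mulrA (cexp (b j) 1)) cexpN mul1r.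
have dC : ((rj j)%:C - (DV j)%:C * (E j)%:C : C) != 0.
  by rewrite -rmorphM -rmorphB; apply: contra d0 => /eqP/complexI ->.
have cden : c * ((rj j)%:C - (DV j)%:C * (E j)%:C) =
   (DV j)%:C * a + ((rj j)%:C * Q j - (DV j)%:C * P j + cexp (b j) 1 * HV j).
  rewrite /c; have [-> ->] := dh_internal jN.
  rewrite rmorphM/= !fmorphV rmorphB rmorphM/= mulrDl mulrAC.
  by field.
have : c * (rj j)%:C = c * ((rj j)%:C - (DV j)%:C * (E j)%:C) + (DV j)%:C * (c * (E j)%:C).
  by ring.
rewrite cden => h.
have -> : (rj j)%:C * (c - Q j) = c * (rj j)%:C - (rj j)%:C * Q j by ring.
by rewrite h; ring.
Qed.


Context (F : nat -> R) (K : R) (K0 : 0 <= K) (F0 : forall j, 0 <= F j)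
  (sF : sm (wt F))
  (hP : forall j, (0 < j)%N -> nc (P j) ^+ 2 <= K * F j)
  (hQ : forall j, (0 < j)%N -> nc (Q j) ^+ 2 <= K * F j).

Let nc_sqr_realM (a s : R) (x : C) : 0 <= a <= s ->
  nc (a%:C * x) ^+ 2 <= s ^+ 2 * nc x ^+ 2.
Proof.
move=> /andP[a0 a1]; rewrite nc_sqrM nc_real ger0_norm// ler_wpM2r ?sqr_ge0//.
by rewrite ler_pXn2r ?nnegrE// (le_trans a0).
Qed.

Let h_bound_arith (q p' H X2 X KF L : R) : 0 <= X2 -> 0 <= X -> q <= X2 ^+ 2 * KF ->
  p' <= X2 ^+ 2 * KF -> H <= X * (4 * L) ->
  2 * (2 * (q + p') + H) <= 8 * X2 ^+ 2 * KF + 8 * X * L.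
Proof. by move=> *; lra. Qed.

(** An instance of [tree_backward] with source [F]. The mean over the children is handled by
    [jensen_ptV], and the real factors 1/E_j, r_j, -DV_j and the inverse of the denominator are all
    at most [X2] = e^(2B). *)
Lemma sm_h : sm (wt (fun j => nc (hj j) ^+ 2)).
Proof.
pose X2 := expR (B + B); pose X := expR B ^+ 2.
have X20 : 0 <= X2 by exact: expR_ge0.
have X0 : 0 <= X by exact: sqr_ge0.
(* The summand K serves the leaves; the other two are the coefficients of F_j and of the mean over
   the children at an internal vertex. *)
pose c0 := K + 8 * X2 ^+ 2 * K + 8 * X.
have k8 : 0 <= 8 * X2 ^+ 2 * K.
  by apply: mulr_ge0 => //; apply: mulr_ge0 => //; exact: sqr_ge0.
have x8 : 0 <= 8 * X by apply: mulr_ge0.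
have c00 : 0 <= c0 by apply: addr_ge0 => //; exact: addr_ge0.
apply: (@tree_backward _ _ hT _ _ htree _ hp0 _ he_range _ hpt (X2 ^+ 2 * c0) _ F) => //.
- by rewrite mulr_ge0// sqr_ge0.
- by move=> j _; exact: sqr_ge0.
- move=> j jN; have j0 : (0 < j)%N by case/andP: jN.
  rewrite /hj (fuel_N2 jN) /=.
  have Ei : 0 <= (E j)^-1 <= X2 by rewrite E_inv// invr_ge0 ltW// E_gt0.
  apply: le_trans (nc_sqr_realM _ Ei) _; rewrite -mulrA ler_wpM2l ?sqr_ge0//.
  apply: le_trans (hP j0) _; rewrite ler_wpM2r//.
  by rewrite /c0 -addrA lerDl addr_ge0.
move=> j jN s; have j0 := N1_gt0 jN; have [_ ->] := dh_internal jN.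
have den := den_gt jN; have d0 : 0 < rj j - DV j * E j.
  by apply: lt_le_trans den; exact: expR_gt0.
have Ei : 0 <= (rj j - DV j * E j)^-1 <= X2.
  rewrite invr_ge0 ltW//= -[leRHS]invrK -expRN lef_pV2 ?posrE ?expR_gt0//.
apply: le_trans (nc_sqr_realM _ Ei) _; rewrite -mulrA ler_wpM2l ?sqr_ge0//.
set L := limn _.
have L0 : 0 <= L.
  have p0 n : 0 <= ptV j n * nc (hj n) ^+ 2 by rewrite mulr_ge0 ?ptV_ge0' ?sqr_ge0.
  by rewrite -lee_fin -nns_lim// nns_ge0.
have [/andP[r1 r2] /andP[D1 D2]] := (rj_bounds j0, DV_bounds jN).
have q1 : nc ((rj j)%:C * Q j) ^+ 2 <= X2 ^+ 2 * (K * F j).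
  have rr : 0 <= rj j <= X2 by rewrite expR_ge0.
  apply: le_trans (nc_sqr_realM _ rr) _; rewrite ler_wpM2l ?sqr_ge0//.
  exact: hQ.
have q2 : nc (- ((DV j)%:C * P j)) ^+ 2 <= X2 ^+ 2 * (K * F j).
  have -> : - ((DV j)%:C * P j) = (- DV j)%:C * P j by rewrite rmorphN mulNr.
  have rr : 0 <= - DV j <= X2 by rewrite oppr_ge0 D2 lerNl.
  apply: le_trans (nc_sqr_realM _ rr) _; rewrite ler_wpM2l ?sqr_ge0//.
  exact: hP.
have q3 : nc (cexp (b j) 1 * HV j) ^+ 2 <= X * (4 * L).
  apply: le_trans (nc_sqr_leM _ (nc_cexp_le (bB j0) in01_1)) _.
  by rewrite ler_wpM2l ?sqr_ge0//; exact: jensen_ptV.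
apply: le_trans (nc_sqrD _ _) _.
apply: le_trans (_ : 2 * (2 * (nc ((rj j)%:C * Q j) ^+ 2 + nc (- ((DV j)%:C * P j)) ^+ 2)
   + nc (cexp (b j) 1 * HV j) ^+ 2) <= _).
  by rewrite ler_wpM2l// lerD2r; exact: nc_sqrD.
apply: le_trans (h_bound_arith X20 X0 q1 q2 q3) _.
rewrite mulrDr lerD//.
  rewrite mulrA ler_wpM2r// /c0 [K + _]addrC -addrA lerDl.
  by rewrite addr_ge0.
by rewrite ler_wpM2r// /c0 lerDr addr_ge0.
Qed.

(** The end value y_j(1) when y_j(0) = a and u_j(0) = D_j a + h_j. *)
Definition Yj j (a : C) : C :=
  cexp (- b j) 1 * (a + ((Dj j)%:C * a + hj j) * (E j)%:C - P j).

(** Continuity makes the initial value on an edge the end value on its parent. The recursion climbs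
    [m] steps and stops at e_1, where y_1(0) = 0. *)
Fixpoint afix (m j : nat) : C :=
  if m is m'.+1 then Yj (k j) (afix m' (k j)) else 0.

Definition aj j := afix (nu j) j.
Definition cj j := (Dj j)%:C * aj j + hj j.

Lemma aj1 : aj 1 = 0. Proof. by rewrite /aj (nu1 htree). Qed.

Lemma ajS n : (2 <= n)%N -> aj n = Yj (k n) (aj (k n)).
Proof. by move=> n2; rewrite /aj (nuS htree n2). Qed.

Lemma cj_bound j (a : C) : (0 < j)%N ->
  nc ((Dj j)%:C * a + hj j) ^+ 2 <= 2 * (expR (B + B) ^+ 2 * nc a ^+ 2 + nc (hj j) ^+ 2).
Proof.
move=> j0; apply: le_trans (nc_sqrD _ _) _; rewrite ler_wpM2l// lerD2r.
have /andP[D1 D2] := Dj_bounds j0.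
rewrite nc_sqrM nc_real ler_wpM2r ?sqr_ge0// ler_pXn2r ?nnegrE ?expR_ge0//.
by rewrite ler0_norm// lerNl.
Qed.

Context (KY : R) (KY0 : 0 <= KY)
  (hY : forall j (a c : C), (0 < j)%N ->
    nc (cexp (- b j) 1 * (a + c * (E j)%:C - P j)) ^+ 2 <=
    KY * (nc a ^+ 2 + nc c ^+ 2 + F j)).

Let c_arith (X2 a c h f : R) : 0 <= X2 -> 0 <= a -> 0 <= h -> 0 <= f ->
  c <= 2 * (X2 * a + h) -> a + c + f <= (1 + 2 * X2 + 2) * (a + (h + f)).
Proof.
move=> X20 a0 h0 f0 ch.
by have := mulr_ge0 X20 h0; have := mulr_ge0 X20 f0; lra.
Qed.

(** Once c_j is bounded by [cj_bound], [hY] estimates |a_n|^2 on a child by |a_j|^2 + |h_j|^2 + F_j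
    on its parent, up to a constant: the recursion of [tree_forward]. *)
Lemma sm_a : sm (wt (fun j => nc (aj j) ^+ 2)).
Proof.
pose X2 := expR (B + B) ^+ 2.
have X20 : 0 <= X2 by exact: sqr_ge0.
have c0 : 0 <= KY * (1 + 2 * X2 + 2) by rewrite mulr_ge0// !addr_ge0// mulr_ge0.
have [K' K'0 HK'] := tree_forward htree hp0 hp1 he_inj he_range hpt c0.
pose g j := nc (hj j) ^+ 2 + F j.
have g0 j : (0 < j)%N -> 0 <= g j by move=> _; rewrite addr_ge0 ?sqr_ge0.
have sg : sm (wt g).
  by apply: (@sm_wt_le 1 _ _ _ _ _ _ _ _ sm_h sF) => // j _;
    rewrite ?mul1r ?addr_ge0 ?sqr_ge0.
have wg j : 0 <= wt g j by exact: wt_ge0'.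
apply: le_lt_trans (HK' (fun j => nc (aj j) ^+ 2) g _ g0 _ _) _.
- by move=> j _; exact: sqr_ge0.
- by rewrite aj1 nc0 expr0n.
- move=> n n2; rewrite ajS//; have kn := N1_gt0 (parent_N1 htree n2).
  apply: le_trans (hY _ _ kn) _; rewrite -mulrA ler_wpM2l//.
  by apply: c_arith => //; rewrite ?sqr_ge0//; exact: cj_bound.
by apply: lte_mul_pinfty => //; rewrite ?lee_fin// nns_ge0.
Qed.

Lemma sm_S : sm (wt (fun j => nc (aj j) ^+ 2 + nc (cj j) ^+ 2 + F j)).
Proof.
pose X2 := expR (B + B) ^+ 2.
have X20 : 0 <= X2 by exact: sqr_ge0.
have sg : sm (wt (fun j => nc (hj j) ^+ 2 + F j)).
  by apply: (@sm_wt_le 1 _ _ _ _ _ _ _ _ sm_h sF) => // j _;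
    rewrite ?mul1r ?addr_ge0 ?sqr_ge0.
have c0 : 0 <= 1 + 2 * X2 + 2 by rewrite !addr_ge0// mulr_ge0.
apply: (@sm_wt_le _ _ _ _ c0 _ _ _ _ sm_a sg) => j j0; rewrite ?addr_ge0 ?sqr_ge0//.
by apply: c_arith => //; rewrite ?sqr_ge0//; exact: cj_bound.
Qed.

End Solve.

Lemma Lop_surjective f : L2a al f -> exists y, Lop T k nu pt b y f.
Proof.
move=> /L2aP[Lf sf]; have [K K0 HK] := edge_solve B0.
have ch j : exists EPQ : R * C * C, (0 < j)%N ->
    edge_solver B K (b j) (f j) EPQ.1.1 EPQ.1.2 EPQ.2.
  case: (posnP j) => [_|j0]; first by exists (0, 0, 0).
  by have [E [P [Q H]]] := HK (b j) (f j) (bB j0) (Lf j j0); exists (E, P, Q).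
have [EPQ H] := choice ch.
pose E j := (EPQ j).1.1; pose P j := (EPQ j).1.2; pose Q j := (EPQ j).2.
have {}H j (j0 : (0 < j)%N) : edge_solver B K (b j) (f j) (E j) (P j) (Q j) := H j j0.
have hE j (j0 : (0 < j)%N) : expR (- (B + B)) <= E j := es_E (H j j0).
pose F j := n2 (f j); have F0 j : 0 <= F j by exact: n2_ge0.
have hP j (j0 : (0 < j)%N) : nc (P j) ^+ 2 <= K * F j := es_P (H j j0).
have hQ j (j0 : (0 < j)%N) : nc (Q j) ^+ 2 <= K * F j := es_Q (H j j0).
(* Read off from the bound on the end value of the edge solution with these initial data. *)
have hY j (a c : C) : (0 < j)%N ->
    nc (cexp (- b j) 1 * (a + c * (E j)%:C - P j)) ^+ 2 <=
    K * (nc a ^+ 2 + nc c ^+ 2 + F j).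
  move=> j0; have [d0 [d1 [d2 [_ _ [<- _] _ [_ _ _ h]]]]] := es_sol (H j j0) a c.
  exact: h.
have sS := sm_S hE K0 F0 sf hP hQ K0 hY.
pose a j := aj E P Q j; pose c j := cj E P Q j.
pose S j := nc (a j) ^+ 2 + nc (c j) ^+ 2 + F j.
have chd j : exists d : nat -> R -> C, (0 < j)%N ->
    [/\ ac (d 0%N) (d 1%N) /\ ac (d 1%N) (d 2%N),
        d 0%N 0 = a j /\ d 1%N 0 + b j * d 0%N 0 = c j,
        d 0%N 1 = cexp (- b j) 1 * (a j + c j * (E j)%:C - P j) /\
          d 1%N 1 + b j * d 0%N 1 = cexp (conjc (b j)) 1 * (c j - Q j),
        (forall t, - d 2%N t - 2%:R * 'i * (Im (b j))%:C * d 1%N t +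
            `|b j| ^+ 2 * d 0%N t = f j t) &
        forall m, (m <= 2)%N -> n2 (d m) <= K * S j].
  case: (posnP j) => [_|j0]; first by exists (fun _ _ => 0).
  have [d0 [d1 [d2 [h1 h2 h3 h4 [g0 g1 g2 _]]]]] := es_sol (H j j0) (a j) (c j).
  exists (fun m => if m == 0%N then d0 else if m == 1%N then d1 else d2) => _.
  by split=> // -[|[|[|m]]].
have [d Hd] := choice chd.
have S0 j : 0 <= S j by rewrite !addr_ge0 ?sqr_ge0.
have smd m : (m <= 2)%N -> sm (wt (fun j => n2 (d j m))).
  move=> m2; apply: (@sm_wt_le K _ _ (fun=> 0) K0 _ _ _ _ sS) => //.
  - by move=> j _; exact: n2_ge0.
  - by move=> j _; exact: S0.
  - by move=> j j0; rewrite addr0; have [_ _ _ _ h] := Hd j j0; exact: h.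
  - rewrite /sm /nns eseries0 ?ltry// => j _ _.
    by rewrite /alpha_wt mulr0 if_same.
have cont n : (2 <= n)%N -> d (k n) 0%N 1 = d n 0%N 0.
  move=> n2; have kn := N1_gt0 (parent_N1 htree n2).
  have [_ _ [-> _] _ _] := Hd _ kn; have [_ [-> _] _ _ _] := Hd _ (ltnW n2).
  by rewrite /a (ajS E P Q n2).
have ac1 j : (0 < j)%N -> ac (d j 1%N) (d j 2%N) by move=> /Hd[[]].
have ac0 j : (0 < j)%N -> ac (d j 0%N) (d j 1%N) by move=> /Hd[[]].
have s1 := sm_trace in01_0 ac1 (smd 1%N isT) (smd 2%N isT).
have uu0 j : (0 < j)%N -> uu d j 0 = c j by move=> /Hd[_ [_ <-]].
have D : dom d.
  split=> //; split=> //.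
  - by have [_ [-> _] _ _ _] := Hd 1%N isT; exact: aj1.
  - move=> j jN; have j0 : (0 < j)%N by case/andP: jN.
    have [_ _ [-> _] _ _] := Hd j j0.
    have Ej : (E j)%:C != 0 :> C.
      apply/eqP => /complexI E0; have := hE j j0.
      by rewrite E0 leNgt expR_gt0.
    (* At a leaf the recursion starts with D = -1/E and h = P/E, that is c = (P - a)/E, which makes
       a + c E - P vanish. *)
    rewrite /c /cj /Dj /hj (fuel_N2 jN)/= -/(a j) rmorphN fmorphV.
    by apply/eqP; rewrite mulf_eq0; apply/orP; right; apply/eqP; field.
  move=> j jN; have j0 := N1_gt0 jN; apply/(kirchhoff_uu jN cont s1).
  have [_ _ [d01 u1] _ _] := Hd j j0.
  rewrite [LHS]u1 (solve_algebra _ _ hE)// -/(a j) -/(cj E P Q j) -/(c j) -d01.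
  have sDV : cs (fun n => ((ptV j n * Dj E P Q n)%:C : C)).
    apply: cs_le (asm_ptV_D _ _ hE jN) => n.
    by rewrite nc_real.
  have sh := cs_ptV jN (sm_h hE K0 F0 sf hP hQ).
  rewrite /DV -csum_real mulrC -csumZ// /HV -csumD//; last exact: csZ.
  apply: eq_csum => n; rewrite /child_wt; case: ifP => [/andP[n0 /eqP kn]|_].
    have n2 := child_ge2 htree jN n0 kn; rewrite uu0// /c /cj.
    have -> : d j 0%N 1 = aj E P Q n.
      by rewrite -kn cont//; have [_ [-> _] _ _ _] := Hd n n0.
    by rewrite rmorphM/=; ring.
  by rewrite !mul0r mulr0 addr0.
exists (fun j => d j 0%N); apply/LopP; exists d; split=> // j j0.
  by split; [apply: L2_meas; exact: dom_L2|exact: eq_ae_eq01].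
split; first exact: L2_meas (Lf j j0).
apply: eq_ae_eq01 => t _; have [_ _ _ <- _] := Hd j j0.
by [].
Qed.

(** * From symmetry and surjectivity to self-adjointness *)

Lemma ipa_Bl y y' z : L2a al y -> L2a al y' -> L2a al z ->
  ipa al (y - y') z = ipa al y z - ipa al y' z.
Proof.
move=> Ly Ly' Lz; rewrite -[y - y']addrC -scaleN1r ipa_linl//.
by rewrite mulN1r addrC.
Qed.

Lemma null_ae y y' : L2a al y -> L2a al y' -> null (ipa al) (y - y') ->
  forall j, (0 < j)%N -> ae_eq01 (y j) (y' j).
Proof.
move=> Ly Ly' ny j j0; have LB := L2a_B Ly Ly'.
have n0 := (nullP LB).1 ny j j0; have /L2aP[/(_ _ j0) L _] := LB.
have := ae_eq01_D (n2_eq0 L n0) (eq_ae_eq01 (fun t _ => erefl (y' j t))).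
rewrite (_ : (fun t => (y - y') j t + y' j t) = y j); last first.
  by apply/funext => t; rewrite -[(y - y') j t]/(y j t - y' j t) subrK.
by rewrite (_ : (fun t => 0 + y' j t) = y' j)//; apply/funext => t; rewrite add0r.
Qed.

Lemma ipa_0l z : L2a al z -> ipa al 0 z = 0.
Proof.
move=> Lz; have := ipa_Bl L2a_0 L2a_0 Lz.
by rewrite !subrr.
Qed.

Lemma ipa_null y z : L2a al y -> L2a al z -> null (ipa al) y -> ipa al y z = 0.
Proof.
move=> Ly Lz; rewrite -{1}[y]subr0 => /(null_ae Ly L2a_0) ny.
have /L2aP[Lyj _] := Ly; have /L2aP[L0j _] := L2a_0; have /L2aP[Lzj _] := Lz.
rewrite -(ipa_0l Lz); apply: ae_eq_ipa => j j0.
- by split; apply: L2_meas; [exact: Lyj|exact: L0j].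
- by split; apply: L2_meas; exact: Lzj.
- exact: ny.
- exact: eq_ae_eq01.
Qed.

(** If |x|^2 > 0, some y in the domain has |x - y|^2 < |x|^2; but orthogonality gives |x - y|^2 =
    |x|^2 + |y|^2. *)
Lemma dense_null x : L2a al x ->
  (forall y f, Lop T k nu pt b y f -> ipa al x y = 0) -> null (ipa al) x.
Proof.
move=> Lx H; rewrite /null ipa_sqr//.
set r := limn _; have r0 : 0 <= r by exact: lim_wt_ge0.
case: (ltgtP r 0) r0 => // [r0 _|-> //].
have [y [f [Hy]]] := Lop_densely_defined Lx r0; have [Ly _] := Lop_L2a Hy.
have xy := H _ _ Hy; have yx := ipa_conj Lx Ly; rewrite xy conjc0 in yx.
have LB := L2a_B Lx Ly.
rewrite ipa_Br// !ipa_Bl// xy yx subr0 sub0r opprK ipa_sqr// (ipa_sqr Ly) -rmorphD/=.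
by rewrite ltcR gtrDl ltNge lim_wt_ge0.
Qed.

Lemma dom_0 : dom (fun _ _ _ => 0).
Proof.
split; try by move=> j _; exact: ac_cst.
  by move=> m _; have /L2aP[] := L2a_0.
split=> // j jN; rewrite mulr0 addr0 sum_outE -[LHS]csum0.
by apply: eq_csum => n; rewrite mulr0.
Qed.

(** Kirchhoff's condition is transferred in the form of [kirchhoff_uu], whose series converge
    absolutely and may be combined. *)
Lemma dom_lin (a : C) d d' : dom d -> dom d' ->
  dom (fun j m t => a * d j m t + d' j m t).
Proof.
move=> D D'; pose D2 j m t := a * d j m t + d' j m t.
have A0 j (j0 : (0 < j)%N) : ac (D2 j 0%N) (D2 j 1%N).
  exact: acD (acZ a (dom_ac0 D j0)) (dom_ac0 D' j0).
have A1 j (j0 : (0 < j)%N) : ac (D2 j 1%N) (D2 j 2%N).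
  exact: acD (acZ a (dom_ac1 D j0)) (dom_ac1 D' j0).
have S m (m2 : (m <= 2)%N) : sm (wt (fun j => n2 (D2 j m))).
  have L e' (De : dom e') : L2a al (fun j => e' j m).
    by apply/L2aP; split; [move=> j j0; exact: dom_L2|exact: dom_sm].
  by have /L2aP[_] := L2a_lin a (L _ D) (L _ D').
have cont n : (2 <= n)%N -> D2 (k n) 0%N 1 = D2 n 0%N 0.
  by move=> n2; rewrite /D2 (bc_cont (dom_bc D) n2) (bc_cont (dom_bc D') n2).
split=> //; split=> //.
- by rewrite (bc_root (dom_bc D)) (bc_root (dom_bc D')) mulr0 addr0.
- by move=> j jN; rewrite (bc_leaf (dom_bc D) jN) (bc_leaf (dom_bc D') jN) mulr0 addr0.
have K e' j (De : dom e') (jN : N1 T j) : uu e' j 1 = csum (fun n => (ptV j n)%:C * uu e' n 0).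
  apply: (kirchhoff_uu jN (bc_cont (dom_bc De)) _).1; last exact: bc_kirchhoff (dom_bc De) _ jN.
  exact: sm_trace in01_0 (dom_ac1 De) (dom_sm De (isT : (1 <= 2)%N)) (dom_sm De (isT : (2 <= 2)%N)).
have cU e' j (De : dom e') (jN : N1 T j) : cs (fun n => (ptV j n)%:C * uu e' n 0).
  by apply: cs_ptV => //; exact: sm_uu_trace De in01_0.
move=> j jN; apply/(kirchhoff_uu jN cont).
  exact: sm_trace in01_0 A1 (S 1%N isT) (S 2%N isT).
have -> : uu D2 j 1 = a * uu d j 1 + uu d' j 1 by rewrite /uu /D2; ring.
rewrite (K d)// (K d')// -csumZ; last exact: cU.
rewrite -csumD; [|by apply: csZ; exact: cU|exact: cU].
by apply: eq_csum => n; rewrite /uu /D2; ring.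
Qed.

Lemma Lop_zero : Lop T k nu pt b 0 0.
Proof.
apply/LopP; exists (fun _ _ _ => 0); split; first exact: dom_0.
  by move=> j j0; split; [exact: cmeasurable_cst|exact: eq_ae_eq01].
move=> j j0; split; first exact: cmeasurable_cst.
by apply: eq_ae_eq01 => t _; rewrite /Lexpr !mulr0 oppr0 !addr0.
Qed.

Lemma Lop_linear (a : C) y f z g : Lop T k nu pt b y f -> Lop T k nu pt b z g ->
  Lop T k nu pt b (a *: y + z) (a *: f + g).
Proof.
move=> Hy Hz; have [Ly Lf] := Lop_L2a Hy; have [Lz Lg] := Lop_L2a Hz.
have /L2aP[My _] := L2a_lin a Ly Lz; have /L2aP[Mf _] := L2a_lin a Lf Lg.
move: Hy Hz => /LopP[d [D my mf]] /LopP[d' [D' mz mg]].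
have lin (u u' v v' : R -> C) : ae_eq01 u u' -> ae_eq01 v v' ->
    ae_eq01 (fun t => a * u t + v t) (fun t => a * u' t + v' t).
  by move=> uu' vv'; apply: ae_eq01_D => //; apply: ae_eq01_M => //; exact: eq_ae_eq01.
apply/LopP; exists (fun j m t => a * d j m t + d' j m t); split; first exact: dom_lin.
  move=> j j0; split; first exact: L2_meas (My _ j0).
  exact: lin (my j j0).2 (mz j j0).2.
move=> j j0; split; first exact: L2_meas (Mf _ j0).
apply: ae_eq01_trans (lin _ _ _ _ (mf j j0).2 (mg j j0).2) _.
by apply: eq_ae_eq01 => t _; rewrite /Lexpr; ring.
Qed.

Lemma Lop_compat y f y' f' : Lop T k nu pt b y f -> L2a al y' -> L2a al f' ->
  null (ipa al) (y - y') -> null (ipa al) (f - f') -> Lop T k nu pt b y' f'.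
Proof.
move=> Hy Ly' Lf' ny nf; have [Ly Lf] := Lop_L2a Hy.
have yy := null_ae Ly Ly' ny; have ff := null_ae Lf Lf' nf.
have /L2aP[My _] := Ly'; have /L2aP[Mf _] := Lf'.
move: Hy => /LopP[d [D my mf]]; apply/LopP; exists d; split=> // j j0.
  split; first exact: L2_meas (My _ j0).
  exact: ae_eq01_trans (ae_eq01_sym (yy j j0)) (my j j0).2.
split; first exact: L2_meas (Mf _ j0).
exact: ae_eq01_trans (ae_eq01_sym (ff j j0)) (mf j j0).2.
Qed.

Lemma Lop_B y f z g : Lop T k nu pt b y f -> Lop T k nu pt b z g ->
  Lop T k nu pt b (y - z) (f - g).
Proof.
by move=> Hy Hz; have := Lop_linear (-1) Hz Hy; rewrite !scaleN1r ![- _ + _]addrC.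
Qed.

(* A densely defined symmetric operator is single-valued, and it has no proper
   symmetric extension when it is onto. *)
Lemma Lop_self_adjoint : self_adjoint (L2a al) (ipa al) (Lop T k nu pt b).
Proof.
split; [split|exact: Lop_densely_defined|].
- exact: Lop_L2a.
- exact: Lop_zero.
- by move=> a y f z g; exact: Lop_linear.
- by move=> y f y' f'; exact: Lop_compat.
(* The difference lies in the graph with a null first component, so by symmetry its image is
   orthogonal to the whole domain. *)
- move=> y f y' f' Hy Hy' ny; have Hd := Lop_B Hy Hy'.
  have [Ld Lfd] := Lop_L2a Hd; apply: (dense_null Lfd) => z g Hz.
  have [_ Lg] := Lop_L2a Hz; rewrite (Lop_symmetric Hd Hz).
  exact: (ipa_null Ld Lg ny).
move=> z g; split=> [Hz|[Lz Lg adj]].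
  have [Lz Lg] := Lop_L2a Hz; split; [exact: Lz|exact: Lg|].
  by move=> y f Hy; exact: (Lop_symmetric Hy Hz).
(* Take L w = g and L v = w - z. Then |w - z|^2 = <L v, w> - <L v, z> = <v, g> - <v, g> = 0, by
   symmetry for w and by the adjoint relation for z. *)
have [w Hw] := Lop_surjective Lg; have [Lw _] := Lop_L2a Hw.
have Lwz := L2a_B Lw Lz; have [v Hv] := Lop_surjective Lwz.
apply: (Lop_compat Hw Lz Lg); last by rewrite subrr; exact: ipa_0l L2a_0.
rewrite /null (ipa_Br Lwz Lw Lz) (adj _ _ Hv) (Lop_symmetric Hv Hw).
exact: subrr.
Qed.

End Operator.

Unset Implicit Arguments.
Set Strict Implicit.
Set Printing Implicit Defensive.
Local Close Scope complex_scope.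

Theorem mainTheorem2 (R : realType) (T : nat) (hT : (2 <= T)%N)
    (k nu : nat -> nat) (htree : is_tree T k nu)
    (* theta l and p l stand for the terms of index l + 1 *)
    (theta : nat -> R[i]) (M : R)
    (htheta : forall l : nat, `|theta l| <= (M%:C)%C)
    (p : nat -> R) (hp0 : forall l : nat, 0 < p l)
    (hp1 : (series p : nat -> R) @ \oo --> (1 : R))
    (e : nat -> nat -> nat)
    (he_inj : forall j : nat, N1 T j -> injective (e j))
    (he_range : forall j : nat, N1 T j -> range (e j) = out_edges k j)
    (* b 1 is arbitrary; b 0, pt 0 and pt 1 are not used *)
    (b : nat -> R[i]) (pt : nat -> R)
    (hb : forall j l : nat, N1 T j -> b (e j l) = theta l)
    (hpt : forall j l : nat, N1 T j -> pt (e j l) = p l) :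
  self_adjoint (L2a (alpha k nu pt)) (ipa (alpha k nu pt)) (Lop T k nu pt b) /\
  positive_definite (ipa (alpha k nu pt)) (Lop T k nu pt b).
Proof.
(* The coefficient b_1 is not among the theta_l and enters the bound separately; |M| makes
   nonnegativity immediate. *)
have bB j : (0 < j)%N -> Normc.normc (b j) <= Normc.normc (b 1%N) + `|M|.
  rewrite leq_eqVlt => /predU1P[<-|j2]; first by rewrite lerDl.
  have [l ->] := edge_index htree he_range j2.
  rewrite hb; last exact: (parent_N1 htree j2).
  have := htheta l; rewrite normr_nc lecR => /le_trans; apply.
  by rewrite (le_trans (ler_norm M))// lerDr nc_ge0.
have B0 : 0 <= Normc.normc (b 1%N) + `|M| by rewrite addr_ge0// nc_ge0.
split; first exact: (Lop_self_adjoint hT htree hp0 hp1 he_inj he_range hpt B0 bB).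
exact: (Lop_positive_definite htree hp0 hp1 he_inj he_range hpt B0 bB).
Qed.
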